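(* Let $d_0,e>0$, let $\alpha,\beta,\delta\in(0,d_0)$ with $\epsilon_0:=\frac32\beta-\alpha-d_0-\frac72\delta>0$, let $\epsilon\in(0,\epsilon_0)$, and let $n=n(N)$ be an integer-valued function of $N$ with $N^{d_0}/(\log N)^e\le n(N)\le N^{d_0}(\log N)^e$. Then there exists $C$ (depending on all parameters except $N$) such that, for every sufficiently large $N\in\mathbb N$, with probability at least $1-CN^{-\epsilon}$ one can find in $\mathbf T^n$ rooted subtrees $T_1,\dots,T_m$ ($m$ is also random), where $T_i$ is rooted at $v_i$, the unique vertex of $T_i$ closest to the root $o$ of $\mathbf T^n$, satisfying the following: 1. For every $i\in\{1,\dots,m\}$, $N^{\beta-2\delta}/(\log N)^{1.01}\le|T_i|\le N^\beta$, and the distance between $v_i$ and $o$ is at least $\lfloor N^\alpha\rfloor$. 2. Let $\hat T$ be the graph generated by all edges of $\mathbf T^n$ not in any $T_i$. Then $\hat T$ is a tree and $|\hat T|\le n/N^\delta$. 3. Let $\iota_i$ ($i=1,\dots,m$) be the unique path of length $\lfloor N^\alpha\rfloor$ starting from $v_i$ towards the root $o$ of $\mathbf T^n$. Then for any $i\in\{1,\dots,m\}$, all $T_j$ except $T_i$ are in the same component of $\mathbf T^n\setminus\iota_i$. 4. Conditionally on (the event that the subtrees are found and on) $\{m;|T_1|,\dots,|T_m|;\hat T\}$, and even on the locations of the $v_i$ in $\hat T$, the trees $T_i$ are independent and each $T_i$ is distributed as the Galton–Watson tree conditioned on having size $|T_i|$.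
   Context: $\mu$ is a probability measure on $\mathbb N=\{0,1,2,\dots\}$ with mean one, variance $\sigma^2>0$, finite exponential moments ($\sum_i c^i\mu(i)<\infty$ for some $c>1$) and span $1$ ($\gcd\{i:\mu(i)>0\}=1$). Trees are plane (rooted ordered) trees; $|T|$ denotes the number of vertices of $T$; distances are graph distances. $\mathbf T$ is the Galton–Watson tree with offspring law $\mu$, and $\mathbf T^n$, the Galton–Watson tree with size $n$, is $\mathbf T$ conditioned on $|\mathbf T|=n$. *)

(* Defs.v *)
From HB Require Import structures.
From mathcomp Require Import all_boot all_order all_algebra finmap.
From mathcomp Require Import all_classical all_reals all_analysis.
Set Implicit Arguments.
Unset Strict Implicit.
Unset Printing Implicit Defensive.
Import Order.TTheory GRing.Theory Num.Theory.
Import numFieldNormedType.Exports.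
Local Open Scope classical_set_scope.
Local Open Scope ring_scope.

Inductive ptree : Type := Node of seq ptree.

Section PtreeCountable.

Fixpoint ptree_enc (t : ptree) : GenTree.tree void :=
  let: Node ts := t in GenTree.Node 0 (map ptree_enc ts).

Fixpoint ptree_dec (g : GenTree.tree void) : ptree :=
  match g with
  | GenTree.Leaf _ => Node [::]
  | GenTree.Node _ gs => Node (map ptree_dec gs)
  end.

Lemma ptree_encK : cancel ptree_enc ptree_dec.
Proof.
rewrite /cancel; fix IH 1 => -[ts] /=; congr Node.
by elim: ts => //= t ts IHts; rewrite IH IHts.
Qed.

End PtreeCountable.

HB.instance Definition _ := Countable.copy ptree (can_type ptree_encK).
HB.instance Definition _ := isPointed.Build ptree (Node [::]).
HB.instance Definition _ := @isMeasurable.Build default_measure_display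
  ptree discrete_measurable discrete_measurable0
  discrete_measurableC discrete_measurableU.

(* Vertices are Ulam-Harris words: the root o is [::], and the children of u
   are rcons u 0, rcons u 1, ... from left to right.  Thus the graph distance
   of u to the root is size u. *)
Definition word := seq nat.

Fixpoint ptree_words (t : ptree) : seq word :=
  let: Node ts := t in
  [::] :: flatten [seq [seq p.1 :: u | u <- p.2]
                  | p <- zip (iota 0 (size ts)) (map ptree_words ts)].

Definition verts (t : ptree) : {fset word} := [fset u in ptree_words t]%fset.

Section GaltonWatson.
Context {R : realType}.
Implicit Type mu : probability nat R.

(* The branching property: the root has k children with probability mu k and,
   given this, the subtrees grafted on the children are i.i.d. copies. *)
Fixpoint gw_weight mu (t : ptree) : R :=
  let: Node ts := t in
  fine (mu [set size ts]) * \prod_(w <- map (gw_weight mu) ts) w.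

Lemma gw_weight_ge0 mu t : 0 <= gw_weight mu t.
Proof.
move: t; fix IH 1 => -[ts] /=; apply: mulr_ge0; first exact: fine_ge0.
elim: ts => [|t ts IHts] /=; first by rewrite big_nil.
by rewrite big_cons mulr_ge0.
Qed.

Definition gw_law mu (A : set ptree) : \bar R :=
  (\esum_(t in A) (gw_weight mu t)%:E)%E.

Section GwLawMeasure.
Variable mu : probability nat R.

Let gw_law0 : gw_law mu set0 = 0%E.
Proof. exact: esum_set0. Qed.

Let gw_law_ge0 A : (0 <= gw_law mu A)%E.
Proof. by apply: esum_ge0 => t _; rewrite lee_fin gw_weight_ge0. Qed.

Let gw_law_sigma_additive : semi_sigma_additive (gw_law mu).
Proof.
move=> F _ tF _; rewrite [X in _ --> X]nneseries_sum_bigcup//.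
  by apply: is_cvg_nneseries => i _ _; exact: gw_law_ge0.
by move=> t; rewrite lee_fin gw_weight_ge0.
Qed.

HB.instance Definition _ := isMeasure.Build _ _ _ (gw_law mu)
  gw_law0 gw_law_ge0 gw_law_sigma_additive.

End GwLawMeasure.

Definition of_size (n : nat) : set ptree := [set t | #|` verts t| = n].

Lemma measurable_of_size n : measurable (of_size n).
Proof. by []. Qed.

(* The law of the Galton-Watson tree with size n.  If no tree of size n has
   positive weight, there is nothing to condition on, and mnormalize returns
   its second argument, the Dirac mass at the one-vertex tree. *)
Definition gw_cond mu (n : nat) : probability ptree R :=
  mnormalize (mrestr (gw_law mu) (measurable_of_size n)) (dirac (Node [::])).

Definition cond_pr d (T : measurableType d) (P : probability T R)
  (A B : set T) : R := fine (P (A `&` B)) / fine (P B).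

End GaltonWatson.

Definition is_gcd (A : set nat) (g : nat) : Prop :=
  (forall i, A i -> g %| i)%N /\
  (forall d, (forall i, A i -> d %| i) -> d %| g)%N.

Section Graphs.
Implicit Types (V S : {fset word}) (e : rel word) (u v x y : word).

Definition joined e x y : Prop := exists p, path e x p /\ last x p = y.

Definition is_tree V e : Prop :=
  (exists x, x \in V) /\
  (forall x y, x \in V -> y \in V ->
     exists! p, [/\ path e x p, uniq (x :: p) & last x p = y]).

Definition parent_of x y : bool := (y != [::]) && (x == take (size y).-1 y).

Definition tree_edge (t : ptree) : rel word := fun x y =>
  [&& x \in verts t, y \in verts t & parent_of x y || parent_of y x].

(* The component structure of t with the vertices in I (and all edges incident
   to them) removed. *)
Definition same_component (t : ptree) (I : pred word) x y : Prop :=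
  [/\ x \in verts t, ~~ I x, y \in verts t, ~~ I y &
      joined (fun a b => [&& ~~ I a, ~~ I b & tree_edge t a b]) x y].

(* A subgraph of a tree that is itself a tree contains every edge between two
   of its vertices, so it is given by its vertex set; v is its vertex closest
   to o. *)
Definition is_rooted_subtree (t : ptree) v S : Prop :=
  [/\ (S `<=` verts t)%fset,
      is_tree S (fun x y => [&& x \in S, y \in S & tree_edge t x y]),
      v \in S & forall u, u \in S -> u != v -> (size v < size u)%N].

(* The vertices of the path of length l from v towards the root. *)
Definition ancestral_path v (l : nat) : pred word :=
  fun u => prefix u v && (size v <= size u + l)%N.

(* A subtree S rooted at v is a plane tree for the order inherited from the
   ambient tree.  relabel S v sends a vertex of S to its word in that plane
   tree: each letter becomes the number of elder siblings that lie in S. *)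
Definition relabel S v (u : word) : word :=
  [seq count (fun j => rcons (take k u) j \in S) (iota 0 (nth 0%N u k))
  | k <- iota (size v) (size u - size v)].

Definition shape S v : {fset word} := [fset relabel S v u | u in S]%fset.

End Graphs.

(* T_1, ..., T_m, each given by its root v_i and its vertex set. *)
Definition subtree_seq := seq (word * {fset word}).

Definition sroot (s : subtree_seq) (i : nat) : word := (nth ([::], fset0) s i).1.
Definition sverts (s : subtree_seq) (i : nat) : {fset word} :=
  (nth ([::], fset0) s i).2.

Definition hat_edge (t : ptree) (s : subtree_seq) : rel word := fun x y =>
  tree_edge t x y && all (fun p => ~~ ((x \in p.2) && (y \in p.2))) s.

Definition hat_verts (t : ptree) (s : subtree_seq) : {fset word} :=
  [fset x in verts t | has (hat_edge t s x) (ptree_words t)]%fset.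

(* The conditioning data: \hat T as a plane tree, the sizes of the T_i (hence also m), and the
   locations of the v_i in \hat T. *)
Definition skeleton (t : ptree) (s : subtree_seq) :
    {fset word} * seq nat * seq word :=
  let H := hat_verts t s in
  (shape H [::], [seq #|` p.2| | p <- s], [seq relabel H [::] p.1 | p <- s]).

Definition skeleton_event (D : ptree -> option subtree_seq)
    (c : {fset word} * seq nat * seq word) : set ptree :=
  [set t | exists2 s, D t = Some s & skeleton t s = c].

(* T_i, as a plane tree, belongs to A i for each i. *)
Definition shapes_event (D : ptree -> option subtree_seq)
    (A : nat -> set ptree) : set ptree :=
  [set t | exists2 s, D t = Some s & forall i, (i < size s)%N ->
     exists2 tau, A i tau & verts tau = shape (sverts s i) (sroot s i)].

(* Main.v *)
Require Import Defs.
From HB Require Import structures.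
From mathcomp Require Import all_boot all_order all_algebra finmap.
From mathcomp Require Import all_classical all_reals all_analysis.
From mathcomp Require Import ring lra zify.
Set Implicit Arguments.
Unset Strict Implicit.
Unset Printing Implicit Defensive.
Import Order.TTheory GRing.Theory Num.Theory.
Import numFieldNormedType.Exports.
Local Open Scope classical_set_scope.
Local Open Scope ring_scope.

(** Fix a threshold x of order N^(beta - 2 delta) / (log N)^1.01, a cap M of order N^beta and
    l = floor (N^alpha), and explore the tree from the root with a counter k that starts at 0.  A
    vertex reached with k = 0 whose fringe subtree has size between x and M is chosen, and that
    fringe subtree is one of the T_i.  Otherwise, if its fringe subtree has size at least x, its
    children are explored, with counter l if at least two of them carry subtrees of size at least
    x, and with counter k - 1 if not.  Two chosen vertices are thus at distance more than l from
    the vertex where their ancestral lines separate, which gives 3 and the depth bound in 1, and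
    replacing chosen subtrees by subtrees of the same sizes does not alter the exploration, which
    gives 4.

    The size of the remainder is controlled by a Chernoff bound, without any local limit theorem:
    for theta of order (M x)^(-1/2), an induction on the height shows that
    E exp (theta * lost - |T| / M) <= 1, so that |T| = n and lost >= r have joint probability at
    most exp (n / M - theta * r).  For r of order n / N^delta this is smaller than any negative
    power of N even after division by P(|T| = n), which is at least exp (- C (log n)^2). *)

(** * Truncated Galton-Watson expectations *)

(** The size of [theta] comes from one balance. A tree reached with counter 0 loses vertices only if
    it has more than [M] of them; then some child carries a comparable part, an event of probability
    of order M^(-1/2), while another child of size below [x] has truncated mean size of order
    x^(1/2). The mean cost theta (x / M)^(1/2) can be paid by the discount exp (- 1 / M) per vertex
    only if theta is of order (M x)^(-1/2). Counter resets cost of order l x^(-3/2), which must also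
    stay below 1 / M; the slack 3/2 beta - alpha - d0 - 7/2 delta > 0 provides this. With x = M
    N^(-2 delta) / (log N)^1.01 the exponent theta r is of order (n / M) (log N)^0.505: the
    logarithm in the threshold is what lets theta r exceed n / M, and the bound that remains is exp
    (- n / M). Degrees are truncated at L = N^(delta / 2): powers such as (1 + A)^d then stay
    bounded, a third moment controls pairs of marked children, and the exponential moment makes
    larger degrees negligible. *)

Lemma ptree_nested_ind (P : ptree -> Prop) :
  (forall ts, {in ts, forall t, P t} -> P (Node ts)) -> forall t, P t.
Proof.
move=> H; fix IH 1 => -[ts]; apply: H.
elim: ts => [u|t ts IHts u]; [rewrite in_nil; discriminate|].
rewrite inE => /orP[/eqP ->|]; first exact: IH.
exact: IHts.
Qed.

Notation leaf := (Node [::]).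
Definition kids (t : ptree) : seq ptree := let: Node ts := t in ts.

Fixpoint tsz (t : ptree) : nat := let: Node ts := t in (sumn (map tsz ts)).+1.

Lemma tsz_gt0 t : (0 < tsz t)%N. Proof. by case: t. Qed.

Lemma tsz_kid ts t : t \in ts -> (tsz t < tsz (Node ts))%N.
Proof.
move=> tts; rewrite /= ltnS.
elim: ts tts => //= u ts IH; rewrite inE => /orP[/eqP->|/IH]; first exact: leq_addr.
by move=> h; rewrite (leq_trans h)// leq_addl.
Qed.

Lemma size_lt_tsz ts : (size ts < tsz (Node ts))%N.
Proof.
rewrite /= ltnS; elim: ts => //= u ts IH.
by rewrite -add1n leq_add// tsz_gt0.
Qed.

Lemma words_consE i u ts :
  (i :: u \in ptree_words (Node ts)) =
  (i < size ts)%N && (u \in ptree_words (nth leaf ts i)).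
Proof.
rewrite /= inE /=.
suff H m : (i :: u \in flatten [seq [seq p.1 :: v | v <- p.2]
   | p <- zip (iota m (size ts)) (map ptree_words ts)]) =
   [&& (m <= i), (i - m < size ts) & u \in ptree_words (nth leaf ts (i - m))]%N.
  by rewrite H subn0.
elim: ts m => [|t ts IH] m /=; first by rewrite andbF.
rewrite mem_cat IH.
have -> : (i :: u \in [seq m :: v | v <- ptree_words t]) =
          (i == m) && (u \in ptree_words t).
  apply/mapP/andP => [[v vt [-> ->]]//|[/eqP-> ut]]; by exists u.
case: (ltngtP m i) => [mi|im|->] /=.
- by rewrite -subn_gt0 in mi; rewrite subnS; case: (i - m)%N mi.
- by [].
- by rewrite subnn /= orbF.
Qed.

Lemma words_nil t : [::] \in ptree_words t.
Proof. by case: t => ts /=; rewrite inE. Qed.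

Lemma words_uniq t : uniq (ptree_words t).
Proof.
elim/ptree_nested_ind: t => ts IH /=.
have -> /= : [::] \notin flatten [seq [seq p.1 :: v | v <- p.2]
   | p <- zip (iota 0 (size ts)) (map ptree_words ts)].
  by apply/flatten_mapP => -[p _ /mapP[]].
elim: ts 0%N IH => //= t ts IHts m IH.
rewrite cat_uniq IHts ?andbT; last by move=> u uts; apply: IH; rewrite inE uts orbT.
rewrite map_inj_uniq ?IH ?mem_head//=; last by move=> ? ? [].
apply/hasPn => w /flatten_mapP[p pz /mapP[v vp ->]].
apply/mapP => -[v' _ [mp _]].
move: pz; case: p mp vp => p1 p2 /= -> vp.
have : m \notin iota m.+1 (size ts) by rewrite mem_iota ltnn.
move=> /negP H H2; apply: H.
have : m \in unzip1 (zip (iota m.+1 (size ts)) (map ptree_words ts)).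
  by apply/mapP; exists (m, p2).
by rewrite unzip1_zip// size_iota size_map.
Qed.

Lemma size_words t : size (ptree_words t) = tsz t.
Proof.
elim/ptree_nested_ind: t => ts IH /=; congr S.
rewrite size_flatten /shape -map_comp.
elim: ts 0%N IH => //= t ts IHts m IH.
rewrite size_map IH ?mem_head// IHts// => u uts; apply: IH; by rewrite inE uts orbT.
Qed.

Lemma card_verts t : #|` verts t| = tsz t.
Proof.
rewrite -size_words /verts card_fseq undup_id ?words_uniq//.
Qed.

Lemma mem_verts t u : (u \in verts t) = (u \in ptree_words t).
Proof. by rewrite /verts in_fset /=. Qed.

(** The words of length one give the number of children and the words starting with [i] give the
    [i]-th child. This recovers the pruned tree from the vertex set stored in a skeleton. *)
Lemma verts_inj : injective verts.
Proof.
move=> t t' /fsetP E.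
have {}E u : (u \in ptree_words t) = (u \in ptree_words t') by rewrite -!mem_verts.
elim/ptree_nested_ind: t t' E => ts IH [ts'] E.
have Es i : (i < size ts)%N = (i < size ts')%N.
  by have := E [:: i]; rewrite !words_consE !words_nil !andbT.
have sz : size ts = size ts'.
  apply/eqP; rewrite eqn_leq; apply/andP; split; rewrite leqNgt.
    by rewrite Es ltnn.
  by rewrite -Es ltnn.
congr Node; apply: (@eq_from_nth _ leaf) => // i isz.
apply: IH => [|u]; first exact: mem_nth.
by have := E (i :: u); rewrite !words_consE isz -Es isz.
Qed.

(** * Finite enumeration of plane trees *)

Section Enumeration.
Implicit Types (A : seq ptree).

Fixpoint seqs_of A (d : nat) : seq (seq ptree) :=
  if d is d'.+1 then [seq t :: ts | t <- A, ts <- seqs_of A d'] else [:: [::]].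

Lemma mem_seqs_of A d ts :
  (ts \in seqs_of A d) = (size ts == d) && all (mem A) ts.
Proof.
elim: d ts => [|d IH] ts /=; first by rewrite inE; case: ts.
apply/allpairsP/idP => [[[t ts'] /= [tA]]|].
  by rewrite IH => + -> /= => /andP[/eqP -> ->]; rewrite tA eqxx.
case: ts => [//|t ts] /= /andP[sz /andP[tA ats]]; exists (t, ts) => /=.
by rewrite IH -eqSS sz.
Qed.

Lemma seqs_of_uniq A d : uniq A -> uniq (seqs_of A d).
Proof.
move=> uA; elim: d => //= d IH; apply: allpairs_uniq => //.
by move=> [a b] [a' b'] _ _ /= [-> ->].
Qed.

(** [h] counts generations of vertices, so [trees L 0] is empty and every induction on [h] starts
    from expectation 0. *)
Fixpoint trees (L h : nat) : seq ptree :=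
  if h is h'.+1 then
    flatten [seq map Node (seqs_of (trees L h') d) | d <- iota 0 L.+1]
  else [::].

Lemma mem_trees L h ts :
  (Node ts \in trees L h.+1) = (size ts <= L)%N && all (mem (trees L h)) ts.
Proof.
apply/flatten_mapP/andP => [[d + /mapP[ts' + [->]]]|[sz al]].
  by rewrite mem_iota mem_seqs_of /= add0n ltnS => dL /andP[/eqP -> ->].
exists (size ts); first by rewrite mem_iota /= add0n ltnS.
by apply/mapP; exists ts => //; rewrite mem_seqs_of eqxx.
Qed.

Lemma trees_uniq L h : uniq (trees L h).
Proof.
elim: h => //= h IH.
suff H s : uniq s -> uniq (flatten [seq map Node (seqs_of (trees L h) d) | d <- s]).
  exact: (H (iota 0 L.+1) (iota_uniq _ _)).
elim: s => //= d s IHs /andP[ds us].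
rewrite cat_uniq IHs// map_inj_uniq; last by move=> ? ? [].
rewrite seqs_of_uniq//= andbT; apply/hasPn => t /flatten_mapP[d' d's /mapP[ts + ->]].
rewrite mem_seqs_of => /andP[/eqP sz _]; apply/mapP => -[ts' + [E]].
by rewrite -E mem_seqs_of sz => /andP[/eqP dd _]; rewrite -dd d's in ds.
Qed.

Fixpoint maxdeg (t : ptree) : nat :=
  let: Node ts := t in maxn (size ts) (foldr maxn 0 (map maxdeg ts)).

Lemma maxdeg_leP L ts :
  (maxdeg (Node ts) <= L)%N = (size ts <= L)%N && all (fun t => maxdeg t <= L)%N ts.
Proof.
rewrite /= geq_max; congr andb.
by elim: ts => //= t ts IH; rewrite geq_max IH.
Qed.

Lemma maxdeg_lt_tsz t : (maxdeg t < tsz t)%N.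
Proof.
elim/ptree_nested_ind: t => ts IH; rewrite ltnS maxdeg_leP -ltnS size_lt_tsz.
by apply/allP => t tts; rewrite (leq_trans (ltnW (IH _ tts)))// -ltnS tsz_kid.
Qed.

Lemma trees_complete L h t : (tsz t <= h)%N -> (maxdeg t <= L)%N -> t \in trees L h.
Proof.
elim: h t => [|h IH] [ts]; first by [].
move=> th; rewrite maxdeg_leP mem_trees => /andP[-> /allP al] /=.
apply/allP => t tts /=; apply: IH; last exact: al.
by rewrite -ltnS (leq_trans _ th)// tsz_kid.
Qed.

(** A tree with [n] vertices has at most [n] generations and degrees below [n], so filtering
    [trees n n] loses none. *)
Definition trees_size n := [seq t <- trees n n | tsz t == n].

Lemma mem_trees_size n t : (t \in trees_size n) = (tsz t == n).
Proof.
rewrite mem_filter; case: eqP => //= <-.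
by rewrite trees_complete// ltnW// maxdeg_lt_tsz.
Qed.

Lemma trees_size_uniq n : uniq (trees_size n).
Proof. exact/filter_uniq/trees_uniq. Qed.

Lemma trees_mono L h : {subset trees L h <= trees L h.+1}.
Proof.
elim: h => [|h IH] [ts]; first by [].
rewrite !mem_trees => /andP[-> /allP al] /=; apply/allP => t /al; exact: IH.
Qed.
End Enumeration.

Section Expectation.
Context {R : realType}.
Variables (m : nat -> R) (m_ge0 : forall d, 0 <= m d) (L : nat).
Implicit Types (f g : ptree -> R) (h : nat).

Fixpoint weight (t : ptree) : R :=
  let: Node ts := t in m (size ts) * \prod_(w <- map weight ts) w.

Lemma weightE ts : weight (Node ts) = m (size ts) * \prod_(t <- ts) weight t.
Proof. by rewrite /= big_map. Qed.

Lemma weight_ge0 t : 0 <= weight t.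
Proof.
elim/ptree_nested_ind: t => ts IH; rewrite weightE mulr_ge0// big_seq.
exact: prodr_ge0.
Qed.

(* Truncating the height and the degrees turns every expectation into a finite sum. *)
Definition gwE h f : R := \sum_(t <- trees L h) weight t * f t.

(** The children of a root of degree [d] are [d] independent truncated trees with one generation
    fewer; [gwES] is the branching property in these terms. *)
Definition forestE h d (F : seq ptree -> R) : R :=
  \sum_(ts <- seqs_of (trees L h) d) (\prod_(t <- ts) weight t) * F ts.

Lemma gwES h f :
  gwE h.+1 f = \sum_(d < L.+1) m d * forestE h d (fun ts => f (Node ts)).
Proof.
rewrite /gwE.
have -> : trees L h.+1 = flatten [seq map Node (seqs_of (trees L h) d)
    | d <- index_iota 0 L.+1] by rewrite /index_iota subn0.
rewrite big_flatten big_map big_mkord; apply: eq_bigr => d _.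
rewrite big_map /forestE big_distrr/= big_seq [RHS]big_seq.
apply: eq_bigr => ts; rewrite mem_seqs_of => /andP[/eqP sz _].
by rewrite big_map sz mulrA.
Qed.

Lemma le_gwE h f g :
  (forall t, t \in trees L h -> f t <= g t) -> gwE h f <= gwE h g.
Proof.
move=> fg; rewrite /gwE big_seq [leRHS]big_seq; apply: ler_sum => t tt.
by rewrite ler_wpM2l ?weight_ge0 ?fg.
Qed.

Lemma eq_gwE h f g : f =1 g -> gwE h f = gwE h g.
Proof. by move=> fg; apply: eq_bigr => t _; rewrite fg. Qed.

Lemma gwE_ge0 h f : (forall t, 0 <= f t) -> 0 <= gwE h f.
Proof. by move=> f0; apply: sumr_ge0 => t _; rewrite mulr_ge0 ?weight_ge0. Qed.

Lemma gwED h f g : gwE h (fun t => f t + g t) = gwE h f + gwE h g.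
Proof. by rewrite -big_split; apply: eq_bigr => t _; rewrite mulrDr. Qed.

Lemma gwEB h f g : gwE h (fun t => f t - g t) = gwE h f - gwE h g.
Proof. by rewrite -sumrB; apply: eq_bigr => t _; rewrite mulrBr. Qed.

Lemma gwEZ h a f : gwE h (fun t => a * f t) = a * gwE h f.
Proof. by rewrite /gwE big_distrr; apply: eq_bigr => t _ /=; rewrite mulrCA. Qed.

Lemma gwE0 f : gwE 0 f = 0. Proof. by rewrite /gwE big_nil. Qed.

Lemma gwE_mono h f : (forall t, 0 <= f t) -> gwE h f <= gwE h.+1 f.
Proof.
move=> f0; rewrite /gwE.
rewrite [leRHS](bigID (mem (trees L h))) /= -[leLHS]addr0 lerD//; last first.
  by apply: sumr_ge0 => t _; rewrite mulr_ge0 ?weight_ge0.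
rewrite -[leRHS]big_filter -/(trees L h.+1) (perm_big [seq t <- trees L h.+1 | t \in trees L h])//.
apply: uniq_perm; rewrite ?filter_uniq ?trees_uniq// => t.
rewrite mem_filter; case: (boolP (t \in trees L h)) => //= tt.
by rewrite trees_mono.
Qed.

Lemma le_forestE h d F G :
  (forall ts, size ts = d -> F ts <= G ts) -> forestE h d F <= forestE h d G.
Proof.
move=> fg; rewrite /forestE big_seq [leRHS]big_seq; apply: ler_sum => ts.
rewrite mem_seqs_of => /andP[/eqP sz _].
rewrite ler_wpM2l ?fg//; apply: prodr_ge0 => t _; exact: weight_ge0.
Qed.

Lemma forestED h d F G :
  forestE h d (fun ts => F ts + G ts) = forestE h d F + forestE h d G.
Proof. by rewrite -big_split; apply: eq_bigr => t _; rewrite mulrDr. Qed.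

Lemma forestEZ h d a F : forestE h d (fun ts => a * F ts) = a * forestE h d F.
Proof. by rewrite /forestE big_distrr; apply: eq_bigr => t _ /=; rewrite mulrCA. Qed.

Lemma forestE_sum h d (I : Type) (r : seq I) (P : pred I) F :
  forestE h d (fun ts => \sum_(i <- r | P i) F i ts) =
  \sum_(i <- r | P i) forestE h d (F i).
Proof.
rewrite /forestE exchange_big /=; apply: eq_bigr => ts _; by rewrite big_distrr.
Qed.

Lemma forestE_prod h d (f : nat -> ptree -> R) :
  forestE h d (fun ts => \prod_(i < d) f i (nth leaf ts i)) =
  \prod_(i < d) gwE h (f i).
Proof.
rewrite /forestE; elim: d f => [|d IH] f.
  by rewrite /= big_seq1 big_nil !big_ord0 mulr1.
rewrite big_allpairs_dep /= big_ord_recl /= -(IH (fun i => f i.+1)).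
rewrite /gwE big_distrl /=; apply: eq_bigr => t _.
rewrite big_distrr /=; apply: eq_bigr => ts _.
rewrite big_cons big_ord_recl /= mulrACA; congr (_ * (_ * _)).
Qed.

Lemma forestE_prod1 h d (f : ptree -> R) :
  forestE h d (fun ts => \prod_(t <- ts) f t) = gwE h f ^+ d.
Proof.
rewrite (_ : gwE h f ^+ d = \prod_(i < d) gwE h f); last first.
  by rewrite prodr_const card_ord.
rewrite -(forestE_prod h d (fun=> f)); apply: eq_big_seq => ts.
rewrite mem_seqs_of => /andP[/eqP sz _]; congr (_ * _).
by rewrite (big_nth leaf) sz big_mkord.
Qed.

(** In this and in [forestE_mark2] an event at the root is charged to one child or to an ordered
    pair of distinct children. Independence factorizes each term; the factors [d] and [d * d.-1] are
    later absorbed by moments of the offspring law. *)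
Lemma forestE_mark1 h d (f f1 : ptree -> R) :
  forestE h d (fun ts => \sum_(i < d) f1 (nth leaf ts i) *
                 \prod_(j < d | j != i) f (nth leaf ts j)) =
  d%:R * (gwE h f1 * gwE h f ^+ d.-1).
Proof.
rewrite forestE_sum (eq_bigr (fun=> gwE h f1 * gwE h f ^+ d.-1)).
  by rewrite sumr_const card_ord mulr_natl.
move=> i _.
transitivity (forestE h d (fun ts =>
    \prod_(j < d) (if j == i :> nat then f1 else f) (nth leaf ts j))).
  apply: eq_bigr => ts _; congr (_ * _).
  rewrite [RHS](bigD1 i)//= eqxx; congr (_ * _); apply: eq_bigr => j ji.
  by rewrite -val_eqE /= in ji; rewrite (negbTE ji).
rewrite (forestE_prod h d (fun j => if j == i :> nat then f1 else f)).
rewrite (bigD1 i)//= eqxx; congr (_ * _).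
rewrite (eq_bigr (fun=> gwE h f)); last first.
  by move=> j; rewrite -val_eqE /= => /negbTE ->.
rewrite prodr_const; congr (_ ^+ _).
by rewrite cardC1 card_ord.
Qed.

Lemma forestE_mark2 h d (f f1 f2 : ptree -> R) :
  forestE h d (fun ts => \sum_(i < d) \sum_(j < d | j != i)
     f1 (nth leaf ts i) * f2 (nth leaf ts j) *
                 \prod_(k < d | (k != i) && (k != j)) f (nth leaf ts k)) =
  (d * d.-1)%:R * (gwE h f1 * gwE h f2 * gwE h f ^+ d.-2).
Proof.
rewrite forestE_sum
  (eq_bigr (fun=> d.-1%:R * (gwE h f1 * gwE h f2 * gwE h f ^+ d.-2))).
  by rewrite sumr_const card_ord natrM -[RHS]mulrA [RHS]mulr_natl.
move=> i _; rewrite forestE_sum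
  (eq_bigr (fun=> gwE h f1 * gwE h f2 * gwE h f ^+ d.-2)).
  by rewrite sumr_const cardC1 card_ord mulr_natl.
move=> j ji.
pose F k := if k == i :> nat then f1 else if k == j :> nat then f2 else f.
transitivity (forestE h d (fun ts => \prod_(k < d) F k (nth leaf ts k))).
  apply: eq_bigr => ts _; congr (_ * _).
  rewrite [RHS](bigD1 i)//= [in RHS](bigD1 j)//= {1 2}/F !eqxx.
  have /negbTE-> : val j != val i by rewrite val_eqE.
  rewrite mulrA; congr (_ * _); apply: eq_bigr => k /andP[ki kj].
  by rewrite /F !val_eqE (negbTE ki) (negbTE kj).
rewrite (forestE_prod h d F) (bigD1 i)//= (bigD1 j)//= {1 2}/F !eqxx.
have /negbTE-> : val j != val i by rewrite val_eqE.
rewrite mulrA; congr (_ * _).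
rewrite (eq_bigr (fun=> gwE h f)); last first.
  by move=> k /andP[ki kj]; rewrite /F !val_eqE (negbTE ki) (negbTE kj).
rewrite prodr_const; congr (_ ^+ _).
have : #|[pred k : 'I_d | (k != i) && (k != j)]| = d.-2.
  have := cardC [pred k : 'I_d | (k != i) && (k != j)]; rewrite card_ord.
  have -> : #|[predC [pred k : 'I_d | (k != i) && (k != j)]]| = 2.
    rewrite (eq_card (B := pred2 i j)); first by rewrite card2 eq_sym ji.
    by move=> k; rewrite !inE negb_and !negbK.
  by rewrite addn2 => e2; rewrite -[in RHS]e2.
by [].
Qed.
End Expectation.

(** * Tail of the total progeny *)

Section PowerBounds.
Context {R : realType}.
Implicit Types (a b y u : R) (d j : nat).

(** The power is convex, so among subintervals of [0, 1] of a given length its increment is largest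
    on the one ending at 1. *)
Lemma subX_le_subX1 a b d : 0 <= b -> b <= a -> a <= 1 ->
  a ^+ d - b ^+ d <= 1 - (1 - (a - b)) ^+ d.
Proof.
move=> b0 ba a1; rewrite subrXX -[X in _ <= X - _](expr1n R d) [leRHS]subrXX.
have -> : 1 - (1 - (a - b)) = a - b by ring.
apply: ler_wpM2l; first lra.
apply: ler_sum => i _; apply: ler_pM; rewrite ?exprn_ge0//; first lra.
  by apply: lerXn2r; rewrite ?nnegrE//; lra.
by apply: lerXn2r; rewrite ?nnegrE//; lra.
Qed.

(** Only one unit of the second-order coefficient is kept, and only for [d >= 2]: after averaging it
    becomes the probability of at least two children, which is at least [c]. *)
Lemma onesubX_le y d : 0 <= y -> y <= 1 ->
  1 - (1 - y) ^+ d <= d%:R * y - (1 < d)%:R * y ^+ 2.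
Proof.
move=> y0 y1; case: d => [|[|d]]; rewrite ?expr0 ?expr1 /=; [lra|lra|].
rewrite mul1r; elim: d => [|d IH]; first by rewrite !expr2; lra.
have p0 : 0 <= (1 - y) ^+ d.+2 by rewrite exprn_ge0//; lra.
have p1 : (1 - y) ^+ d.+2 <= 1 by apply: exprn_ile1; lra.
rewrite exprS -[d.+3%:R]natr1; nra.
Qed.

Lemma bernoulli_ge u j : 0 <= u -> 1 + j%:R * u <= (1 + u) ^+ j.
Proof.
move=> u0; elim: j => [|j IH]; first by rewrite mul0r addr0.
by rewrite exprS -natr1; have := ler0n R j; nra.
Qed.

(** Since (1 - u)^j (1 + u)^j <= 1, Bernoulli's inequality gives (1 - u)^j <= 1 / (1 + j u). *)
Lemma min_le_onesubX u j : 0 < u -> u <= 1 ->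
  Num.min (u * j%:R) 1 <= 2 * (1 - (1 - u) ^+ j).
Proof.
move=> u0 u1.
have j0 := ler0n R j.
have H : (1 - u) ^+ j * (1 + j%:R * u) <= 1.
  apply: (@le_trans _ _ ((1 - u) ^+ j * (1 + u) ^+ j)).
    by rewrite ler_wpM2l ?bernoulli_ge ?exprn_ge0//; lra.
  by rewrite -exprMn; apply: exprn_ile1; nra.
set p := (1 - u) ^+ j in H *.
have p0 : 0 <= p by rewrite exprn_ge0//; lra.
have p1 : p <= 1 by apply: exprn_ile1; lra.
have ju : 0 <= j%:R * u by nra.
rewrite [u * _]mulrC; move: (j%:R * u) ju H => v v0 H.
rewrite ge_min; case: (leP v 1) => v1; apply/orP; [left|right]; nra.
Qed.
End PowerBounds.

Section Tails.
Context {R : realType}.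
Variables (m : nat -> R) (m_ge0 : forall d, 0 <= m d) (L : nat).
Hypothesis m_sum0 : \sum_(d < L.+1) m d <= 1.
Hypothesis m_sum1 : \sum_(d < L.+1) m d * d%:R <= 1.
Variable c : R.
Hypotheses (c_gt0 : 0 < c) (c_le : c <= \sum_(d < L.+1 | (1 < d)%N) m d).
Notation E := (gwE m L).

Lemma c_le_half : c <= 1 / 2.
Proof.
suff : 2 * \sum_(d < L.+1 | (1 < d)%N) m d <= 1 by move: c_le; lra.
apply: le_trans m_sum1; rewrite big_distrr/= big_mkcond /=.
apply: ler_sum => d _; case: ifPn => d1; last by rewrite mulr_ge0 ?ler0n ?m_ge0.
by rewrite mulrC ler_wpM2l// ler_nat.
Qed.

Lemma gwE1_le1 h : E h (fun=> 1) <= 1.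
Proof.
elim: h => [|h IH]; first by rewrite gwE0 ler01.
rewrite gwES; apply: le_trans m_sum0; apply: ler_sum => d _.
rewrite -[leRHS]mulr1 ler_wpM2l//.
have -> : forestE m L h d (fun=> 1) =
   forestE m L h d (fun ts => \prod_(t <- ts) (fun=> 1) t).
  by apply: eq_bigr => ts _; congr (_ * _); rewrite big1.
rewrite forestE_prod1; apply: exprn_ile1 => //; exact: gwE_ge0.
Qed.

Lemma prod_pow_tsz (s : R) ts : \prod_(t <- ts) s ^+ tsz t = s ^+ sumn (map tsz ts).
Proof. by elim: ts => [|t ts IH]; rewrite ?big_nil// big_cons IH -exprD. Qed.

(* By criticality, q = E (1 - (1 - u)^|T|) satisfies c q^2 <= u. *)
Lemma gwE_onesubX h u : 0 < u -> u <= 1 ->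
  E h (fun t => 1 - (1 - u) ^+ tsz t) <= Num.sqrt (u / c).
Proof.
move=> u0 u1; set s := 1 - u.
have s0 : 0 <= s by rewrite /s; lra.
set Y := Num.sqrt _.
have Y2 : c * Y ^+ 2 = u.
  by rewrite sqr_sqrtr ?divr_ge0 ?ltW// mulrC divfK ?gt_eqF.
have Y0 : 0 <= Y by exact: sqrtr_ge0.
have F0 k : 0 <= E k (fun t => s ^+ tsz t).
  by apply: gwE_ge0 => // t; rewrite exprn_ge0.
have y0 k : 0 <= E k (fun t => 1 - s ^+ tsz t).
  by apply: gwE_ge0 => // t; rewrite subr_ge0; apply: exprn_ile1 => //; rewrite /s; lra.
have y1 k : E k (fun t => 1 - s ^+ tsz t) <= 1.
  apply: le_trans (gwE1_le1 k); apply: le_gwE => // t _.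
  by rewrite gerBl exprn_ge0.
elim: h => [|h IH]; first by rewrite gwE0.
have [Y1|Y1] := leP 1 Y; first exact: le_trans (y1 _) Y1.
set y := E h (fun t => 1 - s ^+ tsz t) in IH.
(* The map sending y to u + y - c y^2 is increasing on [0, 1] because [c <= 1 / 2], and [Y] is its
   fixed point, so [y <= Y] passes to the next generation. *)
suff H : E h.+1 (fun t => 1 - s ^+ tsz t) <= u + y - c * y ^+ 2.
  apply: (le_trans H); have := c_le_half; have := y0 h; rewrite -/y => y0' ch.
  rewrite -{1}Y2; have : 0 <= (Y - y) * (1 - c * (Y + y)).
    by apply: mulr_ge0; [lra|nra].
  nra.
rewrite gwES.
pose tot := E h (fun=> 1); pose F := E h (fun t => s ^+ tsz t).
have yE : y = tot - F by rewrite /y gwEB.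
have FE d : forestE m L h d (fun ts => 1 - s ^+ tsz (Node ts)) = tot ^+ d - s * F ^+ d.
  rewrite /tot /F -!forestE_prod1 -forestEZ -[X in _ = _ - X]mul1r -mulNr -forestEZ -forestED.
  apply: eq_bigr => ts _; congr (_ * _).
  by rewrite big1// prod_pow_tsz mulN1r -exprS.
under eq_bigr do rewrite FE.
apply: (@le_trans _ _ (\sum_(d < L.+1) (m d * u + m d * d%:R * y -
          (if (1 < d)%N then m d else 0) * y ^+ 2))).
  apply: ler_sum => d _.
  have -> : m d * u + m d * d%:R * y - (if (1 < d)%N then m d else 0) * y ^+ 2
     = m d * (u + (d%:R * y - (1 < d)%N%:R * y ^+ 2)).
    by case: ifP => _ /=; ring.
  apply: ler_wpM2l => //.
  have tot1 : tot <= 1 by exact: gwE1_le1.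
  have := @onesubX_le R y d (y0 h) (y1 h).
  have yh := y0 h; rewrite -/y yE in yh.
  have := @subX_le_subX1 R tot F d (F0 h) ltac:(lra) tot1; rewrite -yE.
  have F1 : F ^+ d <= 1 by apply: exprn_ile1; [exact: F0|lra].
  have F00 : 0 <= F ^+ d by rewrite exprn_ge0//; exact: F0.
  rewrite /s; nra.
rewrite sumrB big_split/= -!big_distrl/= -big_mkcond/=.
have := y0 h; rewrite -/y => y00; have := sqr_ge0 y => yy.
have := m_sum1; have := m_sum0; have := c_le.
set S1 := \sum_(i < _) m i * _; set S0 := \sum_(i < _) m i.
set S2 := \sum_(i < _ | _) m i.
nra.
Qed.

(** The 2 comes from [min_le_onesubX], the square root from [gwE_onesubX]. *)
Definition tail_const : R := 2 / Num.sqrt c.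

Lemma tail_const_gt0 : 0 < tail_const.
Proof. by rewrite divr_gt0// sqrtr_gt0. Qed.

(** Taking u = 1 / k gives both the tail bound of order k^(-1/2) in [gwE_tail] and, after
    multiplication by k, the truncated mean of order k^(1/2) in [gwE_small_size]. *)
Lemma gwE_min h u : 0 < u -> u <= 1 ->
  E h (fun t => Num.min (u * (tsz t)%:R) 1) <= tail_const * Num.sqrt u.
Proof.
move=> u0 u1; apply: (@le_trans _ _ (2 * Num.sqrt (u / c))); last first.
  by rewrite /tail_const sqrtrM ?(ltW u0)// sqrtrV ?(ltW c_gt0)// [Num.sqrt u * _]mulrC mulrA.
apply: le_trans (ler_wpM2l _ (gwE_onesubX h u0 u1)) => //.
rewrite -gwEZ; apply: le_gwE => // t _; exact: min_le_onesubX.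
Qed.

Lemma gwE_tail h k : (0 < k)%N ->
  E h (fun t => (k <= tsz t)%N%:R) <= tail_const / Num.sqrt k%:R.
Proof.
move=> k0; have k0' : 0 < k%:R :> R by rewrite ltr0n.
rewrite -sqrtrV ?(ltW k0')//; apply: le_trans (gwE_min h _ _); rewrite ?invr_gt0//; last first.
  by rewrite invf_le1// ler1n.
apply: le_gwE => // t _; rewrite le_min; case: leqP => kt; rewrite ?ler01 ?lexx ?andbT/=.
  by rewrite mulrC ler_pdivlMr// mul1r ler_nat.
by rewrite mulr_ge0// invr_ge0 ltW.
Qed.

Lemma gwE_small_size h k : (0 < k)%N ->
  E h (fun t => (tsz t < k)%N%:R * (tsz t)%:R) <= tail_const * Num.sqrt k%:R.
Proof.
move=> k0; have k0' : 0 < k%:R :> R by rewrite ltr0n.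
have -> : tail_const * Num.sqrt k%:R = k%:R * (tail_const * Num.sqrt k%:R^-1).
  rewrite sqrtrV ?(ltW k0')// mulrCA; congr (_ * _).
  rewrite -[X in X * _]sqr_sqrtr ?(ltW k0')// expr2 mulfK// gt_eqF// sqrtr_gt0//.
apply: le_trans (ler_wpM2l (ltW k0') (gwE_min h _ _)); rewrite ?invr_gt0//; last first.
  by rewrite invf_le1// ler1n.
rewrite -gwEZ; apply: le_gwE => // t _.
case: ltnP => kt; rewrite ?mul1r ?mul0r.
  rewrite min_l; first by rewrite mulrA divff ?mul1r// gt_eqF.
  by rewrite mulrC ler_pdivrMr// mul1r ler_nat ltnW.
by rewrite mulr_ge0 ?(ltW k0')// le_min ler01 andbT ltW// mulr_gt0// ?invr_gt0// ltr0n tsz_gt0.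
Qed.
End Tails.

(** * The exploration and its loss *)

Section Marks.
Context {R : realType}.

Lemma le_sum_term (I : finType) (P : pred I) (F : I -> R) i :
  P i -> (forall j, P j -> 0 <= F j) -> F i <= \sum_(j | P j) F j.
Proof.
move=> Pi F0; rewrite (bigD1 i)//= lerDl; apply: sumr_ge0 => j /andP[/F0//].
Qed.

(** The factors are exchanged one at a time, and in each term all others are bounded by the larger
    [g], which produces the form with one marked child. *)
Lemma prodB_le d (f g : 'I_d -> R) : (forall i, 0 <= f i <= g i) ->
  \prod_(i < d) g i - \prod_(i < d) f i <=
  \sum_(i < d) (g i - f i) * \prod_(j < d | j != i) g j.
Proof.
elim: d f g => [|d IH] f g fg; first by rewrite !big_ord0 subrr.
rewrite 3!big_ord_recl /=.
have g0 i : 0 <= g i by case/andP: (fg i) => ? ?; exact: le_trans (_ : _ <= f i) _.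
have -> : \prod_(j < d.+1 | j != ord0) g j = \prod_(i < d) g (lift ord0 i).
  by rewrite big_mkcond big_ord_recl /= mul1r.
have E (i : 'I_d) : \prod_(j < d.+1 | j != lift ord0 i) g j =
    g ord0 * \prod_(j < d | j != i) g (lift ord0 j).
  rewrite big_mkcond big_ord_recl /=; congr (_ * _).
  rewrite [RHS]big_mkcond; apply: eq_bigr => j _.
  by rewrite (inj_eq lift_inj).
rewrite [X in _ <= _ + X](eq_bigr (fun i : 'I_d => g ord0 *
   ((g (lift ord0 i) - f (lift ord0 i)) * \prod_(j < d | j != i) g (lift ord0 j)))).
  2: by move=> i _; rewrite E mulrCA.
rewrite -big_distrr /=.
have := IH (fun i => f (lift ord0 i)) (fun i => g (lift ord0 i)) (fun i => fg _).
have : \prod_(i < d) f (lift ord0 i) <= \prod_(i < d) g (lift ord0 i).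
  by apply: ler_prod => i _.
have : 0 <= \prod_(i < d) f (lift ord0 i).
  by apply: prodr_ge0 => i _; case/andP: (fg (lift ord0 i)).
have /andP[] := fg ord0.
nra.
Qed.
End Marks.

Section Lost.
Variables (x M l : nat).
Implicit Types (t : ptree) (ts : seq ptree) (k : nat).

Definition is_big t := (x <= tsz t)%N.
Definition is_chosen k t := (k == 0) && (x <= tsz t <= M)%N.
(** At counter 0 the predecessor stays 0, so below a vertex whose tree is larger than [M] the search
    goes on without a new waiting time unless there is a branching. *)
Definition child_state k ts := if (1 < count is_big ts)%N then l else k.-1.
Definition smalls ts : nat := (\sum_(t <- ts | ~~ is_big t) tsz t)%N.

(* Number of vertices outside the chosen subtrees, in a tree [t] of size at least [x] whose
   root still needs [k] branching-free steps; smaller trees are charged to their parent. *)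
Fixpoint lost t k : nat :=
  match t with Node ts =>
    if is_big (Node ts) && ~~ is_chosen k (Node ts)
    then (1 + smalls ts + sumn [seq lost u (child_state k ts) | u <- ts])%N else 0%N
  end.

Lemma lostE ts k : lost (Node ts) k =
  if is_big (Node ts) && ~~ is_chosen k (Node ts)
    then (1 + smalls ts + sumn [seq lost u (child_state k ts) | u <- ts])%N else 0%N.
Proof. by []. Qed.

Lemma lost_small t k : ~~ is_big t -> lost t k = 0%N.
Proof. by case: t => ts; rewrite lostE => /negbTE ->. Qed.

Lemma lost_chosen t k : is_chosen k t -> lost t k = 0%N.
Proof. by case: t => ts; rewrite lostE => ->; rewrite andbF. Qed.

(** A branching resets both counters to [l]; without one the children are compared with counters 0
    and [k.-1], to which induction applies. *)
Lemma lost0_le t k : (lost t 0 <= lost t k)%N.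
Proof.
elim/ptree_nested_ind: t k => ts IH k; rewrite !lostE.
case: ifPn => // /andP[-> nc] /=.
have -> : is_chosen k (Node ts) = false.
  by apply: contraNF nc => /andP[_ h]; rewrite /is_chosen eqxx.
rewrite leq_add2l.
have : (forall u, u \in ts -> lost u (child_state 0 ts) <= lost u (child_state k ts))%N.
  by move=> u uts; rewrite /child_state; case: ifP => // _; exact: IH.
elim: ts {IH nc} (child_state 0 ts) (child_state k ts) => //= u ts IH p q H.
by rewrite leq_add ?H ?mem_head//; apply: IH => v vts; rewrite H// inE vts orbT.
Qed.

Lemma big_count_other ts (i : 'I_(size ts)) : (1 < count is_big ts)%N ->
  exists2 j : 'I_(size ts), j != i & is_big (nth leaf ts j).
Proof.
move=> c2; apply/exists_inP; apply: contraLR c2 => /exists_inPn H.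
rewrite -leqNgt -sum1_count (big_nth leaf) big_mkord big_mkcond (bigD1 i)//=.
rewrite big1 ?addn0; first by case: ifP.
by move=> j ji; rewrite (negbTE (H j ji)).
Qed.

Lemma sum_tsz_nth ts : sumn (map tsz ts) = (\sum_(i < size ts) tsz (nth leaf ts i))%N.
Proof. by rewrite sumnE big_map (big_nth leaf) big_mkord. Qed.

(** Pigeonhole; the factor 2 makes room for the root. *)
Lemma giant_child ts : (M < tsz (Node ts))%N -> (0 < M)%N ->
  exists i : 'I_(size ts), (M <= 2 * size ts * tsz (nth leaf ts i))%N.
Proof.
move=> Mt M0; apply/existsP; apply: contraLR Mt => /existsPn H.
rewrite -leqNgt /= sum_tsz_nth.
case: (posnP (size ts)) => [d0|d0].
  by rewrite big1 ?M0// => -[i]; rewrite d0.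
rewrite -(leq_pmul2l (m := 2 * size ts)) ?muln_gt0//.
rewrite mulnS big_distrr /=.
apply: (@leq_trans (2 * size ts + \sum_(i < size ts) M.-1)).
  rewrite leq_add2l; apply: leq_sum => i _.
  by have := H i; rewrite -ltnNge => h; rewrite -ltnS prednK.
rewrite sum_nat_const card_ord; case: M M0 => // M' _; nia.
Qed.

(** The root and the small child have together at most [x <= M / 2] vertices, so the other children
    share at least half of [M], and pigeonhole applies to them. *)
Lemma giant_sibling ts (i : 'I_(size ts)) : (M < tsz (Node ts))%N -> (0 < M)%N ->
  (2 * x <= M)%N -> ~~ is_big (nth leaf ts i) ->
  exists2 j : 'I_(size ts), j != i & (M <= 2 * size ts * tsz (nth leaf ts j))%N.
Proof.
move=> + M0 xM; rewrite /is_big -ltnNge => Mt ix.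
apply/exists_inP; apply: contraLR Mt => /exists_inPn H.
rewrite -leqNgt /= sum_tsz_nth (bigD1 i)//=.
set s := (\sum_(j < _ | _) _)%N.
suff : (2 * s < M)%N by lia.
have d0 : (0 < size ts)%N by case: (i) => /= k; case: (size ts).
rewrite -(ltn_pmul2l (m := size ts))// mulnA [(size ts * 2)%N]mulnC big_distrr /=.
apply: (@leq_ltn_trans (\sum_(j < size ts | j != i) M)).
  by apply: leq_sum => j ji; have := H j ji; rewrite -ltnNge => /ltnW.
by rewrite sum_nat_const cardC1 card_ord ltn_pmul2r// prednK.
Qed.

End Lost.

(** * Chernoff bound for the loss *)

Section ExpBounds.
Context {R : realType}.
Implicit Types u : R.

Lemma expR_le2 u : u <= 1 / 2 -> expR u <= 2.
Proof.
move=> u2; have := expR_ge1Dx (- u); rewrite expRN => H.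
have p := expR_gt0 u.
suff : expR u * (1 / 2) <= 1 by lra.
apply: (@le_trans _ _ (expR u * (expR u)^-1)); last by rewrite divff// gt_eqF.
by rewrite ler_wpM2l ?(ltW p)//; lra.
Qed.

Lemma expR_sub1_le u : 0 <= u -> u <= 1 / 2 -> expR u - 1 <= 2 * u.
Proof.
move=> u0 u2; have := expR_ge1Dx (- u); rewrite expRN => H.
have p := expR_gt0 u; have := expR_le2 u2 => e2.
have : expR u * (1 - u) <= 1.
  apply: (@le_trans _ _ (expR u * (expR u)^-1)); last by rewrite divff// gt_eqF.
  by rewrite ler_wpM2l ?(ltW p)//; lra.
nra.
Qed.

Lemma pow_onep_le_expR u d : 0 <= u -> (1 + u) ^+ d <= expR (d%:R * u).
Proof.
move=> u0; rewrite expRM_natl; apply: lerXn2r; rewrite ?nnegrE ?expR_ge0 ?expR_ge1Dx//.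
by lra.
Qed.

Lemma pow_onep_le2 u d : 0 <= u -> d%:R * u <= 1 / 2 -> (1 + u) ^+ d <= 2.
Proof. by move=> u0 du; apply: (le_trans (pow_onep_le_expR d u0)); exact: expR_le2. Qed.

Lemma pow_onep_le u d : 0 <= u -> d%:R * u <= 1 / 2 -> (1 + u) ^+ d <= 1 + 2 * (d%:R * u).
Proof.
move=> u0 du; have := pow_onep_le_expR d u0.
have : expR (d%:R * u) - 1 <= 2 * (d%:R * u) by apply: expR_sub1_le => //; rewrite mulr_ge0.
lra.
Qed.
End ExpBounds.

Lemma pred2_le d : (d.-2 <= d)%N.
Proof. by rewrite (leq_trans (leq_pred _))// leq_pred. Qed.

Lemma pred_le_sqr d : (d.-1 <= d * d)%N. Proof. by nia. Qed.

Lemma mul_pred_le_cube d : (d * d.-1 <= d ^ 3)%N.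
Proof. by rewrite (expnS d 2) leq_mul// (expnS d 1) expn1 pred_le_sqr. Qed.

Section Chernoff.
Context {R : realType}.
Variables (m : nat -> R) (m_ge0 : forall d, 0 <= m d) (L : nat).
Hypothesis m_sum0 : \sum_(d < L.+1) m d <= 1.
Hypothesis m_sum1 : \sum_(d < L.+1) m d * d%:R <= 1.
Variables (c C3 : R).
Hypotheses (c_gt0 : 0 < c) (c_le : c <= \sum_(d < L.+1 | (1 < d)%N) m d).
Hypotheses (m_gt0 : 0 < m 0%N) (m_sum3 : \sum_(d < L.+1) m d * d%:R ^+ 3 <= C3).
Variables (x M l : nat) (theta lam : R).
Hypotheses (L_gt0 : (0 < L)%N) (x_gt0 : (0 < x)%N) (xM : (2 * x <= M)%N).
Notation E := (gwE m L).
Notation a := (tail_const c).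
Let rx : R := Num.sqrt x%:R.
Let rM : R := Num.sqrt M%:R.
(** [rho] bounds the tilted mass of trees of size at least [x] ([E_bigX]), and [nu] the excess over
    1 of the exponential moment of small trees ([E_small_exp]). One step of the counter multiplies
    the extra cost by at most [K] and adds at most [B], whence at most [A] after [l] steps. *)
Let rho := 3 * a / rx.
Let nu := 2 * theta * a * rx.
Let K := (1 + 2 * theta) * (1 + 2 * nu * C3).
Let B := 2 * theta + 4 * C3 * rho ^+ 2.
Let A := 2 * l%:R * B.
Hypotheses (theta_gt0 : 0 < theta) (lamM : lam = M%:R^-1).
Hypothesis theta_small : theta * (1 + L%:R * x%:R) <= 1 / 2.
Hypothesis nu_small : L%:R * nu <= 1 / 2.
Hypothesis K_small : l%:R * (2 * theta + 2 * nu * C3 + 2 * theta * (2 * nu * C3)) <= 1 / 2.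
Hypothesis A_small : A <= a / rx.
Hypothesis LA_small : L%:R * A <= 1 / 2.
Hypothesis A_rho : 4 * C3 * A * rho <= lam * m 0%N / 2.
Hypothesis theta_lam : 6 * a * (1 + a) * C3 * theta * rx / rM <= lam * m 0%N / 2.

Let tilt k t : R := expR (theta * (lost x M l t k)%:R - lam * (tsz t)%:R).
Local Notation X := tilt.
Local Notation big := (is_big x).

Let a_gt0 : 0 < a := tail_const_gt0 c_gt0.
Let x_leM : (x <= M)%N. Proof. by apply: leq_trans xM; rewrite leq_pmull. Qed.
Let M_gt0 : (0 < M)%N. Proof. exact: leq_trans x_leM. Qed.
Let lam_gt0 : 0 < lam. Proof. by rewrite lamM invr_gt0 ltr0n. Qed.
Let rx_ge1 : 1 <= rx. Proof. by rewrite -[leLHS]sqrtr1 ler_sqrt ?ler1n ?ltr0n. Qed.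
Let rx_gt0 : 0 < rx. Proof. exact: lt_le_trans ltr01 rx_ge1. Qed.
Let rM_gt0 : 0 < rM. Proof. by rewrite sqrtr_gt0 ltr0n. Qed.
Let rxM : rx <= rM. Proof. by rewrite ler_sqrt ?ler_nat ?ltr0n ?x_leM. Qed.
Let C3_ge0 : 0 <= C3.
Proof. by apply: le_trans m_sum3; apply: sumr_ge0 => d _; rewrite mulr_ge0 ?exprn_ge0. Qed.

Let X_gt0 k t : 0 < X k t. Proof. exact: expR_gt0. Qed.
Let X_ge0 k t : 0 <= X k t. Proof. exact: ltW. Qed.

Let X0_le k t : X 0 t <= X k t.
Proof. by rewrite ler_expR lerD2r ler_wpM2l ?(ltW theta_gt0)// ler_nat lost0_le. Qed.

Let X_small k t : ~~ big t -> X k t = X 0 t.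
Proof. by move=> h; rewrite /tilt !lost_small. Qed.

(** A tree of size at most [M] reached with counter 0 is chosen or smaller than [x]; in both cases
    nothing is lost. *)
Let X0_lt1 t : (tsz t <= M)%N -> X 0 t = expR (- (lam * (tsz t)%:R)).
Proof.
move=> tM; rewrite /tilt; suff -> : lost x M l t 0 = 0%N by rewrite mulr0 sub0r.
case: (boolP (big t)) => h; last exact: lost_small.
by apply: lost_chosen; rewrite /is_chosen eqxx tM andbT.
Qed.

Let X0_le1 t : (tsz t <= M)%N -> X 0 t <= 1.
Proof.
by move=> tM; rewrite X0_lt1// -expR0 ler_expR oppr_le0 mulr_ge0 ?(ltW lam_gt0).
Qed.

Let s (ts : seq ptree) : R := (smalls x ts)%:R.

Let tilt_node k ts : big (Node ts) -> ~~ is_chosen x M k (Node ts) ->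
  X k (Node ts) = expR (- lam) * expR (theta * (1 + s ts)) *
     \prod_(t <- ts) X (child_state x l k ts) t.
Proof.
move=> bt nc; rewrite /tilt lostE bt nc -expR_sum -!expRD /=; congr expR.
rewrite sumrB -!big_distrr /= -!natr_sum !sumnE !big_map /s -!natr1 !natrD; ring.
Qed.

Let smalls_le ts : (smalls x ts <= size ts * x)%N.
Proof.
rewrite /smalls (big_nth leaf) big_mkord big_mkcond /=.
rewrite -[size ts in X in (_ <= X)%N]card_ord -sum_nat_const.
by apply: leq_sum => i _; case: ifPn => //; rewrite -ltnNge => /ltnW.
Qed.

Let u_le ts : (size ts <= L)%N -> theta * (1 + s ts) <= 1 / 2.
Proof.
move=> dL; apply: le_trans theta_small; rewrite ler_wpM2l ?(ltW theta_gt0)// lerD2l.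
rewrite -natrM ler_nat (leq_trans (smalls_le ts))// leq_mul2r dL orbT//.
Qed.

Let u_ge0 ts : 0 <= theta * (1 + s ts).
Proof. by rewrite mulr_ge0 ?(ltW theta_gt0)// addr_ge0. Qed.

Let giant ts : R := (M < tsz (Node ts))%N%:R.

(** Up to size [M] the tilt at counter 0 is multiplicative by [X0_lt1]. Above [M] two corrections
    appear: the loss of the root and its small children, linearized by [expR_sub1_le], and the
    passage of the children's counters from 0 to [l] at a branching. *)
Let X0_step ts : (size ts <= L)%N ->
  X 0 (Node ts) <= expR (- lam) *
    (\prod_(t <- ts) X 0 t + 2 * theta * (giant ts * (1 + s ts) * \prod_(t <- ts) X 0 t)
     + 2 * ((1 < count big ts)%N%:R * (\prod_(t <- ts) X l t - \prod_(t <- ts) X 0 t))).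
Proof.
move=> dL.
have P0 k : 0 <= \prod_(t <- ts) X k t by apply: prodr_ge0.
have P0l : \prod_(t <- ts) X 0 t <= \prod_(t <- ts) X l t.
  by apply: ler_prod => t _; rewrite X_ge0 X0_le.
have s0 : 0 <= s ts by exact: ler0n.
have th0 := theta_gt0.
case: (leqP (tsz (Node ts)) M) => tM.
  have -> : X 0 (Node ts) = expR (- lam) * \prod_(t <- ts) X 0 t.
    rewrite X0_lt1// [in RHS]big_seq (eq_bigr (fun t => expR (- (lam * (tsz t)%:R)))).
      rewrite -big_seq -expR_sum -expRD /=.
      congr expR; rewrite sumrN -big_distrr/= -natr_sum sumnE big_map -natr1; ring.
    by move=> t tts; rewrite X0_lt1// (leq_trans (ltnW (tsz_kid tts))).
  rewrite ler_pM2l ?expR_gt0// -addrA lerDl addr_ge0//.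
    by rewrite !mulr_ge0 ?ler0n// ?(ltW th0)// addr_ge0.
  by rewrite !mulr_ge0 ?ler0n// subr_ge0.
have bt : big (Node ts) by exact: leq_trans x_leM (ltnW tM).
have nc : ~~ is_chosen x M 0 (Node ts) by rewrite /is_chosen [(_ <= M)%N]leqNgt tM !andbF.
rewrite tilt_node// -mulrA ler_pM2l ?expR_gt0// /giant tM !mul1r.
set e := expR _.
have e2 : e <= 2 by exact/expR_le2/u_le.
have e1 : e - 1 <= 2 * (theta * (1 + s ts)) by apply: expR_sub1_le; [exact: u_ge0|exact: u_le].
have e0 : 0 < e by exact: expR_gt0.
rewrite /child_state; case: ifP => c2; rewrite ?mul1r ?mul0r ?mulr0 ?addr0.
  have := P0 0; have := P0 l; move: P0l; nra.
have := P0 0; nra.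
Qed.

Let le_giant ts (f : ptree -> R) : (forall t, 0 <= f t) ->
  giant ts * \prod_(t <- ts) f t <=
  \sum_(i < size ts) (M <= 2 * size ts * tsz (nth leaf ts i))%N%:R * f (nth leaf ts i) *
      \prod_(j < size ts | j != i) f (nth leaf ts j).
Proof.
move=> f0; rewrite /giant; case: ltnP => h; last first.
  rewrite mul0r; apply: sumr_ge0 => i _; rewrite !mulr_ge0 ?ler0n//.
  exact: prodr_ge0.
have [i Hi] := giant_child h M_gt0.
apply: le_trans (le_sum_term (i := i) _ _) => //; last first.
  by move=> j _; rewrite !mulr_ge0 ?ler0n//; exact: prodr_ge0.
by rewrite Hi !mul1r (big_nth leaf) big_mkord (bigD1 i).
Qed.

(** The lost small child and the giant child found by [giant_sibling] are distinct, hence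
    independent: their expectations, of order x^(1/2) and M^(-1/2), multiply. *)
Let le_giant_small ts (f : ptree -> R) : (forall t, 0 <= f t) ->
  giant ts * s ts * \prod_(t <- ts) f t <=
  \sum_(i < size ts) \sum_(j < size ts | j != i)
    (tsz (nth leaf ts i) < x)%N%:R * (tsz (nth leaf ts i))%:R * f (nth leaf ts i) *
    ((M <= 2 * size ts * tsz (nth leaf ts j))%N%:R * f (nth leaf ts j)) *
      \prod_(k < size ts | (k != i) && (k != j)) f (nth leaf ts k).
Proof.
move=> f0.
have T0 (i j : 'I_(size ts)) : 0 <=
    (tsz (nth leaf ts i) < x)%N%:R * (tsz (nth leaf ts i))%:R * f (nth leaf ts i) *
    ((M <= 2 * size ts * tsz (nth leaf ts j))%N%:R * f (nth leaf ts j)) *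
      \prod_(k < size ts | (k != i) && (k != j)) f (nth leaf ts k).
  by rewrite !mulr_ge0 ?ler0n//; exact: prodr_ge0.
rewrite /giant; case: ltnP => h; last first.
  by rewrite !mul0r; apply: sumr_ge0 => i _; apply: sumr_ge0 => j _.
rewrite mul1r /s /smalls (big_nth leaf) big_mkord big_mkcond natr_sum big_distrl /=.
apply: ler_sum => i _; case: ifPn => bi; last first.
  by rewrite mul0r; apply: sumr_ge0 => j _.
have [j ji Hj] := giant_sibling h M_gt0 xM bi.
apply: le_trans (le_sum_term (i := j) _ _) => //.
rewrite Hj mul1r (_ : (_ < x)%N = true); last by rewrite ltnNge.
rewrite mul1r (big_nth leaf) big_mkord (bigD1 i)//= (bigD1 j)//= !mulrA.
by rewrite lexx.
Qed.

(** One mark is on a child at which the counter makes a difference, the other on a further big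
    child; the second mark brings the factor [rho], without which a reset would be too expensive. *)
Let le_two_big ts (f g : ptree -> R) : (forall t, 0 <= f t <= g t) ->
  (1 < count big ts)%N%:R * (\prod_(t <- ts) g t - \prod_(t <- ts) f t) <=
  \sum_(i < size ts) \sum_(j < size ts | j != i)
    (g (nth leaf ts i) - f (nth leaf ts i)) *
    ((big (nth leaf ts j))%:R * g (nth leaf ts j)) *
      \prod_(k < size ts | (k != i) && (k != j)) g (nth leaf ts k).
Proof.
move=> fg.
have g0 t : 0 <= g t by case/andP: (fg t) => ? ?; exact: le_trans (_ : _ <= f t) _.
have T0 (i j : 'I_(size ts)) : 0 <= (g (nth leaf ts i) - f (nth leaf ts i)) *
    ((big (nth leaf ts j))%:R * g (nth leaf ts j)) *
      \prod_(k < size ts | (k != i) && (k != j)) g (nth leaf ts k).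
  rewrite !mulr_ge0 ?ler0n//; last exact: prodr_ge0.
  by rewrite subr_ge0; case/andP: (fg (nth leaf ts i)).
case: ltnP => h; last first.
  by rewrite mul0r; apply: sumr_ge0 => i _; apply: sumr_ge0 => j _.
rewrite mul1r !(big_nth leaf) !big_mkord.
apply: (le_trans (prodB_le (fun i => fg (nth leaf ts i)))).
apply: ler_sum => i _.
have [j ji Hj] := big_count_other i h.
apply: le_trans (le_sum_term (i := j) _ _) => //.
by rewrite Hj mul1r [in leLHS](bigD1 j)//= mulrA.
Qed.

Let le_two_big0 ts (g : ptree -> R) : (forall t, 0 <= g t) ->
  (1 < count big ts)%N%:R * \prod_(t <- ts) g t <=
  \sum_(i < size ts) \sum_(j < size ts | j != i)
    ((big (nth leaf ts i))%:R * g (nth leaf ts i)) *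
    ((big (nth leaf ts j))%:R * g (nth leaf ts j)) *
      \prod_(k < size ts | (k != i) && (k != j)) g (nth leaf ts k).
Proof.
move=> g0.
have T0 (i j : 'I_(size ts)) : 0 <= ((big (nth leaf ts i))%:R * g (nth leaf ts i)) *
    ((big (nth leaf ts j))%:R * g (nth leaf ts j)) *
      \prod_(k < size ts | (k != i) && (k != j)) g (nth leaf ts k).
  by rewrite !mulr_ge0 ?ler0n//; exact: prodr_ge0.
case: ltnP => h; last first.
  by rewrite mul0r; apply: sumr_ge0 => i _; apply: sumr_ge0 => j _.
rewrite mul1r.
have [i bi] : exists i : 'I_(size ts), big (nth leaf ts i).
  have : has big ts by rewrite has_count ltnW.
  by case/hasP => t /(nthP leaf)[i il <-] bt; exists (Ordinal il).
have [j ji Hj] := big_count_other i h.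
apply: le_trans (le_sum_term (i := i) _ _) => //; last first.
  by move=> k _; apply: sumr_ge0 => j' _.
apply: le_trans (le_sum_term (i := j) _ _) => //.
by rewrite bi Hj !mul1r (big_nth leaf) big_mkord (bigD1 i)//= (bigD1 j)//= mulrA.
Qed.

Let D k t : R := X k t - X 0 t.
Let D_ge0 k t : 0 <= D k t. Proof. by rewrite subr_ge0 X0_le. Qed.
Let D_small k t : ~~ big t -> D k t = 0.
Proof. by move=> h; rewrite /D X_small// subrr. Qed.

Let small t := ~~ big t.
Let smallE t : small t = (tsz t < x)%N. Proof. by rewrite /small /is_big -ltnNge. Qed.

Let smalls_nth ts : s ts = \sum_(i < size ts) (small (nth leaf ts i))%:R * (tsz (nth leaf ts i))%:R.
Proof.
rewrite /s /smalls (big_nth leaf) big_mkord big_mkcond natr_sum; apply: eq_bigr => i _.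
by rewrite /small; case: ifP => _; rewrite ?mul1r ?mul0r.
Qed.

(** [D k] vanishes on small trees, so only the big child contributes a term. The loss [theta * s] is
    then spread over its siblings, all small, whose tilted weights are at most 1. *)
Let D_one_big k ts : (count big ts <= 1)%N ->
  expR (theta * (1 + s ts)) * (\prod_(t <- ts) X k t - \prod_(t <- ts) X 0 t) <=
  expR theta * \sum_(i < size ts) D k (nth leaf ts i) *
    \prod_(j < size ts | j != i)
       ((small (nth leaf ts j))%:R * expR (theta * (tsz (nth leaf ts j))%:R)).
Proof.
move=> c1; rewrite !(big_nth leaf) !big_mkord.
apply: (@le_trans _ _ (expR (theta * (1 + s ts)) * \sum_(i < size ts) D k (nth leaf ts i) *
    \prod_(j < size ts | j != i) X k (nth leaf ts j))).
  rewrite ler_pM2l ?expR_gt0//; apply: prodB_le => i.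
  by rewrite X_ge0 X0_le.
rewrite !big_distrr /=; apply: ler_sum => i _.
case: (boolP (big (nth leaf ts i))) => bi; last by rewrite D_small// !mul0r !mulr0.
have sm j : j != i -> small (nth leaf ts j).
  move=> ji; apply: contraTN c1 => /negPn bj; rewrite -ltnNge.
  rewrite -sum1_count (big_nth leaf) big_mkord big_mkcond (bigD1 i)//= (bigD1 j)//=.
  by rewrite bi (negPn bj : is_big x _ = true).
rewrite mulrCA [leRHS]mulrCA ler_wpM2l//.
have -> : expR (theta * (1 + s ts)) = expR theta * \prod_(j < size ts | j != i)
     expR (theta * (tsz (nth leaf ts j))%:R).
  rewrite -expR_sum -expRD; congr expR; rewrite mulrDr mulr1; congr (_ + _).
  rewrite -big_distrr; congr (_ * _).
  rewrite smalls_nth (bigD1 i)//= {1}/small bi mul0r add0r; apply: eq_bigr => j ji.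
  by rewrite sm// mul1r.
rewrite -mulrA ler_pM2l ?expR_gt0// -big_split /=; apply: ler_prod => j ji.
rewrite sm// mul1r mulr_ge0 ?expR_ge0//= ler_piMr ?expR_ge0//.
have := sm j ji; rewrite smallE => jx.
by rewrite X_small -/(small _) ?sm// X0_le1// (leq_trans (ltnW jx)).
Qed.

(** A positive counter costs more than counter 0 in three ways: the only big child inherits [k], the
    root and its small children may be lost although the tree would be chosen at counter 0, and at a
    branching the weight is bounded without subtracting [X 0]. *)
Let D_step k ts : (size ts <= L)%N -> D k.+1 (Node ts) <=
  expR theta * \sum_(i < size ts) D k (nth leaf ts i) *
    \prod_(j < size ts | j != i)
       ((small (nth leaf ts j))%:R * expR (theta * (tsz (nth leaf ts j))%:R))
  + 2 * theta * ((x <= tsz (Node ts))%N%:R * (1 + s ts))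
  + 2 * ((1 < count big ts)%N%:R * \prod_(t <- ts) X l t).
Proof.
move=> dL.
have S1 : 0 <= expR theta * \sum_(i < size ts) D k (nth leaf ts i) *
    \prod_(j < size ts | j != i)
       ((small (nth leaf ts j))%:R * expR (theta * (tsz (nth leaf ts j))%:R)).
  rewrite mulr_ge0 ?expR_ge0//; apply: sumr_ge0 => i _; rewrite mulr_ge0//.
  by apply: prodr_ge0 => j _; rewrite mulr_ge0 ?ler0n ?expR_ge0.
have s0 : 0 <= s ts by exact: ler0n.
have th0 := theta_gt0.
have P0 j : 0 <= \prod_(t <- ts) X j t by apply: prodr_ge0.
case: (boolP (big (Node ts))) => bt; last first.
  rewrite D_small// !addr_ge0// !mulr_ge0 ?ler0n ?(ltW th0)//; lra.
rewrite -/(is_big x (Node ts)) bt mul1r.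
set e := expR (theta * (1 + s ts)).
have e2 : e <= 2 by exact/expR_le2/u_le.
have e1 : e - 1 <= 2 * (theta * (1 + s ts)) by apply: expR_sub1_le; [exact: u_ge0|exact: u_le].
have e0 : 0 < e by exact: expR_gt0.
have e3 : 1 <= e by rewrite -expR0 ler_expR u_ge0.
have nc : ~~ is_chosen x M k.+1 (Node ts) by [].
have el1 : expR (- lam) <= 1 by rewrite -expR0 ler_expR oppr_le0 ltW.
have el0 : 0 < expR (- lam) := expR_gt0 _.
have X0n := X_ge0 0 (Node ts).
have S2 : 0 <= 2 * theta * (1 + s ts) by nra.
have ele2 : expR (- lam) * e <= 2 by nra.
rewrite {1}/D tilt_node// -/e /child_state.
case: ltnP => c2.
  rewrite mul1r; have := ler_wpM2r (P0 l) ele2; move: S1 S2 X0n; lra.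
rewrite mul0r mulr0 addr0 /=.
have := D_one_big k c2; rewrite -/e.
set S := expR theta * _ in S1 *; move=> HS.
have Q0 := P0 0; have Qk : \prod_(t <- ts) X 0 t <= \prod_(t <- ts) X k t.
  by apply: ler_prod => t _; rewrite X_ge0 X0_le.
(* What remains compares the root under the two counters with the children kept at counter 0; the
   difference is zero unless the tree is chosen at counter 0. *)
suff H : expR (- lam) * e * \prod_(t <- ts) X 0 t - X 0 (Node ts) <= e - 1.
  have : expR (- lam) * (e * (\prod_(t <- ts) X k t - \prod_(t <- ts) X 0 t)) <= S.
    by apply: le_trans HS; rewrite ler_piMl// mulr_ge0 ?(ltW e0)//; lra.
  lra.
case: (boolP (is_chosen x M 0 (Node ts))) => ch; last first.
  by rewrite tilt_node// -/e /child_state ltnNge c2/= subrr; lra.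
have tM : (tsz (Node ts) <= M)%N by case/and3P: ch.
have -> : X 0 (Node ts) = expR (- lam) * \prod_(t <- ts) X 0 t.
  rewrite X0_lt1// [in RHS]big_seq (eq_bigr (fun t => expR (- (lam * (tsz t)%:R)))).
    rewrite -big_seq -expR_sum -expRD /=.
    congr expR; rewrite sumrN -big_distrr/= -natr_sum sumnE big_map -natr1; ring.
  by move=> t tts; rewrite X0_lt1// (leq_trans (ltnW (tsz_kid tts))).
have Q1 : \prod_(t <- ts) X 0 t <= 1.
  rewrite big_seq; apply: prodr_ile1 => t tts.
  by rewrite X_ge0 X0_le1// (leq_trans (ltnW (tsz_kid tts))).
have : expR (- lam) * \prod_(t <- ts) X 0 t <= 1 by nra.
have : 0 <= expR (- lam) * \prod_(t <- ts) X 0 t by nra.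
nra.
Qed.

Let E1_le1 h : E h (fun=> 1) <= 1. Proof. exact: gwE1_le1. Qed.

Let E_min h : E h (fun t => Num.min (lam * (tsz t)%:R) 1) <= a / rM.
Proof.
apply: (le_trans (gwE_min m_ge0 m_sum0 m_sum1 c_gt0 c_le h lam_gt0 _)).
  by rewrite lamM invf_le1 ?ler1n ?ltr0n.
by rewrite lamM sqrtrV.
Qed.

Let E_small_size h : E h (fun t => (tsz t < x)%N%:R * (tsz t)%:R) <= a * rx.
Proof. exact: gwE_small_size. Qed.

Let E_small_exp h :
  E h (fun t => (small t)%:R * expR (theta * (tsz t)%:R)) <= 1 + nu.
Proof.
apply: (@le_trans _ _ (E h (fun t => 1 + 2 * theta * ((tsz t < x)%N%:R * (tsz t)%:R)))).
  apply: le_gwE => // t _; rewrite smallE; case: ltnP => tx; rewrite ?mul0r ?mulr0 ?addr0// !mul1r.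
  have : expR (theta * (tsz t)%:R) - 1 <= 2 * (theta * (tsz t)%:R).
    apply: expR_sub1_le; first by rewrite mulr_ge0// ltW.
    apply: le_trans theta_small; rewrite ler_wpM2l ?(ltW theta_gt0)//.
    rewrite -natrM -[1]/(1%:R) -natrD ler_nat.
    by rewrite (leq_trans (ltnW tx))// (leq_trans (leq_pmull x L_gt0))// leq_addl.
  by lra.
rewrite gwED gwEZ /nu; have := E1_le1 h; have := E_small_size h; have := theta_gt0; nra.
Qed.

(** For a tree smaller than [x], [1 + s] is its size, and by criticality the mean of [s] is at most
    the truncated mean size one generation lower. The two truncated means cancel; bounding [s] alone
    would leave a term of order x^(1/2). *)
Let E_size_large h : E h.+1 (fun t => (x <= tsz t)%N%:R * (1 + s (kids t))) <= 1.
Proof.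
have eqs t : (x <= tsz t)%N%:R * (1 + s (kids t)) =
   (1 + s (kids t)) - (tsz t < x)%N%:R * (tsz t)%:R.
  case: t => ts /=; rewrite ltnNge; case: leqP => h1 /=; rewrite ?mul1r ?mul0r ?subr0//.
  suff -> : 1 + s ts = (sumn (map tsz ts)).+1%:R by rewrite subrr.
  rewrite -natr1 addrC /s /smalls sumnE big_map big_mkcond; congr (_%:R + _).
  rewrite big_seq [RHS]big_seq; apply: eq_bigr => t tts.
  suff -> : ~~ big t by [].
  by rewrite -/(small t) smallE (ltn_trans (tsz_kid tts)).
rewrite (eq_gwE _ _ _ eqs) gwEB.
set S := E h (fun t => (tsz t < x)%N%:R * (tsz t)%:R).
have S0 : 0 <= S by apply: gwE_ge0 => // t; rewrite mulr_ge0.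
have SS : S <= E h.+1 (fun t => (tsz t < x)%N%:R * (tsz t)%:R).
  by apply: gwE_mono => // t; rewrite mulr_ge0.
suff : E h.+1 (fun t => 1 + s (kids t)) <= 1 + S by lra.
rewrite gwES; apply: (@le_trans _ _ (\sum_(d < L.+1) (m d + m d * d%:R * S))); last first.
  by rewrite big_split/= -big_distrl/=; have := m_sum0; have := m_sum1; nra.
apply: ler_sum => d _; rewrite -mulrA -[X in X + _]mulr1 -mulrDr ler_wpM2l//=.
have tot0 : 0 <= E h (fun=> 1) by apply: gwE_ge0.
have totd j : E h (fun=> 1) ^+ j <= 1 by apply: exprn_ile1.
have -> : forestE m L h d (fun ts => 1 + s ts) =
    forestE m L h d (fun ts => \prod_(t <- ts) (fun=> 1) t) +
    forestE m L h d (fun ts => \sum_(i < d)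
       (fun t => (tsz t < x)%N%:R * (tsz t)%:R) (nth leaf ts i) *
                 \prod_(j < d | j != i) (fun=> 1) (nth leaf ts j)).
  rewrite -forestED /forestE big_seq [RHS]big_seq; apply: eq_bigr => ts.
  rewrite mem_seqs_of => /andP[/eqP dE _]; rewrite -dE; congr (_ * (_ + _)).
    by rewrite big1.
  rewrite smalls_nth; apply: eq_bigr => i _.
  by rewrite smallE big1 ?mulr1.
rewrite forestE_prod1 (forestE_mark1 m L h d (fun=> 1)
  (fun t => (tsz t < x)%N%:R * (tsz t)%:R)) lerD// ler_wpM2l// -[leRHS]mulr1 ler_pM//.
exact: exprn_ge0.
Qed.

Let nu_ge0 : 0 <= nu. Proof. by rewrite /nu !mulr_ge0 ?(ltW theta_gt0) ?(ltW a_gt0) ?(ltW rx_gt0). Qed.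
Let rho_gt0 : 0 < rho. Proof. by apply: divr_gt0; [apply: mulr_gt0; [lra|exact: a_gt0]|exact: rx_gt0]. Qed.
Let B_ge0 : 0 <= B.
Proof.
have r2 : 0 <= rho ^+ 2 := sqr_ge0 _.
apply: addr_ge0; first by apply: mulr_ge0 => //; exact: ltW.
by apply: mulr_ge0 => //; exact: mulr_ge0.
Qed.
Let A_ge0 : 0 <= A. Proof. by rewrite /A !mulr_ge0 ?B_ge0. Qed.
Let K_ge1 : 1 <= K.
Proof.
have := mulr_ge0 nu_ge0 C3_ge0; have := theta_gt0; rewrite /K; nra.
Qed.

(** Dominates the recursion that multiplies by [K] and adds [B] at each step; [growth_le] uses that
    [K ^+ l <= 2]. *)
Let growth k : R := k%:R * K ^+ k * B.

Let growth_le k : (k <= l)%N -> growth k <= A.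
Proof.
move=> kl; rewrite /growth /A; apply: ler_wpM2r => //; rewrite [2 * _]mulrC.
apply: ler_pM; rewrite ?ler0n ?ler_nat ?exprn_ge0//; first exact: le_trans ler01 K_ge1.
apply: (@le_trans _ _ (K ^+ l)); first exact: ler_weXn2l.
have -> : K = 1 + (2 * theta + 2 * nu * C3 + 2 * theta * (2 * nu * C3)) by rewrite /K; ring.
apply: pow_onep_le2 => //.
have := mulr_ge0 nu_ge0 C3_ge0; have := theta_gt0; nra.
Qed.

Let pow_le2 d : (d <= L)%N -> (1 + A) ^+ d <= 2.
Proof.
move=> dL; apply: pow_onep_le2 => //; apply: le_trans LA_small.
by rewrite ler_wpM2r// ler_nat.
Qed.

(** * One generation of the joint induction *)

Section Step.
Variable h : nat.
Hypothesis X0_IH : E h (X 0) <= E h (fun=> 1).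
Hypothesis D_IH : forall k, (k <= l)%N -> E h (D k) <= growth k.

Let EX0_le1 : E h (X 0) <= 1. Proof. exact: le_trans X0_IH (E1_le1 h). Qed.
Let EX_ge0 k : 0 <= E h (X k). Proof. exact: gwE_ge0. Qed.

Let ED_ge0 k : 0 <= E h (D k). Proof. exact: gwE_ge0. Qed.

Let ED_le : E h (D l) <= A.
Proof. by apply: le_trans (growth_le (leqnn l)); exact: D_IH. Qed.

Let EXl : E h (X l) <= 1 + A.
Proof.
rewrite (@eq_gwE R m L h _ (fun t => X 0 t + D l t)); last by move=> t; rewrite /D addrC subrK.
rewrite gwED.
by apply: lerD; [exact: EX0_le1|exact: ED_le].
Qed.

(** Trees larger than [M] carry at most what [X0_IH] leaves after the smaller ones, where [X 0] is
    at least [1 - lam * tsz t]. This is why the induction compares with [E h (fun=> 1)] and not with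
    1: the mass cut off by truncation would enter here. *)
Let E_huge : E h (fun t => (M < tsz t)%N%:R * X 0 t) <= a / rM.
Proof.
rewrite (@eq_gwE R m L h _ (fun t => X 0 t - (tsz t <= M)%N%:R * X 0 t)); last first.
  by move=> t; rewrite ltnNge; case: (_ <= _)%N => /=; rewrite ?mul1r ?mul0r ?subr0 ?subrr.
rewrite gwEB; apply: le_trans (E_min h); apply: (le_trans (lerB X0_IH (lexx _))).
rewrite -gwEB; apply: le_gwE => // t _.
have v0 : 0 <= lam * (tsz t)%:R by rewrite mulr_ge0// ltW.
rewrite le_min; case: leqP => tM; rewrite ?mul1r ?mul0r.
  rewrite X0_lt1//; have := expR_ge1Dx (- (lam * (tsz t)%:R)).
  by have := expR_gt0 (- (lam * (tsz t)%:R)); move=> ? ?; apply/andP; split; lra.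
rewrite subr0 lexx andbT lamM mulrC ler_pdivlMr ?ltr0n// mul1r ler_nat; exact: ltnW.
Qed.

Let E_giant d : (0 < d)%N ->
  E h (fun t => (M <= 2 * d * tsz t)%N%:R * X 0 t) <= 3 * d%:R * (a / rM).
Proof.
move=> d0; have d1 : 1 <= d%:R :> R by rewrite ler1n.
apply: (@le_trans _ _ (E h (fun t => 2 * d%:R * Num.min (lam * (tsz t)%:R) 1 +
   (M < tsz t)%N%:R * X 0 t))).
  apply: le_gwE => // t _; case: (leqP (tsz t) M) => tM /=; last first.
    rewrite mul1r ler_wpDl//; last by rewrite ler_piMl ?lern1 ?leq_b1.
    by rewrite !mulr_ge0// le_min mulr_ge0 ?ler01// ltW.
  rewrite mul0r addr0.
  have v0 : 0 <= lam * (tsz t)%:R by rewrite mulr_ge0// ltW.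
  case: leqP => Mt; last by rewrite mul0r mulr_ge0// ?mulr_ge0// le_min v0 ler01.
  rewrite mul1r (le_trans (X0_le1 tM))//.
  have H : 1 <= 2 * d%:R * (lam * (tsz t)%:R).
    rewrite mulrCA lamM mulrC ler_pdivlMr ?ltr0n// mul1r.
    by rewrite -!natrM ler_nat.
  by case: (leP (lam * (tsz t)%:R) 1) => v1; [exact: H|rewrite mulr1; lra].
rewrite gwED gwEZ; have := E_min h; have := E_huge.
have : 0 < a / rM by rewrite divr_gt0.
set u := E h _; set v := E h _; move: (a / rM) => w; nra.
Qed.

Let E_smallX : E h (fun t => (tsz t < x)%N%:R * (tsz t)%:R * X 0 t) <= a * rx.
Proof.
apply: le_trans (E_small_size h); apply: le_gwE => // t _.
case: ltnP => tx; rewrite ?mul0r// mul1r ler_piMr//.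
by rewrite X0_le1// (leq_trans (ltnW tx)).
Qed.

(** The tail at [x], the trees above [M] and the extra cost of counter [l] are each at most
    [a / rx], whence the 3 in [rho]. *)
Let E_bigX : E h (fun t => (big t)%:R * X l t) <= rho.
Proof.
apply: (@le_trans _ _ (E h (fun t => (x <= tsz t)%N%:R + (M < tsz t)%N%:R * X 0 t + D l t))).
  apply: le_gwE => // t _; rewrite /is_big; have := D_ge0 l t; rewrite /D => D0.
  have tr : true%:R = 1 :> R by [].
  case: (leqP (tsz t) M) => tM; rewrite ?mul0r ?mul1r ?addr0; case: leqP => tx;
    rewrite ?mul0r ?mul1r ?addr0 ?add0r ?tr//.
  - by have := X0_le1 tM; lra.
  - by lra.
  - by have := X_ge0 0 t; lra.
have H1 : E h (fun t => D l t) <= A := ED_le.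
rewrite gwED gwED; have := E_huge.
have := gwE_tail m_ge0 m_sum0 m_sum1 c_gt0 c_le h x_gt0; rewrite -/rx.
move=> H2 H3.
have : a / rM <= a / rx by rewrite ler_pM2l// lef_pV2.
have -> : rho = a / rx + a / rx + a / rx by rewrite /rho; ring.
move: A_small; lra.
Qed.

(** The first term is the loss at trees larger than [M], the second the resets at branchings. *)
Let W := 6 * a * (1 + a) * theta * rx / rM + 4 * A * rho.

Let step0_deg d : (d <= L)%N ->
  forestE m L h d (fun ts => X 0 (Node ts)) <=
  expR (- lam) * (E h (fun=> 1) ^+ d + d%:R ^+ 3 * W).
Proof.
move=> dL.
pose f1 t := (M <= 2 * d * tsz t)%N%:R * X 0 t.
pose f2 t := (tsz t < x)%N%:R * (tsz t)%:R * X 0 t.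
pose f3 t := (big t)%:R * X l t.
pose F1 ts := \sum_(i < d) f1 (nth leaf ts i) * \prod_(j < d | j != i) X 0 (nth leaf ts j).
pose F2 ts := \sum_(i < d) \sum_(j < d | j != i) f2 (nth leaf ts i) * f1 (nth leaf ts j) *
   \prod_(k < d | (k != i) && (k != j)) X 0 (nth leaf ts k).
pose F3 ts := \sum_(i < d) \sum_(j < d | j != i) D l (nth leaf ts i) * f3 (nth leaf ts j) *
   \prod_(k < d | (k != i) && (k != j)) X l (nth leaf ts k).
apply: (@le_trans _ _ (forestE m L h d (fun ts => expR (- lam) *
   (\prod_(t <- ts) X 0 t + (2 * theta * F1 ts + (2 * theta * F2 ts + 2 * F3 ts)))))).
  apply: le_forestE => // ts dE; subst d.
  apply: (le_trans (X0_step dL)); rewrite ler_pM2l ?expR_gt0// -addrA lerD2l.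
  rewrite !addrA lerD//; last first.
    rewrite ler_pM2l//; apply: le_two_big => t; by rewrite X_ge0 X0_le.
  rewrite -mulrDr ler_pM2l ?mulr_gt0// mulrDr mulr1 mulrDl.
  by rewrite lerD//; [exact: le_giant|exact: le_giant_small].
rewrite forestEZ !forestED !forestEZ forestE_prod1 ler_pM2l ?expR_gt0//.
rewrite /F1 /F2 /F3 forestE_mark1 !forestE_mark2.
have Xd j : E h (X 0) ^+ j <= 1 by apply: exprn_ile1.
have Xd0 j : 0 <= E h (X 0) ^+ j by exact: exprn_ge0.
rewrite lerD ?lerXn2r ?nnegrE ?(gwE_ge0 m_ge0)//.
case: d => [|d] in dL f1 F1 F2 F3 *.
  by rewrite expr0n /= !mul0n !mul0r !mulr0 !addr0.
have e1 : E h f1 <= 3 * d.+1%:R * (a / rM) by exact: E_giant.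
have e10 : 0 <= E h f1 by apply: gwE_ge0 => // t; rewrite mulr_ge0.
have e2 : E h f2 <= a * rx by exact: E_smallX.
have e20 : 0 <= E h f2 by apply: gwE_ge0 => // t; rewrite !mulr_ge0.
have e3 : E h f3 <= rho by exact: E_bigX.
have e30 : 0 <= E h f3 by apply: gwE_ge0 => // t; rewrite !mulr_ge0.
have e4 : E h (D l) <= A by exact: ED_le.
have e40 : 0 <= E h (D l) by [].
have e5 : E h (X l) ^+ d.+1.-2 <= 2.
  apply: (@le_trans _ _ ((1 + A) ^+ d.+1.-2)).
    by apply: lerXn2r; rewrite ?nnegrE//; first [exact: EXl | exact: addr_ge0].
  by apply: pow_le2; apply: leq_trans dL; exact: pred2_le.
have e50 : 0 <= E h (X l) ^+ d.+1.-2 by exact: exprn_ge0.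
have q : 0 < a / rM by rewrite divr_gt0.
have Xd1 := Xd d.+1.-1; have Xd01 := Xd0 d.+1.-1.
have Xd2 := Xd d.+1.-2; have Xd02 := Xd0 d.+1.-2.
set n := d.+1%:R in e1 *.
have n1 : 1 <= n by rewrite ler1n.
have n2 : (d.+1 * d)%N%:R <= n ^+ 2 by rewrite expr2 -natrM ler_nat leq_mul2l leqnSn orbT.
have n20 : 0 <= (d.+1 * d)%N%:R :> R by [].
have n3 : n ^+ 2 <= n ^+ 3 by rewrite ler_weXn2l.
have T1 : n * (E h f1 * E h (X 0) ^+ d.+1.-1) <= n ^+ 3 * (3 * (a / rM)).
  apply: (@le_trans _ _ (n * (3 * n * (a / rM) * 1))).
    apply: ler_wpM2l; first lra.
    by apply: ler_pM.
  have -> : n * (3 * n * (a / rM) * 1) = n ^+ 2 * (3 * (a / rM)) by ring.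
  by apply: ler_wpM2r => //; lra.
have T2 : (d.+1 * d)%N%:R * (E h f2 * E h f1 * E h (X 0) ^+ d.+1.-2) <=
    n ^+ 3 * (3 * (a * rx) * (a / rM)).
  apply: (@le_trans _ _ (n ^+ 2 * ((a * rx) * (3 * n * (a / rM)) * 1))).
    apply: ler_pM => //; first by rewrite !mulr_ge0.
    by apply: ler_pM => //; [exact: mulr_ge0|exact: ler_pM].
  by rewrite le_eqVlt; apply/orP; left; apply/eqP; ring.
have T3 : (d.+1 * d)%N%:R * (E h (D l) * E h f3 * E h (X l) ^+ d.+1.-2) <=
    n ^+ 3 * (A * rho * 2).
  apply: ler_pM => //; [by rewrite !mulr_ge0|exact: le_trans n3|].
  by apply: ler_pM => //; [exact: mulr_ge0|exact: ler_pM].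
apply: (@le_trans _ _ (2 * theta * (n ^+ 3 * (3 * (a / rM))) +
  (2 * theta * (n ^+ 3 * (3 * (a * rx) * (a / rM))) + 2 * (n ^+ 3 * (A * rho * 2))))).
  by rewrite lerD ?lerD// ler_pM2l// mulr_gt0.
have -> : W = 6 * theta * (a / rM) * (rx + a * rx) + 4 * A * rho by rewrite /W; ring.
have : 0 <= n ^+ 3 by rewrite exprn_ge0//; lra.
have : 0 <= theta * (a / rM) * (rx - 1).
  apply: mulr_ge0; last by rewrite subr_ge0.
  by apply: mulr_ge0; exact: ltW.
move: (n ^+ 3) => n' H0 H'.
have := mulr_ge0 H' H0.
by lra.
Qed.

(** The averaged corrections are at most [C3 * W <= lam * m 0], and the truncated mass is at least
    [m 0] because of the one-vertex tree. So they are at most a fraction [lam] of the mass, and exp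
    (- lam) (1 + lam) <= 1 closes the induction. *)
Let step0 : E h.+1 (X 0) <= E h.+1 (fun=> 1).
Proof.
have E1S : E h.+1 (fun=> 1) = \sum_(d < L.+1) m d * E h (fun=> 1) ^+ d.
  rewrite gwES; apply: eq_bigr => d _; congr (_ * _).
  rewrite -forestE_prod1; apply: eq_bigr => ts _; congr (_ * _); by rewrite big1.
apply: (@le_trans _ _ (expR (- lam) * (E h.+1 (fun=> 1) + C3 * W))).
  rewrite gwES E1S.
  apply: (@le_trans _ _ (\sum_(d < L.+1) m d *
      (expR (- lam) * (E h (fun=> 1) ^+ d + d%:R ^+ 3 * W)))).
    by apply: ler_sum => d _; apply: ler_wpM2l => //; apply: step0_deg; rewrite -ltnS.
  under eq_bigr do rewrite mulrCA mulrDr mulrA.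
  rewrite -big_distrr /= ler_pM2l ?expR_gt0// big_split /= lerD2l -big_distrl /=.
  apply: ler_wpM2r => //.
  apply: addr_ge0; last by apply: mulr_ge0; [exact: mulr_ge0|exact: ltW].
  apply: divr_ge0; last exact: ltW.
  have a0 := ltW a_gt0; have a1 : 0 <= 1 + a by rewrite addr_ge0.
  have t0 := ltW theta_gt0; have r0 := ltW rx_gt0.
  by do 4 (apply: mulr_ge0 => //).
have m0E : m 0%N <= E h.+1 (fun=> 1).
  rewrite E1S big_ord_recl expr0 mulr1 lerDl; apply: sumr_ge0 => d _.
  by rewrite mulr_ge0// exprn_ge0// gwE_ge0.
have CW : C3 * W <= lam * m 0%N by move: A_rho theta_lam; rewrite /W; lra.
have el : expR (- lam) * (1 + lam) <= 1.
  rewrite expRN mulrC ler_pdivrMr ?expR_gt0// mul1r; exact: expR_ge1Dx.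
have e0 : 0 < expR (- lam) := expR_gt0 _.
set T := E h.+1 _ in m0E *.
have T0 : 0 <= T by exact: le_trans (ltW m_gt0) m0E.
apply: (@le_trans _ _ (expR (- lam) * (1 + lam) * T)); last by nra.
rewrite -mulrA ler_pM2l// mulrDl mul1r lerD2l (le_trans CW)// ler_pM2l//.
Qed.

(** Since the mean offspring number is at most 1, the single big child multiplies the extra cost by
    1 up to the corrections collected in [K]; the two other terms of [D_step] add up to at most
    [B]. *)
Let stepD k : (k < l)%N -> E h.+1 (D k.+1) <= growth k.+1.
Proof.
move=> kl.
have IHk := D_IH (ltnW kl).
pose g t := (small t)%:R * expR (theta * (tsz t)%:R).
have g0 t : 0 <= g t by rewrite mulr_ge0 ?expR_ge0.
pose F1 d ts := \sum_(i < d) D k (nth leaf ts i) * \prod_(j < d | j != i) g (nth leaf ts j).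
pose F2 ts := (x <= tsz (Node ts))%N%:R * (1 + s ts).
pose f3 t := (big t)%:R * X l t.
pose F3 d ts := \sum_(i < d) \sum_(j < d | j != i) f3 (nth leaf ts i) * f3 (nth leaf ts j) *
   \prod_(k < d | (k != i) && (k != j)) X l (nth leaf ts k).
have e3 : E h f3 <= rho by exact: E_bigX.
have e30 : 0 <= E h f3 by apply: gwE_ge0 => // t; rewrite !mulr_ge0.
have eg : E h g <= 1 + nu by exact: E_small_exp.
have eg0 : 0 <= E h g by exact: gwE_ge0.
apply: (@le_trans _ _ (\sum_(d < L.+1) m d *
   (expR theta * (d%:R * (E h (D k) * E h g ^+ d.-1)) +
    2 * theta * forestE m L h d F2 + 2 * ((d * d.-1)%:R * (E h f3 * E h f3 * E h (X l) ^+ d.-2))))).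
  rewrite gwES; apply: ler_sum => d _; apply: ler_wpM2l => //.
  rewrite -forestE_mark1 -forestE_mark2 -!forestEZ -!forestED.
  apply: le_forestE => // ts dE.
  have dL : (size ts <= L)%N by rewrite dE -ltnS.
  apply: (le_trans (D_step k dL)); rewrite -dE lerD2l ler_pM2l//.
  exact: le_two_big0.
apply: (@le_trans _ _ (\sum_(d < L.+1) (
   growth k * (expR theta * (m d * d%:R + m d * d%:R ^+ 3 * (2 * nu))) +
   2 * theta * (m d * forestE m L h d F2) + 4 * rho ^+ 2 * (m d * d%:R ^+ 3)))).
  apply: ler_sum => d _.
  have -> : growth k * (expR theta * (m d * d%:R + m d * d%:R ^+ 3 * (2 * nu))) +
   2 * theta * (m d * forestE m L h d F2) + 4 * rho ^+ 2 * (m d * d%:R ^+ 3) =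
   m d * (expR theta * (d%:R * (growth k * (1 + 2 * (d%:R * d%:R * nu)))) +
   2 * theta * forestE m L h d F2 + 2 * (d%:R ^+ 3 * (rho * rho * 2))) by ring.
  apply: ler_wpM2l => //; apply: lerD; first apply: lerD => //.
    rewrite ler_pM2l ?expR_gt0//; apply: ler_wpM2l => //.
    apply: ler_pM => //; first exact: exprn_ge0.
    have dL : (d <= L)%N by rewrite -ltnS.
    apply: (@le_trans _ _ ((1 + nu) ^+ d.-1)).
      by apply: lerXn2r; rewrite ?nnegrE//; lra.
    have dd : (d.-1%:R : R) <= d%:R * d%:R.
      by rewrite -natrM ler_nat pred_le_sqr.
    apply: le_trans (pow_onep_le nu_ge0 _) _; last first.
      by have := ler_wpM2r nu_ge0 dd; lra.
    apply: le_trans nu_small; apply: ler_wpM2r => //; rewrite ler_nat.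
    by apply: leq_trans dL; exact: leq_pred.
  rewrite ler_pM2l//; apply: ler_pM => //.
  - by rewrite !mulr_ge0 ?exprn_ge0.
  - by rewrite -natrX ler_nat mul_pred_le_cube.
  - apply: ler_pM => //; [exact: mulr_ge0|exact: exprn_ge0|exact: ler_pM|].
    apply: (@le_trans _ _ ((1 + A) ^+ d.-2)).
      by apply: lerXn2r; rewrite ?nnegrE//; first [exact: EXl | exact: addr_ge0].
    by apply: pow_le2; apply: leq_trans (pred2_le _) _; rewrite -ltnS.
rewrite !big_split /= -!big_distrr /= big_split /= -big_distrl /=.
have EF2 : \sum_(d < L.+1) m d * forestE m L h d F2 <= 1.
  by rewrite -(gwES m L h (fun t => (x <= tsz t)%N%:R * (1 + s (kids t)))); exact: E_size_large.
have := m_sum1; have := m_sum3.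
set S1 := \sum_(i < _) m i * i%:R; set S3 := \sum_(i < _) m i * _ ^+ 3.
set S2 := \sum_(i < _) m i * forestE _ _ _ _ _ in EF2 *.
move=> S3C S11.
have gk0 : 0 <= growth k by rewrite !mulr_ge0 ?exprn_ge0//; exact: le_trans ler01 K_ge1.
have eth : expR theta <= 1 + 2 * theta.
  have : theta <= 1 / 2.
    apply: le_trans theta_small; rewrite ler_peMr ?(ltW theta_gt0)//.
    by rewrite -natrM -[1 in X in X <= _]addr0 lerD2l.
  by move=> t2; have := expR_sub1_le (ltW theta_gt0) t2; lra.
have H1 : expR theta * (S1 + S3 * (2 * nu)) <= K.
  rewrite /K; apply: ler_pM => //.
    rewrite addr_ge0//; first by apply: sumr_ge0 => d _; rewrite mulr_ge0.
    apply: mulr_ge0; last exact: mulr_ge0.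
    by apply: sumr_ge0 => d _; rewrite mulr_ge0 ?exprn_ge0.
  have := ler_wpM2r nu_ge0 S3C; lra.
have H2 : 2 * theta * S2 <= 2 * theta by rewrite ler_piMr ?mulr_ge0 ?(ltW theta_gt0).
have H3 : 4 * rho ^+ 2 * S3 <= 4 * rho ^+ 2 * C3.
  by apply: ler_wpM2l => //; rewrite mulr_ge0 ?exprn_ge0 ?(ltW rho_gt0).
apply: (@le_trans _ _ (growth k * K + B)).
  rewrite -addrA lerD//; first exact: ler_wpM2l.
  by rewrite /B; lra.
rewrite /growth exprS -natr1.
have : 0 <= K * K ^+ k - 1 by rewrite subr_ge0 -exprS; exact: exprn_ege1.
move=> /(mulr_ge0 B_ge0); lra.
Qed.

Let stepD_all k : (k <= l)%N -> E h.+1 (D k) <= growth k.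
Proof.
case: k => [_|k kl]; last exact: stepD.
by rewrite /growth !mul0r /gwE big1// => t _; rewrite /D subrr mulr0.
Qed.

Lemma tilt_step : E h.+1 (X 0) <= E h.+1 (fun=> 1) /\
   forall k, (k <= l)%N -> E h.+1 (D k) <= growth k.
Proof. by split; [exact: step0|exact: stepD_all]. Qed.
End Step.

(* Joint induction on the height: starting with counter [k] instead of [0] costs at most [growth k],
   and this is paid for by the factor [expR (- lam)] per vertex. *)
Lemma gwE_tilt_le1 h : E h (X 0) <= 1.
Proof.
suff [H _] : E h (X 0) <= E h (fun=> 1) /\
   forall k, (k <= l)%N -> E h (D k) <= growth k by exact: le_trans H (E1_le1 h).
elim: h => [|h [IH1 IH2]]; last exact: tilt_step.
rewrite !gwE0; split => // k _; rewrite gwE0 !mulr_ge0 ?exprn_ge0//.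
exact: le_trans ler01 K_ge1.
Qed.

Lemma gwE_lost_tail h n (r : R) :
  E h (fun t => ((tsz t == n) && (r <= (lost x M l t 0)%:R))%:R) <=
  expR (lam * n%:R - theta * r).
Proof.
rewrite -[leRHS]mulr1; apply: le_trans (ler_wpM2l (expR_ge0 _) (gwE_tilt_le1 h)).
rewrite -gwEZ; apply: le_gwE => // t _.
case: andP => [[/eqP <- rt]|_] /=; last by rewrite mulr_ge0 ?expR_ge0.
rewrite /tilt -expRD; apply: (@le_trans _ _ (expR 0)); first by rewrite expR0.
rewrite ler_expR.
have := ler_wpM2l (ltW theta_gt0) rt; lra.
Qed.

End Chernoff.

(** * Lower bound on the probability of a given size *)

Section SizeDistribution.
Context {R : realType}.
Variables (m : nat -> R) (m_ge0 : forall d, 0 <= m d).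
Implicit Types (f : ptree -> R) (a b d h j k n : nat).

Definition size_pr n : R := \sum_(t <- trees_size n) weight m t.

Lemma le_sum_subseq (s s' : seq ptree) f : uniq s -> {subset s <= s'} ->
  (forall t, 0 <= f t) -> \sum_(t <- s) f t <= \sum_(t <- s') f t.
Proof.
move=> us sub f0; rewrite [leRHS](bigID (mem s) xpredT) /=.
rewrite -[leLHS]addr0 lerD//; last exact: sumr_ge0.
rewrite -[leRHS]big_filter.
have -> : \sum_(t <- s) f t = \sum_(t <- undup [seq t <- s' | t \in s]) f t.
  apply: perm_big; apply: uniq_perm; rewrite ?undup_uniq// => t.
  rewrite mem_undup mem_filter; case: (boolP (t \in s)) => //= ts.
  by rewrite sub.
elim: [seq _ <- _ | _] => //= t r IH; case: ifP => _; rewrite !big_cons ?lerD//.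
by rewrite -[leLHS]add0r lerD.
Qed.

Lemma size_pr_ge0 n : 0 <= size_pr n.
Proof. by apply: sumr_ge0 => t _; exact: weight_ge0. Qed.

Lemma gwE_size_le L h n : gwE m L h (fun t => (tsz t == n)%:R) <= size_pr n.
Proof.
rewrite /gwE (eq_bigr (fun t => if tsz t == n then weight m t else 0)); last first.
  by move=> t _; case: eqP; rewrite ?mulr1 ?mulr0.
rewrite -big_mkcond -big_filter; apply: le_sum_subseq.
- exact/filter_uniq/trees_uniq.
- by move=> t; rewrite mem_filter mem_trees_size => /andP[].
- exact: weight_ge0.
Qed.

Lemma weight_leaf : weight m leaf = m 0%N.
Proof. by rewrite weightE big_nil mulr1. Qed.

Lemma prod_weight_leaves k :
  \prod_(t <- nseq k leaf) weight m t = m 0%N ^+ k.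
Proof.
by elim: k => [|k IH]; rewrite ?big_nil ?expr0// big_cons IH weight_leaf exprS.
Qed.

Lemma sumn_tsz_leaves k : sumn (map tsz (nseq k leaf)) = k.
Proof. by elim: k => //= k ->. Qed.

(** A new root gets the given tree and [d] leaves as children. This is injective, as is the variant
    with two trees in [size_pr_join]. *)
Lemma size_pr_graft k d :
  m d.+1 * m 0%N ^+ d * size_pr k <= size_pr (k + d.+1).
Proof.
pose g t := Node (t :: nseq d leaf).
have -> : m d.+1 * m 0%N ^+ d * size_pr k =
    \sum_(t <- map g (trees_size k)) weight m t.
  rewrite big_map /size_pr big_distrr; apply: eq_bigr => t _.
  by rewrite [in RHS]/g [RHS]weightE big_cons prod_weight_leaves /= size_nseq mulrAC mulrA.
apply: le_sum_subseq; last exact: weight_ge0.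
  rewrite map_inj_uniq ?trees_size_uniq// => t t' []//.
move=> _ /mapP[t + ->]; rewrite !mem_trees_size /= sumn_tsz_leaves => /eqP ->.
by rewrite addnS.
Qed.

Lemma size_pr_join a b j :
  m j.+2 * m 0%N ^+ j * (size_pr a * size_pr b) <= size_pr (a + b + j.+1).
Proof.
pose g t u := Node (t :: u :: nseq j leaf).
have -> : m j.+2 * m 0%N ^+ j * (size_pr a * size_pr b) =
    \sum_(t <- [seq g t u | t <- trees_size a, u <- trees_size b]) weight m t.
  rewrite big_allpairs_dep /size_pr big_distrl big_distrr.
  apply: eq_bigr => t _; rewrite !big_distrr; apply: eq_bigr => u _.
  by rewrite [in RHS]/g [RHS]weightE !big_cons prod_weight_leaves /= size_nseq -!mulrA; congr (_ * _); rewrite mulrC -mulrA.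
apply: le_sum_subseq; last exact: weight_ge0.
  apply: allpairs_uniq; rewrite ?trees_size_uniq//.
  by move=> [t u] [t' u'] _ _ /= [-> ->].
move=> _ /allpairsP[[t u] /= [+ + ->]]; rewrite !mem_trees_size => /eqP <- /eqP <- /=.
by rewrite sumn_tsz_leaves addnA addnS.
Qed.

(** Union bound over vertices, by generation: each of the [h] generations has mean size at most
    1. *)
Lemma gwE_maxdeg N L h : \sum_(d < N.+1) m d <= 1 -> \sum_(d < N.+1) m d * d%:R <= 1 ->
  gwE m N h (fun t => (L < maxdeg t)%N%:R) <= h%:R * \sum_(d < N.+1 | (L < d)%N) m d.
Proof.
move=> s0 s1; elim: h => [|h IH]; first by rewrite gwE0 mul0r.
set q := \sum_(d < N.+1 | _) _ in IH *.
have q0 : 0 <= q by apply: sumr_ge0.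
set e := gwE m N h _ in IH.
have e0 : 0 <= e by apply: gwE_ge0.
have tot0 : 0 <= gwE m N h (fun=> 1) by apply: gwE_ge0.
have totd j : gwE m N h (fun=> 1) ^+ j <= 1.
  by apply: exprn_ile1 => //; exact: (gwE1_le1 m_ge0).
apply: (@le_trans _ _ (\sum_(d < N.+1) ((if (L < d)%N then m d else 0) + m d * d%:R * e))).
  rewrite gwES; apply: ler_sum => d _.
  pose f1 t : R := (L < maxdeg t)%N%:R.
  apply: (@le_trans _ _ (m d * ((L < d)%N%:R * gwE m N h (fun=> 1) ^+ d +
      d%:R * (gwE m N h f1 * gwE m N h (fun=> 1) ^+ d.-1)))).
    apply: ler_wpM2l => //.
    rewrite -forestE_prod1 -(forestE_mark1 m N h d (fun=> 1) f1) -forestEZ -forestED.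
    apply: le_forestE => // ts dE; rewrite big1 ?mulr1//.
    under eq_bigr do rewrite big1 ?mulr1//.
    have S0 : 0 <= \sum_(i < d) f1 (nth leaf ts i) by apply: sumr_ge0 => i _; exact: ler0n.
    case: leqP => [_|]; first by rewrite addr_ge0.
    rewrite ltnNge maxdeg_leP negb_and -ltnNge dE; case: ltnP => /= Ld.
      by rewrite lerDl.
    case/allPn => t /(nthP leaf)[i + <-]; rewrite dE => id; rewrite -ltnNge => Lt.
    rewrite add0r; apply: (@le_trans _ _ (f1 (nth leaf ts (Ordinal id)))).
      by rewrite /f1 Lt.
    by apply: (le_sum_term (i := Ordinal id)) => // k _; exact: ler0n.
  rewrite mulrDr; apply: lerD.
    case: ltnP => _; rewrite ?mul0r ?mulr0// mul1r ler_piMr//.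
  rewrite -mulrA ler_wpM2l// ler_wpM2l// ler_piMr//.
rewrite big_split /= -big_mkcond -/q -big_distrl /= -natr1 mulrDl mul1r addrC lerD//.
by apply: le_trans IH; rewrite ler_piMl.
Qed.

End SizeDistribution.

(** Let [g] be the least positive difference of two elements of [T]. Euclidean division of an
    element of [A] by [g] leaves a remainder that is again a difference, so [g] divides all of [A]
    and is 1. Two consecutive elements b and b + 1 then generate everything from b^2 on. *)
Lemma coin_problem (T : nat -> Prop) (A : set nat) :
  T 0%N -> (forall a b, T a -> T b -> T (a + b)%N) -> (forall i, A i -> T i) ->
  is_gcd A 1 -> exists n0, forall n, (n0 <= n)%N -> T n.
Proof.
move=> T0 TD AT [_ gcd1].
have TM a k : T a -> T (k * a)%N.
  by move=> Ta; elim: k => [|k IH]; rewrite ?mul0n// mulSn; exact: TD.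
pose D g := `[< (0 < g)%N /\ exists b, T b /\ T (b + g)%N >].
have [i [Ai i0]] : exists i, A i /\ (0 < i)%N.
  apply: contrapT => H; have /(_ 2) := gcd1.
  suff : forall i, A i -> (2 %| i)%N by move=> h /(_ h).
  move=> i Ai; case: (posnP i) => [->//|i0]; by exfalso; apply: H; exists i.
have exD : exists g, D g.
  by exists i; apply/asboolP; split => //; exists 0%N; split => //; exact: AT.
have [g /asboolP[g0 [b [Tb Tbg]]] gmin] := ex_minnP exD.
have g1 : g = 1%N.
  apply/eqP; rewrite -dvdn1; apply: gcd1 => d Ad.
  case: (posnP (d %% g)) => [/eqP//|r0].
  have := gmin (d %% g)%N; rewrite leqNgt ltn_mod g0 => H; exfalso.
  suff /H : D (d %% g)%N by [].
  apply/asboolP; split => //; exists (d %/ g * (b + g))%N; split; first exact: TM.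
  have -> : (d %/ g * (b + g) + d %% g = d + d %/ g * b)%N.
    by rewrite mulnDr -addnA -divn_eq addnC.
  by apply: TD; [exact: AT|exact: TM].
rewrite g1 in Tbg; case: (posnP b) => [b0|b0].
  exists 0%N => n _; rewrite -[n]muln1; apply: TM; by move: Tbg; rewrite b0.
exists (b * b)%N => n bn.
have -> : n = ((n %/ b - n %% b) * b + n %% b * (b + 1))%N.
  have h : (n %% b <= n %/ b)%N.
    by rewrite (leq_trans (ltnW (ltn_pmod n b0)))// leq_divRL.
  by rewrite mulnBl mulnDr muln1 {1}(divn_eq n b) addnA subnK// leq_mul2r h orbT.
by apply: TD; exact: TM.
Qed.

Lemma expR1_le4 (R : realType) : expR 1 <= 4 :> R.
Proof.
have h : (1 : R) = 1 / 2 + 1 / 2 by field.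
rewrite h expRD; have := @expR_le2 R (1 / 2) (lexx _); have := expR_ge0 (1 / 2 : R); nra.
Qed.

Lemma split_size n a j n0 : (4 * a <= n)%N -> (4 * j <= n)%N -> (2 * n0 <= n)%N ->
  (0 < a)%N -> [/\ n = (a + (n - a - j) + j)%N, (n0 <= n - a - j)%N & (n - a - j < n)%N].
Proof. by move=> h1 h2 h3 a0; split; lia. Qed.

Section SizeLowerBound.
Context {R : realType}.
Variables (m : nat -> R) (m_ge0 : forall d, 0 <= m d).
Hypothesis m_sum0 : forall L, \sum_(d < L.+1) m d <= 1.
Hypothesis m_sum1 : forall L, \sum_(d < L.+1) m d * d%:R <= 1.
Variable C2 : R.
Hypothesis m_sum2 : forall L, \sum_(d < L.+1) m d * d%:R ^+ 2 <= C2.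
Hypothesis m_crit : forall eps L0, 0 < eps -> exists L, [/\ (L0 <= L)%N,
  1 - eps <= \sum_(d < L.+1) m d & 1 - eps <= \sum_(d < L.+1) m d * d%:R].
Hypothesis m0_gt0 : 0 < m 0%N.
Variable j2 : nat.
Hypothesis mj2_gt0 : 0 < m j2.+2.
Implicit Types (u zeta eta eps : R) (h L n : nat).

Let C2_ge0 : 0 <= C2.
Proof. by apply: le_trans (m_sum2 0); apply: sumr_ge0 => d _; rewrite mulr_ge0 ?exprn_ge0. Qed.

Let c := m j2.+2.

Let c_le L : (j2.+2 <= L)%N -> c <= \sum_(d < L.+1 | (1 < d)%N) m d.
Proof.
rewrite -ltnS => jL.
exact: (@le_sum_term _ _ (fun d : 'I_L.+1 => (1 < d)%N) _ (Ordinal jL)).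
Qed.

Lemma pow_one_sub_le zeta d : 0 <= zeta -> zeta <= 1 ->
  (1 - zeta) ^+ d <= 1 - d%:R * zeta + d%:R ^+ 2 * zeta ^+ 2.
Proof.
move=> z0 z1; elim: d => [|d IH]; first by rewrite expr0 mul0r expr0n mul0r subr0 addr0.
rewrite exprS -natr1; apply: (le_trans (ler_wpM2l _ IH)); first lra.
have d0 : 0 <= d%:R :> R by []; move: (d%:R) d0 => v v0.
have : 0 <= v * zeta ^+ 2 by rewrite mulr_ge0// sqr_ge0.
have : 0 <= zeta ^+ 2 by rewrite sqr_ge0.
have : 0 <= v ^+ 2 * zeta ^+ 3 by rewrite mulr_ge0 ?exprn_ge0.
lra.
Qed.

(** Converse of [gwE_onesubX]: the bound 1 - zeta is preserved by the recursion for the generating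
    function, because the error terms are at most u / 2 and [zeta <= 1 / 2]. *)
Lemma generating_le u zeta eps L h : 0 < u -> u <= 1 -> 0 <= zeta -> zeta <= 1 / 2 ->
  0 <= eps -> eps * zeta + C2 * zeta ^+ 2 <= u / 2 ->
  1 - eps <= \sum_(d < L.+1) m d * d%:R ->
  gwE m L h (fun t => (1 - u) ^+ tsz t) <= 1 - zeta.
Proof.
move=> u0 u1 z0 z1 e0 ez mL; elim: h => [|h IH]; first by rewrite gwE0; lra.
set F := gwE m L h _ in IH.
have F0 : 0 <= F by apply: gwE_ge0 => // t; rewrite exprn_ge0//; lra.
rewrite gwES; apply: (@le_trans _ _ (\sum_(d < L.+1) (1 - u) *
    (m d - zeta * (m d * d%:R) + zeta ^+ 2 * (m d * d%:R ^+ 2)))).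
  apply: ler_sum => d _.
  have -> : forestE m L h d (fun ts => (1 - u) ^+ tsz (Node ts)) = (1 - u) * F ^+ d.
    rewrite /F -forestE_prod1 -forestEZ; apply: eq_bigr => ts _; congr (_ * _).
    by rewrite prod_pow_tsz -exprS.
  rewrite mulrCA ler_wpM2l//; first lra.
  have -> : m d - zeta * (m d * d%:R) + zeta ^+ 2 * (m d * d%:R ^+ 2) =
     m d * (1 - d%:R * zeta + d%:R ^+ 2 * zeta ^+ 2) by ring.
  rewrite ler_wpM2l// (le_trans _ (pow_one_sub_le d z0 _))//; last lra.
  by apply: lerXn2r; rewrite ?nnegrE//; lra.
rewrite -big_distrr /= big_split /= sumrB -!big_distrr /=.
have := m_sum0 L; have := m_sum2 L; move: mL.
set s1 := \sum_(i < _) m i * i%:R; set s2 := \sum_(i < _) m i * _ ^+ 2.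
set s0 := \sum_(i < _) m i => h1 h2 h0.
have zz : 0 <= zeta ^+ 2 by exact: sqr_ge0.
have H : s0 - zeta * s1 + zeta ^+ 2 * s2 <= 1 - zeta + (eps * zeta + C2 * zeta ^+ 2) by nra.
move: (eps * zeta + C2 * zeta ^+ 2) ez H => q ez H.
apply: (le_trans (ler_wpM2l _ H)); first lra.
have q0 : 0 <= u * zeta by nra.
case: (leP 0 q) => hq; nra.
Qed.

(** While the missing mass exceeds [eta], each further generation reduces it by at least c eta^2 /
    2, so it falls to [eta] after finitely many. *)
Lemma extinction_near eta eps L : 0 < eta -> 2 * eps <= c * eta ^+ 2 ->
  (j2.+2 <= L)%N -> 1 - eps <= \sum_(d < L.+1) m d ->
  exists h, 1 - gwE m L h (fun=> 1) <= eta.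
Proof.
move=> eta0 epsc jL mL; apply: contrapT => H.
have {}H h : eta < 1 - gwE m L h (fun=> 1).
  by rewrite ltNge; apply/negP => h1; apply: H; exists h.
have ce : 0 < c * eta ^+ 2 / 2 by rewrite divr_gt0 ?mulr_gt0 ?exprn_gt0.
have K h : 1 - gwE m L h (fun=> 1) <= 1 - h%:R * (c * eta ^+ 2 / 2).
  elim: h => [|h IH]; first by rewrite gwE0 mul0r.
  have tot1 := gwE1_le1 m_ge0 (m_sum0 L) h.
  have tot0 : 0 <= gwE m L h (fun=> 1) by apply: gwE_ge0.
  set tot := gwE m L h _ in IH tot1 tot0.
  have -> : gwE m L h.+1 (fun=> 1) = \sum_(d < L.+1) m d * tot ^+ d.
    rewrite gwES; apply: eq_bigr => d _; congr (_ * _).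
    rewrite -forestE_prod1; apply: eq_bigr => ts _; congr (_ * _); by rewrite big1.
  have H1 := H h; rewrite -/tot in H1.
  suff : \sum_(d < L.+1) (m d - (m d * d%:R * (1 - tot) -
            (if (1 < d)%N then m d else 0) * (1 - tot) ^+ 2)) <=
     \sum_(d < L.+1) m d * tot ^+ d.
    rewrite !sumrB -!big_distrl/= -big_mkcond/=.
    have := m_sum1 L; have := c_le jL; move: mL.
    set s1 := \sum_(i < _) m i * i%:R; set s0 := \sum_(i < _) m i.
    set s2 := \sum_(i < _ | _) m i => h0 h2 h1.
    have e2 : eta ^+ 2 <= (1 - tot) ^+ 2 by apply: lerXn2r; rewrite ?nnegrE; lra.
    have ce2 : c * eta ^+ 2 <= s2 * (1 - tot) ^+ 2.
      by apply: ler_pM => //; [exact: ltW|exact: sqr_ge0].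
    have : s1 * (1 - tot) <= 1 - tot by rewrite ler_piMl//; lra.
    rewrite -natr1; lra.
  apply: ler_sum => d _.
  have -> : m d - (m d * d%:R * (1 - tot) - (if (1 < d)%N then m d else 0) * (1 - tot) ^+ 2)
     = m d * (1 - (d%:R * (1 - tot) - (1 < d)%N%:R * (1 - tot) ^+ 2)).
    by case: ifP => _ /=; ring.
  rewrite ler_wpM2l//.
  have := @onesubX_le R (1 - tot) d ltac:(lra) ltac:(lra); rewrite subKr; lra.
have [h hh] : exists h : nat, 1 < h%:R * (c * eta ^+ 2 / 2).
  exists (Num.truncn ((c * eta ^+ 2 / 2)^-1)).+1.
  by rewrite -ltr_pdivrMr// mul1r truncnS_gt.
have := K h; have := H h; lra.
Qed.

(** [b0] makes zeta = b0 sqrt u admissible in [generating_le]. [K] makes each of the two tails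
    outside the window of [size_window] at most a quarter of the lower bound zeta / 2. *)
Let b0 : R := (4 * (1 + C2))^-1.
Let a := tail_const c.
Let K : R := (8 * a / b0 + 1) ^+ 2.

Let b0_gt0 : 0 < b0. Proof. by rewrite invr_gt0 mulr_gt0// ltr_pwDl. Qed.
Let a_gt0 : 0 < a. Proof. exact: tail_const_gt0. Qed.
Let K_ge1 : 1 <= K.
Proof.
rewrite /K exprn_ege1// lerDr; apply: divr_ge0; last exact: ltW.
by apply: mulr_ge0 => //; exact: ltW.
Qed.

(** The mean of min (u |T|, 1) is at least zeta / 2, and [gwE_min] at u / K and K u bounds the
    contributions of sizes above K / u and below 1 / (K u). What is left lies in the window, where
    the minimum is at most 1. *)
Lemma size_window u : 0 < u -> u * K <= 1 -> exists L h,
  b0 / 4 * Num.sqrt u <=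
  gwE m L h (fun t => ((1 <= K * u * (tsz t)%:R) && (u * (tsz t)%:R < K))%:R).
Proof.
move=> u0 uK.
have K0 : 0 < K by exact: lt_le_trans ltr01 K_ge1.
have u1 : u <= 1 by apply: le_trans uK; rewrite ler_peMr// ltW.
pose zeta := b0 * Num.sqrt u.
have su0 : 0 < Num.sqrt u by rewrite sqrtr_gt0.
have su2 : Num.sqrt u ^+ 2 = u by rewrite sqr_sqrtr// ltW.
have su1 : Num.sqrt u <= 1 by rewrite -[leRHS]sqrtr1 ler_sqrt.
have b0E : b0 * (4 * (1 + C2)) = 1 by rewrite mulVf// gt_eqF// mulr_gt0// ltr_pwDl.
have b01 : b0 <= 1 / 4 by have := b0_gt0; have := C2_ge0; nra.
have z0 : 0 < zeta by rewrite mulr_gt0.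
have z1 : zeta <= 1 / 4 by rewrite /zeta; have := b0_gt0; nra.
have z2 : zeta ^+ 2 * (1 + C2) <= u / 2.
  rewrite /zeta exprMn su2.
  have -> : b0 ^+ 2 * u * (1 + C2) = b0 * (4 * (1 + C2)) * (b0 * u / 4) by field.
  by rewrite b0E mul1r; have := b0_gt0; nra.
pose eta := zeta / 2; pose eps := c * eta ^+ 2 / 2.
have eta0 : 0 < eta by rewrite divr_gt0.
have eps0 : 0 < eps by rewrite divr_gt0// mulr_gt0// exprn_gt0.
have [L [jL mL0 mL1]] := m_crit j2.+2 eps0.
have c12 : c <= 1 / 2 by exact: (c_le_half m_ge0 (m_sum1 L) (c_le jL)).
have epsz : eps <= zeta by rewrite /eps /eta; nra.
have [h hh] := @extinction_near eta eps L eta0 ltac:(rewrite /eps; lra) jL mL0.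
exists L, h.
have gen := @generating_le u zeta eps L h u0 u1 (ltW z0) ltac:(lra) (ltW eps0) ltac:(nra) mL1.
have lower : zeta / 2 <= gwE m L h (fun t => Num.min (u * (tsz t)%:R) 1).
  apply: (@le_trans _ _ (gwE m L h (fun t => 1 - (1 - u) ^+ tsz t))).
    rewrite gwEB; move: hh gen; rewrite /eta.
    set x := gwE _ _ _ _; set y := gwE _ _ _ _; lra.
  apply: le_gwE => // t _; rewrite le_min gerBl exprn_ge0 ?andbT; last lra.
  elim: (tsz t) => [|k IH]; first by rewrite expr0 subrr mulr0.
  have : (1 - u) ^+ k <= 1 by apply: exprn_ile1; lra.
  rewrite exprS -natr1; have := IH; nra.
pose rK : R := 8 * a / b0 + 1.
have rK0 : 0 < rK by rewrite addr_gt0// divr_gt0// mulr_gt0.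
have KE : Num.sqrt K = rK by rewrite /K sqrtr_sqr ger0_norm// ltW.
have up1 := @gwE_min R m m_ge0 L (m_sum0 L) (m_sum1 L) c mj2_gt0 (c_le jL) h (u / K).
have up2 := @gwE_min R m m_ge0 L (m_sum0 L) (m_sum1 L) c mj2_gt0 (c_le jL) h (K * u).
set W := gwE m L h _.
suff : gwE m L h (fun t => Num.min (u * (tsz t)%:R) 1) <= W + a * Num.sqrt (u / K) + K^-1 * (a * Num.sqrt (K * u)).
  have -> : Num.sqrt (u / K) = Num.sqrt u / rK.
    by rewrite sqrtrM ?(ltW u0)// sqrtrV ?(ltW K0)// KE.
  have -> : Num.sqrt (K * u) = rK * Num.sqrt u by rewrite sqrtrM ?(ltW K0)// KE.
  have -> : K^-1 * (a * (rK * Num.sqrt u)) = a * (Num.sqrt u / rK).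
    by rewrite /K -/rK; field; rewrite gt_eqF.
  have : a * (Num.sqrt u / rK) <= b0 / 8 * Num.sqrt u.
    have -> : a * (Num.sqrt u / rK) = a / rK * Num.sqrt u by ring.
    rewrite ler_wpM2r ?(ltW su0)// ler_pdivrMr//.
    have -> : b0 / 8 * rK = a + b0 / 8 by rewrite /rK; field; rewrite gt_eqF.
    by rewrite lerDl divr_ge0// (ltW b0_gt0).
  move: lower; rewrite /zeta; lra.
apply: (@le_trans _ _ (W + gwE m L h (fun t => Num.min (u / K * (tsz t)%:R) 1) +
    K^-1 * gwE m L h (fun t => Num.min (K * u * (tsz t)%:R) 1))).
  rewrite -gwEZ -!gwED; apply: le_gwE => // t _.
  have tz : 0 <= (tsz t)%:R :> R by [].
  move: (tsz t)%:R tz => v v0.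
  have Kuv0 : 0 <= K * u * v by exact: mulr_ge0 (mulr_ge0 (ltW K0) (ltW u0)) v0.
  have uKv0 : 0 <= u / K * v by exact: mulr_ge0 (divr_ge0 (ltW u0) (ltW K0)) v0.
  have m1 : 0 <= Num.min (u / K * v) 1 by rewrite le_min uKv0 ler01.
  have m2 : 0 <= Num.min (K * u * v) 1 by rewrite le_min Kuv0 ler01.
  have Ki0 : 0 < K^-1 by rewrite invr_gt0.
  have m20 := mulr_ge0 (ltW Ki0) m2.
  case: (leP 1 (K * u * v)) => h1 /=; last first.
    rewrite add0r ler_wpDl//.
    by rewrite -mulrA mulKf ?(gt_eqF K0)// ge_min lexx.
  case: ltP => h2 /=.
    have : Num.min (u * v) 1 <= 1 by rewrite ge_min lexx orbT.
    by rewrite mulr1n; lra.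
  have : 1 <= Num.min (u / K * v) 1.
    by rewrite le_min lexx andbT mulrAC ler_pdivlMr// mul1r.
  have : Num.min (u * v) 1 <= 1 by rewrite ge_min lexx orbT.
  by lra.
have := up1 _ _; have := up2 _ _.
have -> : 0 < u / K by rewrite divr_gt0.
have -> : 0 < K * u by rewrite mulr_gt0.
have -> : K * u <= 1 by rewrite mulrC.
have -> : u / K <= 1 by rewrite ler_pdivrMr// mul1r (le_trans u1).
move=> /(_ isT isT) h2 /(_ isT isT) h1; rewrite -/a in h1 h2.
apply: lerD; first by rewrite lerD2l.
by apply: ler_wpM2l => //; rewrite invr_ge0 (ltW K0).
Qed.

Lemma gwE_size_pred L h n (P : pred nat) : (forall j, P j -> (j < n)%N) ->
  gwE m L h (fun t => (P (tsz t))%:R) <= \sum_(j < n | P j) size_pr m j.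
Proof.
move=> Pn; apply: (@le_trans _ _ (\sum_(j < n | P j) gwE m L h (fun t => (tsz t == j)%:R))).
  rewrite /gwE exchange_big /=; apply: ler_sum => t _.
  case: (boolP (P (tsz t))) => Pt; last first.
    by rewrite mulr0; apply: sumr_ge0 => j _; rewrite mulr_ge0 ?weight_ge0.
  rewrite (bigD1 (Ordinal (Pn _ Pt)))//= eqxx lerDl; apply: sumr_ge0 => j _.
  by rewrite mulr_ge0 ?weight_ge0.
by apply: ler_sum => j _; exact: gwE_size_le.
Qed.

(** With u = 4 K / n the window lies between n / (4 K^2) and n / 4. Its mass is at least of order
    n^(-1/2) and it contains at most [n] sizes, so for large [n] one of them has probability at
    least n^(-2). *)
Lemma good_size : exists A : R, exists n0 : nat, 1 <= A /\
  forall n, (n0 <= n)%N -> exists j, [/\ n%:R <= A * j%:R, (4 * j <= n)%N &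
    (n%:R ^+ 2)^-1 <= size_pr m j].
Proof.
have K0 : 0 < K := lt_le_trans ltr01 K_ge1.
have K1 := K_ge1.
pose beta := b0 / 4; have beta0 : 0 < beta by exact: divr_gt0.
exists (4 * K ^+ 2), (maxn 1 (maxn (Num.truncn (4 * K ^+ 2)).+1 (Num.truncn ((beta ^+ 2)^-1)).+1)).
split; first by rewrite expr2; nra.
move=> n; rewrite !geq_max => /and3P[n1 nK nb].
have {}nK : 4 * K ^+ 2 <= n%:R.
  by rewrite (le_trans (ltW (truncnS_gt _)))// ler_nat.
have {}nb : (beta ^+ 2)^-1 < n%:R.
  by rewrite (lt_le_trans (truncnS_gt _))// ler_nat.
have n0 : 0 < n%:R :> R by rewrite ltr0n.
pose u := 4 * K / n%:R.
have u0 : 0 < u by apply: divr_gt0 => //; exact: mulr_gt0.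
have uK : u * K <= 1.
  by rewrite /u mulrAC ler_pdivrMr// mul1r -mulrA -expr2.
have [L [h win]] := size_window u0 uK.
pose P j := (1 <= K * u * j%:R) && (u * j%:R < K).
have PE j : P j -> (n%:R <= 4 * K ^+ 2 * j%:R) /\ (4 * j < n)%N.
  move=> /andP[]; rewrite /u.
  have -> : K * (4 * K / n%:R) * j%:R = 4 * K ^+ 2 * j%:R / n%:R by ring.
  have -> : 4 * K / n%:R * j%:R = (4 * j)%N%:R * K / n%:R by rewrite natrM; ring.
  rewrite ler_pdivlMr// mul1r ltr_pdivrMr// => -> h2; split => //.
  by rewrite -(ltr_nat R); move: h2; rewrite [_ * K]mulrC ltr_pM2l.
apply: contrapT => H.
have small j : P j -> size_pr m j <= (n%:R ^+ 2)^-1.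
  move=> /PE[h1 h2]; rewrite leNgt; apply/negP => h3; apply: H; exists j.
  by split; [|exact: ltnW|exact: ltW].
have : beta * Num.sqrt u <= n%:R^-1.
  apply: (le_trans win); apply: (le_trans (@gwE_size_pred L h n P _)).
    by move=> j /PE[_ h2]; rewrite (leq_ltn_trans _ h2)// leq_pmull.
  apply: (@le_trans _ _ (\sum_(j < n) (n%:R ^+ 2)^-1)).
    rewrite big_mkcond; apply: ler_sum => j _; case: ifP => [/small//|_].
    by rewrite invr_ge0 sqr_ge0.
  rewrite sumr_const card_ord -[_ *+ n]mulr_natr le_eqVlt; apply/orP; left; apply/eqP.
  by field; rewrite gt_eqF.
rewrite leNgt => /negP; apply.
rewrite -(@ltr_pXn2r _ 2)// ?nnegrE ?invr_ge0 ?(ltW n0)//; last first.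
  by rewrite mulr_ge0 ?sqrtr_ge0// (ltW beta0).
rewrite exprMn sqr_sqrtr ?(ltW u0)// /u exprVn.
have b2 : 0 < beta ^+ 2 by rewrite exprn_gt0.
have : 1 < beta ^+ 2 * n%:R by rewrite -ltr_pdivrMl// mulr1.
have -> : beta ^+ 2 * (4 * K / n%:R) = (beta ^+ 2 * n%:R) * (4 * K) * (n%:R ^+ 2)^-1.
  by field; rewrite gt_eqF.
have ni : 0 < (n%:R ^+ 2)^-1 :> R by rewrite invr_gt0 exprn_gt0.
rewrite ltr_pMl//; nra.
Qed.

Lemma size_pr_eventually_gt0 :
  is_gcd [set i : nat | 0 < m i] 1 -> exists n0, forall n, (n0 <= n)%N -> 0 < size_pr m n.
Proof.
(* [T] is the additive set of increments that keep sizes attainable; grafting puts the support of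
   the offspring law into it. *)
move=> gcd1; pose T k := forall j, 0 < size_pr m j -> 0 < size_pr m (j + k).
have p1 : 0 < size_pr m 1.
  by rewrite /size_pr (_ : trees_size 1 = [:: leaf])// big_seq1 weight_leaf.
have [|k1 k2 Ta Tb j jp|i /= mi j jp|n0 Hn0] := @coin_problem T [set i : nat | 0 < m i] _ _ _ gcd1.
- by move=> j; rewrite addn0.
- by rewrite addnA; apply: Tb; exact: Ta.
- case: i mi => [_|d md]; first by rewrite addn0.
  by apply: lt_le_trans (size_pr_graft m_ge0 j d); rewrite !mulr_gt0// exprn_gt0.
exists n0.+1 => -[//|n] nn; rewrite -add1n; exact: Hn0.
Qed.

Lemma size_pr_bounded_lower n0 n1 : (forall n, (n0 <= n)%N -> 0 < size_pr m n) ->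
  exists2 C : R, 0 <= C & forall n, (n0 <= n)%N -> (n < n1)%N -> expR (- C) <= size_pr m n.
Proof.
move=> p0; elim: n1 => [|n1 [C C0 HC]]; first by exists 0.
exists (Num.max C (- ln (size_pr m n1))); first by rewrite le_max C0.
move=> n nn0; rewrite ltnS leq_eqVlt => /orP[/eqP en|/(HC _ nn0)]; last first.
  by apply: le_trans; rewrite ler_expR lerN2 le_max lexx.
rewrite en in nn0 *; rewrite -[leRHS]lnK ?posrE ?p0// ler_expR lerNl le_max lexx orbT//.
Qed.

(* Splitting off a subtree whose size is likely and comparable to n costs a power of n and divides n
   by a constant, so the cost is incurred O(ln n) times. *)
Lemma size_pr_lower : is_gcd [set i : nat | 0 < m i] 1 ->
  exists C : R, exists n0 : nat, 0 <= C /\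
  forall n, (n0 <= n)%N -> expR (- (C * ln n%:R ^+ 2)) <= size_pr m n.
Proof.
move=> /size_pr_eventually_gt0[r0 pos].
have [A [n1 [A1 good]]] := good_size.
pose n0 := maxn 4 r0.
pose kappa := m j2.+2 * m 0%N ^+ j2.
have k0 : 0 < kappa by rewrite mulr_gt0// exprn_gt0.
(* The part split off has at least n / A vertices, so the rest has at most q n; the 2 keeps [q]
   positive when A = 1. *)
pose q := 1 - (2 * A)^-1.
have iA0 : 0 < (2 * A)^-1 by rewrite invr_gt0; lra.
have iA1 : (2 * A)^-1 <= 1 / 2 by rewrite mul1r lef_pV2 ?posrE; lra.
have q0 : 0 < q by rewrite /q; lra.
have q1 : q < 1 by rewrite /q; lra.
pose g := - ln q.
have g0 : 0 < g by rewrite /g oppr_gt0 ln_lt0// q0 q1.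
pose n2 := maxn n1 (maxn (2 * n0) (maxn (4 * j2.+1) (Num.truncn kappa^-1).+1)).
have pos0 n : (n0 <= n)%N -> 0 < size_pr m n.
  by rewrite geq_max => /andP[_]; exact: pos.
have [C0 C00 base] := size_pr_bounded_lower n2 pos0.
(* A split costs at most 3 ln n in the exponent, 2 from [good_size] and 1 from [kappa], and lowers
   ln n by at least [g], hence its square by at least g ln n. *)
pose C := C0 + 3 / g.
have C3 : 3 <= C * g by rewrite /C mulrDl divfK ?gt_eqF// lerDr mulr_ge0// ltW.
have CC : 0 <= C by rewrite addr_ge0// divr_ge0// ltW.
exists C, n0; split => //.
have ln1 n : (n0 <= n)%N -> 1 <= ln n%:R :> R.
  rewrite geq_max => /andP[n4 _].
  apply: (@le_trans _ _ (ln (expR 1))); first by rewrite expRK.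
  rewrite ler_ln ?posrE ?expR_gt0 ?ltr0n ?(leq_trans _ n4)//.
  by rewrite (le_trans (expR1_le4 R))// ler_nat.
elim/ltn_ind => n IH nn0.
have n4 : (4 <= n)%N by move: nn0; rewrite geq_max => /andP[].
have np : 0 < n%:R :> R by rewrite ltr0n (leq_trans _ n4).
case: (ltnP n n2) => nn2.
  apply: le_trans (base _ nn0 nn2); rewrite ler_expR lerN2.
  have l1 := ln1 _ nn0.
  have l2 : 1 <= ln n%:R ^+ 2 :> R by exact: exprn_ege1.
  apply: (@le_trans _ _ C); first by rewrite /C lerDl divr_ge0// ltW.
  by rewrite ler_peMr.
move: nn2; rewrite !geq_max => /and4P[h1 h2 h3 h4].
have [a' [aA a4 pa]] := good _ h1.
have a0 : (0 < a')%N.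
  by rewrite lt0n; apply/eqP => a0; move: aA; rewrite a0 mulr0 leNgt np.
have [en nb bn] := split_size a4 h3 h2 a0.
set b := (n - a' - j2.+1)%N in en nb bn.
have IHb := IH _ bn nb.
have l1 := ln1 _ nn0; have lb1 := ln1 _ nb.
have bp : 0 < b%:R :> R.
  by move: nb; rewrite geq_max ltr0n => /andP[nb _]; exact: leq_trans nb.
have bq : b%:R <= n%:R * q.
  have e : n%:R = a'%:R + b%:R + j2.+1%:R :> R by rewrite -!natrD -en.
  have : n%:R * (2 * A)^-1 <= a'%:R.
    rewrite ler_pdivrMr; last lra.
    have : 0 <= a'%:R :> R by [].
    by move: aA; nra.
  have : 0 <= j2.+1%:R :> R by [].
  rewrite /q mulrBr mulr1; lra.
have lnb : ln b%:R <= ln n%:R - g.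
  rewrite /g opprK -lnM ?posrE// ler_ln ?posrE ?mulr_gt0//.
have lnk : - ln kappa <= ln n%:R.
  rewrite -lnV ?posrE// ler_ln ?posrE ?invr_gt0//.
  by rewrite (le_trans (ltW (truncnS_gt _)))// ler_nat.
rewrite {2}en; apply: le_trans (size_pr_join m_ge0 a' b j2).
apply: (@le_trans _ _ (kappa * ((n%:R ^+ 2)^-1 * expR (- (C * ln b%:R ^+ 2))))); last first.
  by rewrite ler_pM2l//; apply: ler_pM => //; rewrite ?expR_ge0// invr_ge0 sqr_ge0.
rewrite -{1}(lnK (_ : kappa \is Num.pos)) ?posrE//.
have -> : (n%:R ^+ 2)^-1 = expR (- (2 * ln n%:R)) :> R.
  by rewrite expRN mulrC mulr_natr -lnXn// lnK// posrE exprn_gt0.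
rewrite -!expRD ler_expR.
set x := ln n%:R in l1 lnb lnk *; set y := ln b%:R in lb1 lnb *.
have y2 : y ^+ 2 <= x ^+ 2 - g * x by nra.
have := ler_wpM2l CC y2; rewrite mulrBr.
have : 3 * x <= C * g * x by apply: ler_wpM2r => //; lra.
rewrite mulrA; lra.
Qed.
End SizeLowerBound.

(** * Chosen subtrees and remainder *)

Lemma map_zip_iota (A B : Type) (F : nat * A -> B) (g : ptree -> A) ts :
  [seq F q | q <- zip (iota 0 (size ts)) (map g ts)] =
  [seq F (i, g (nth leaf ts i)) | i <- iota 0 (size ts)].
Proof.
suff H k : [seq F q | q <- zip (iota k (size ts)) (map g ts)] =
  [seq F (i, g (nth leaf ts (i - k))) | i <- iota k (size ts)].
  by rewrite H; apply: eq_map => i; rewrite subn0.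
elim: ts k => //= t ts IH k; rewrite subnn; congr cons.
rewrite IH; apply/eq_in_map => i; rewrite mem_iota => /andP[ki _].
by rewrite -[in RHS](subnSK ki).
Qed.

Section Decomposition.
Variables (x M l : nat).
Notation big := (is_big x).
Notation chosen := (is_chosen x M).
Notation nxt := (child_state x l).
Implicit Types (t : ptree) (ts : seq ptree) (k : nat) (u v : word) (f : word -> ptree).

Fixpoint cuts t k : seq (word * ptree) :=
  match t with Node ts =>
    if chosen k (Node ts) then [:: ([::], Node ts)] else
    if big (Node ts) then
      flatten [seq [seq (q.1 :: p.1, p.2) | p <- q.2]
        | q <- zip (iota 0 (size ts)) (map (fun t => cuts t (nxt k ts)) ts)]
    else [::]
  end.

(** A chosen subtree becomes a leaf and is not deleted: its root [v_i] is a vertex of the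
    remainder. *)
Fixpoint prune t k : ptree :=
  match t with Node ts =>
    if chosen k (Node ts) then leaf else
    if big (Node ts) then Node [seq prune t (nxt k ts) | t <- ts] else Node ts
  end.

Fixpoint refill t k : (word -> ptree) -> ptree :=
  match t with Node ts => fun f =>
    if chosen k (Node ts) then f [::] else
    if big (Node ts) then
      Node [seq q.2 (fun v => f (q.1 :: v))
        | q <- zip (iota 0 (size ts)) (map (fun t => refill t (nxt k ts)) ts)]
    else Node ts
  end.

Lemma cutsE ts k : cuts (Node ts) k =
  if chosen k (Node ts) then [:: ([::], Node ts)] else
  if big (Node ts) then
    flatten [seq [seq (i :: p.1, p.2) | p <- cuts (nth leaf ts i) (nxt k ts)]
      | i <- iota 0 (size ts)]
  else [::].
Proof. by rewrite /= (map_zip_iota (fun q => [seq (q.1 :: p.1, p.2) | p <- q.2])). Qed.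

Lemma refillE ts k f : refill (Node ts) k f =
  if chosen k (Node ts) then f [::] else
  if big (Node ts) then
    Node [seq refill (nth leaf ts i) (nxt k ts) (fun v => f (i :: v)) | i <- iota 0 (size ts)]
  else Node ts.
Proof. by rewrite /= (map_zip_iota (fun q => q.2 (fun v => f (q.1 :: v)))). Qed.

Lemma pruneE ts k : prune (Node ts) k =
  if chosen k (Node ts) then leaf else
  if big (Node ts) then Node [seq prune t (nxt k ts) | t <- ts] else Node ts.
Proof. by []. Qed.

Arguments cuts : simpl never.
Arguments prune : simpl never.
Arguments refill : simpl never.

Lemma cuts_not_big t k : ~~ big t -> cuts t k = [::].
Proof.
case: t => ts nb; rewrite cutsE (negbTE nb) /is_chosen.
by move: nb; rewrite /is_big => /negbTE ->; rewrite andbF.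
Qed.

Lemma chosen_big k t : chosen k t -> big t. Proof. by case/and3P. Qed.

Lemma cut_consP i v s ts k : ~~ chosen k (Node ts) -> big (Node ts) ->
  ((i :: v, s) \in cuts (Node ts) k) =
  (i < size ts)%N && ((v, s) \in cuts (nth leaf ts i) (nxt k ts)).
Proof.
move=> nc bt; rewrite cutsE (negbTE nc) bt; apply/flatten_mapP/andP.
  by move=> [j]; rewrite mem_iota /= => js /mapP[[w r] wr [-> -> ->]].
by move=> [il vs]; exists i; [rewrite mem_iota|apply/mapP; exists (v, s)].
Qed.

Lemma cut_nilP s t k : (([::], s) \in cuts t k) = chosen k t && (s == t).
Proof.
case: t => ts; rewrite cutsE; case: ifPn => nc /=.
  by rewrite inE xpair_eqE eqxx.
case: ifP => // _; apply/flatten_mapP => -[i _ /mapP[[w r] _ //]].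
Qed.

Lemma cut_ind (P : nat -> ptree -> word -> ptree -> Prop) :
  (forall k t, chosen k t -> P k t [::] t) ->
  (forall k ts i v s, ~~ chosen k (Node ts) -> big (Node ts) -> (i < size ts)%N ->
     (v, s) \in cuts (nth leaf ts i) (nxt k ts) ->
     P (nxt k ts) (nth leaf ts i) v s -> P k (Node ts) (i :: v) s) ->
  forall k t v s, (v, s) \in cuts t k -> P k t v s.
Proof.
move=> H0 H1 k t v s; elim: v k t => [|i v IH] k t.
  by rewrite cut_nilP => /andP[ch /eqP ->]; exact: H0.
case: t => ts vs.
have nc : ~~ chosen k (Node ts).
  by apply/negP => ch; move: vs; rewrite cutsE ch inE.
have bt : big (Node ts).
  by apply/negPn/negP => nb; move: vs; rewrite cuts_not_big.
move: (vs); rewrite cut_consP// => /andP[il vs']; apply: H1 => //.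
exact: IH.
Qed.

Lemma cut_size k t v s : (v, s) \in cuts t k -> (x <= tsz s <= M)%N.
Proof. by apply: (@cut_ind (fun _ _ _ s => x <= tsz s <= M)%N) => [k' t' /andP[]|]. Qed.

Lemma cut_words k t v s : (v, s) \in cuts t k -> forall w,
  (v ++ w \in ptree_words t) = (w \in ptree_words s).
Proof.
apply: (@cut_ind (fun _ t v s => forall w, (v ++ w \in ptree_words t) = (w \in ptree_words s))) => //.
by move=> k' ts i u r _ _ il _ IH w; rewrite cat_cons words_consE il IH.
Qed.

Lemma cuts_uniq t k : uniq (map fst (cuts t k)).
Proof.
elim/ptree_nested_ind: t k => ts IH k; rewrite cutsE; case: ifP => // _; case: ifP => // _.
have : forall i, i \in iota 0 (size ts) ->
    uniq [seq p.1 | p <- cuts (nth leaf ts i) (nxt k ts)].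
  by move=> i; rewrite mem_iota /= => il; apply: IH; exact: mem_nth.
elim: (iota 0 (size ts)) (iota_uniq 0 (size ts)) => //= i r IHr /andP[ir ur] H.
rewrite map_cat cat_uniq IHr//; last by move=> j jr; apply: H; rewrite inE jr orbT.
rewrite andbT -map_comp; apply/andP; split.
  rewrite (eq_map (g := fun p => i :: p.1))// (map_comp (cons i)) map_inj_uniq ?H ?mem_head//.
  by move=> ? ? [].
apply/hasPn => w /mapP[p /flatten_mapP[j jr /mapP[q _ ->]] ->] /=.
by apply/mapP => -[q' _ [ji _]]; move: ir; rewrite -ji jr.
Qed.

(** The counter falls by at most one per generation and must be 0 at a chosen vertex; a reset to [l]
    only lengthens the way. *)
Lemma cut_depth k t v s : (v, s) \in cuts t k -> (k <= l)%N -> (k <= size v)%N.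
Proof.
apply: (@cut_ind (fun k t v s => k <= l -> k <= size v)%N).
  by move=> k' t' /andP[/eqP ->].
move=> k' ts i u r nc bt il ur IH kl; rewrite /child_state in IH; move: IH.
case: ifP => _ /=; first by move=> /(_ (leqnn l)) h; rewrite (leq_trans kl)// ltnW.
by case: k' kl {nc ur} => //= k' kl /(_ (ltnW kl)).
Qed.

(* Two chosen vertices diverge at a branching vertex of the [x]-core, and a branching resets the
   counter to [l]: hence the ancestor of [v] at distance [l] lies strictly below it. *)
Lemma cut_separated k t v v' s s' : (k <= l)%N -> (v, s) \in cuts t k -> (v', s') \in cuts t k ->
  v != v' -> (l <= size v)%N /\ ~~ prefix (take (size v - l) v) v'.
Proof.
move=> + h; move: h v' s'; apply: (@cut_ind (fun k t v s => forall v' s', (k <= l)%N ->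
   (v', s') \in cuts t k -> v != v' -> (l <= size v)%N /\ ~~ prefix (take (size v - l) v) v')).
  move=> k' [ts] ch v' s' _; rewrite cutsE ch inE => /eqP[-> _].
  by rewrite eqxx.
move=> k' ts i u r nc bt il ur IH [|i' u'] s' kl; first by rewrite cut_nilP (negbTE nc).
rewrite cut_consP// => /andP[il' ur'] uu.
have nl : (nxt k' ts <= l)%N by rewrite /child_state; case: ifP => // _; exact: leq_trans (leq_pred _) kl.
case: (eqVneq i i') => [ii|ii].
  rewrite -ii eqseq_cons eqxx /= in uu; rewrite -ii in ur'.
  have [h1 h2] := IH _ _ nl ur' uu.
  by split; [exact: leqW|rewrite /= subSn//= ii eqxx].
have c2 : (1 < count big ts)%N.
  have bi : big (nth leaf ts i) by apply/negPn/negP => nb; move: ur; rewrite cuts_not_big.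
  have bi' : big (nth leaf ts i') by apply/negPn/negP => nb; move: ur'; rewrite cuts_not_big.
  rewrite -sum1_count (big_nth leaf) big_mkord big_mkcond (bigD1 (Ordinal il))//=.
  rewrite (bigD1 (Ordinal il'))/=; last by rewrite -val_eqE /= eq_sym.
  by rewrite bi bi'.
have := cut_depth ur nl; rewrite /child_state c2 => lu.
by split; [exact: leqW|rewrite /= subSn//= (negbTE ii)].
Qed.

Lemma words_prune k t u : (u \in ptree_words (prune t k)) =
  (u \in ptree_words t) && ~~ has (fun p => prefix p.1 u && (u != p.1)) (cuts t k).
Proof.
elim/ptree_nested_ind: t k u => ts IH k u.
rewrite pruneE; case: ifPn => nc.
  rewrite cutsE nc /= orbF; case: u => [|i u] //=.
  by rewrite inE andbF.
case: ifPn => bt; last by rewrite cuts_not_big// andbT.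
case: u => [|i u].
  rewrite !words_nil; symmetry; apply/hasPn => -[v s] _ /=.
  by case: v.
rewrite !words_consE size_map -andbA; case: ltnP => il //=.
rewrite (nth_map leaf)// IH ?mem_nth//; congr (_ && ~~ _).
apply/hasP/hasP => -[[v s] vs /= /andP[pv uv]].
  exists (i :: v, s); first by rewrite cut_consP// il.
  by rewrite /= eqxx pv /= eqseq_cons eqxx.
case: v vs pv uv => [|j v] vs; first by move: vs; rewrite cut_nilP (negbTE nc).
move: vs; rewrite cut_consP// => /andP[jl vs] /= /andP[/eqP ji pv].
rewrite ji eqseq_cons eqxx /= => uv; exists (v, s); last by rewrite /= pv.
by rewrite -ji.
Qed.

Lemma tsz_Node ts : tsz (Node ts) = (\sum_(t <- ts) tsz t).+1%N.
Proof. by rewrite /= sumnE big_map. Qed.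

Lemma big_flatten_cuts (R : Type) (idx : R) (op : Monoid.com_law idx) (F : ptree -> R) ts k :
  ~~ chosen k (Node ts) -> big (Node ts) ->
  \big[op/idx]_(p <- cuts (Node ts) k) F p.2 =
  \big[op/idx]_(t <- ts) \big[op/idx]_(p <- cuts t (nxt k ts)) F p.2.
Proof.
move=> nc bt; rewrite cutsE (negbTE nc) bt big_flatten big_map.
rewrite [RHS](big_nth leaf) /index_iota subn0.
by apply: eq_bigr => i _; rewrite big_map.
Qed.

Lemma tsz_prune k t :
  (tsz t + size (cuts t k) = tsz (prune t k) + \sum_(p <- cuts t k) tsz p.2)%N.
Proof.
elim/ptree_nested_ind: t k => ts IH k.
case: (boolP (chosen k (Node ts))) => [ch|nc].
  by rewrite cutsE pruneE ch big_seq1 /= addn1 add1n.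
case: (boolP (big (Node ts))) => bt; last first.
  by rewrite pruneE (negbTE nc) (negbTE bt) cuts_not_big// big_nil.
rewrite big_flatten_cuts// pruneE (negbTE nc) bt !tsz_Node big_map.
have -> : size (cuts (Node ts) k) = (\sum_(t <- ts) size (cuts t (nxt k ts)))%N.
  rewrite -sum1_size (big_flatten_cuts _ (fun=> 1%N))//; apply: eq_bigr => t _.
  by rewrite sum1_size.
rewrite !addSn -!big_split /=; congr S; rewrite big_seq [RHS]big_seq.
by apply: eq_bigr => t tts; exact: IH.
Qed.

(** Translates the Chernoff bound on [lost] into a bound on the remainder; the second summand
    accounts for the roots [v_i], kept as leaves. *)
Lemma prune_lost k t : big t -> tsz (prune t k) = (lost x M l t k + size (cuts t k))%N.
Proof.
elim/ptree_nested_ind: t k => ts IH k bt.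
rewrite pruneE lostE bt /=; case: ifPn => nc; first by rewrite cutsE nc.
have -> : size (cuts (Node ts) k) = (\sum_(t <- ts) size (cuts t (nxt k ts)))%N.
  rewrite -sum1_size (big_flatten_cuts _ (fun=> 1%N))//; apply: eq_bigr => t _.
  by rewrite sum1_size.
rewrite tsz_Node big_map sumnE big_map /smalls /=.
transitivity (\sum_(t <- ts | ~~ big t) tsz t +
    \sum_(t <- ts) (lost x M l t (nxt k ts) + size (cuts t (nxt k ts)))).+1%N.
  congr S; rewrite [LHS](bigID big) [X in _ = (_ + X)%N](bigID big) /= addnC.
  congr (_ + _)%N.
    apply: eq_bigr => -[ts'] nb; rewrite pruneE (negbTE nb) ifN//.
    by apply: contraNN nb => /chosen_big.
  rewrite [X in (_ = _ + X)%N]big1 ?addn0; last first.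
    by move=> t nb; rewrite lost_small// cuts_not_big.
  by rewrite big_seq_cond [RHS]big_seq_cond; apply: eq_bigr => t /andP[tts bt']; exact: IH.
by rewrite big_split /=; lia.
Qed.

Lemma size_cuts_le k t : (size (cuts t k) * x <= tsz t)%N.
Proof.
elim/ptree_nested_ind: t k => ts IH k.
case: (boolP (chosen k (Node ts))) => [ch|nc].
  by rewrite cutsE ch mul1n; exact: chosen_big ch.
case: (boolP (big (Node ts))) => bt; last by rewrite cuts_not_big.
have -> : size (cuts (Node ts) k) = (\sum_(t <- ts) size (cuts t (nxt k ts)))%N.
  rewrite -sum1_size (big_flatten_cuts _ (fun=> 1%N))//; apply: eq_bigr => t _.
  by rewrite sum1_size.
rewrite tsz_Node big_distrl /= leqW// big_seq [leqRHS]big_seq.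
by apply: leq_sum => t tts; exact: IH.
Qed.

(** What a skeleton reveals of a chosen subtree: its place and size, not its shape. *)
Definition tag_size (p : word * ptree) : word * nat := (p.1, tsz p.2).

Lemma tsz_tagged t t' k k' : prune t k = prune t' k' ->
  map tag_size (cuts t k) = map tag_size (cuts t' k') -> tsz t = tsz t'.
Proof.
move=> ep ec; have := tsz_prune k t; have := tsz_prune k' t'.
have sE (r : seq (word * ptree)) : (\sum_(p <- r) tsz p.2 = \sum_(q <- map tag_size r) q.2)%N.
  by rewrite big_map.
rewrite !sE -!(size_map tag_size) ep ec; lia.
Qed.

Lemma child_cuts ts k i : ~~ chosen k (Node ts) -> big (Node ts) -> (i < size ts)%N ->
  map tag_size (cuts (nth leaf ts i) (nxt k ts)) =
  [seq (behead q.1, q.2) | q <- map tag_size (cuts (Node ts) k) & ohead q.1 == Some i].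
Proof.
move=> nc bt il; rewrite cutsE (negbTE nc) bt map_flatten -map_comp.
have : i \in iota 0 (size ts) by rewrite mem_iota.
elim: (iota 0 (size ts)) (iota_uniq 0 (size ts)) => //= j r IH /andP[jr ur].
rewrite inE filter_cat map_cat => /orP[/eqP ij|ir].
  rewrite -ij in jr *.
  have -> : [seq q <- flatten [seq [seq tag_size i0 | i0 <- [seq (i0 :: p.1, p.2)
      | p <- cuts (nth leaf ts i0) (nxt k ts)]] | i0 <- r] | ohead q.1 == Some i] = [::].
    apply/eqP; rewrite -[_ == _]negbK -has_filter; apply/hasPn => q.
    case/flatten_mapP => j' j'r /mapP[_ /mapP[p _ ->] ->] /=.
    by apply: contraNneq jr => -[<-].
  rewrite cats0; pose s := [seq (i :: p.1, p.2) | p <- cuts (nth leaf ts i) (nxt k ts)].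
  have -> : [seq q <- [seq tag_size i0 | i0 <- s] | ohead q.1 == Some i] = map tag_size s.
    by apply/all_filterP/allP => _ /mapP[_ /mapP[p _ ->] ->] /=.
  by rewrite /s -!map_comp; apply: eq_map => -[].
rewrite -IH//; suff -> : [seq q <- [seq tag_size i0 | i0 <- [seq (j :: p.1, p.2)
      | p <- cuts (nth leaf ts j) (nxt k ts)]] | ohead q.1 == Some i] = [::] by [].
apply/eqP; rewrite -[_ == _]negbK -has_filter; apply/hasPn => q.
case/mapP => _ /mapP[p _ ->] -> /=.
by apply: contraNneq jr => -[->].
Qed.

Lemma eq_tsz_nxt ts ts' k : map tsz ts = map tsz ts' -> nxt k ts = nxt k ts'.
Proof.
move=> e; rewrite /child_state.
suff -> : count big ts = count big ts' by [].
have cE (r : seq ptree) : count big r = count (fun n => x <= n)%N (map tsz r) by rewrite count_map.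
by rewrite !cE e.
Qed.

(** Equal remainders and equal tagged places force equal subtree sizes at every explored vertex, and
    the exploration consults sizes only. So both trees are explored in the same way and differ only
    inside the chosen subtrees. *)
Lemma refill_uniq t t' k f : prune t k = prune t' k ->
  map tag_size (cuts t k) = map tag_size (cuts t' k) ->
  (forall v s, (v, s) \in cuts t' k -> f v = s) -> refill t k f = t'.
Proof.
elim/ptree_nested_ind: t t' k f => ts IH [ts'] k f ep ec fc.
have etsz := tsz_tagged ep ec.
have eb : big (Node ts) = big (Node ts') by rewrite /is_big etsz.
have ech : chosen k (Node ts) = chosen k (Node ts') by rewrite /is_chosen etsz.
rewrite refillE; case: ifPn => [ch|nc].
  by apply: fc; rewrite cut_nilP -ech ch eqxx.
have nc' := nc; rewrite ech in nc'.
case: ifPn => [bt|nb]; last first.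
  have nb' := nb; rewrite eb in nb'.
  by move: ep; rewrite !pruneE (negbTE nc) (negbTE nc') (negbTE nb) (negbTE nb').
have bt' := bt; rewrite eb in bt'.
move: ep; rewrite !pruneE (negbTE nc) (negbTE nc') bt bt' => -[ep].
have ss : size ts = size ts' by move: (congr1 size ep); rewrite !size_map.
have ep_i i : (i < size ts)%N ->
    prune (nth leaf ts i) (nxt k ts) = prune (nth leaf ts' i) (nxt k ts').
  by move=> il; move: (congr1 (nth leaf ^~ i) ep); rewrite !(nth_map leaf) -?ss.
have ec_i i : (i < size ts)%N -> map tag_size (cuts (nth leaf ts i) (nxt k ts)) =
     map tag_size (cuts (nth leaf ts' i) (nxt k ts')).
  by move=> il; rewrite !child_cuts ?ec// -ss.
have en : nxt k ts = nxt k ts'.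
  apply: eq_tsz_nxt; apply: (@eq_from_nth _ 0%N); rewrite !size_map// => i il.
  rewrite (nth_map leaf)// (nth_map leaf) -?ss//.
  exact: tsz_tagged (ep_i _ il) (ec_i _ il).
congr Node; apply: (@eq_from_nth _ leaf); rewrite size_map size_iota// => i il.
rewrite (nth_map 0%N) ?size_iota// nth_iota// add0n; apply: IH.
- exact: mem_nth.
- by rewrite ep_i// -en.
- by rewrite ec_i// -en.
- by move=> v s vs; apply: fc; rewrite cut_consP// -ss il -en.
Qed.

Definition size_preserving t k f := forall v s, (v, s) \in cuts t k -> tsz (f v) = tsz s.

Lemma size_preserving_child ts k f i : ~~ chosen k (Node ts) -> big (Node ts) ->
  (i < size ts)%N -> size_preserving (Node ts) k f ->
  size_preserving (nth leaf ts i) (nxt k ts) (fun v => f (i :: v)).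
Proof. by move=> nc bt il sp v s vs; apply: sp; rewrite cut_consP// il. Qed.

Lemma refill_tsz t k f : size_preserving t k f -> tsz (refill t k f) = tsz t.
Proof.
elim/ptree_nested_ind: t k f => ts IH k f sp; rewrite refillE; case: ifPn => [ch|nc].
  by apply: sp; rewrite cut_nilP ch eqxx.
case: ifPn => // bt; rewrite !tsz_Node big_map; congr S.
rewrite [RHS](big_nth leaf) /index_iota subn0 big_seq [RHS]big_seq.
apply: eq_bigr => i; rewrite mem_iota /= => il; apply: IH; first exact: mem_nth.
exact: size_preserving_child.
Qed.

(** Replacements of equal size leave the sizes of the root and its children unchanged, hence also
    the status of the root and the counter handed on. *)
Let refill_node ts k f (ts' := [seq refill (nth leaf ts i) (nxt k ts) (fun v => f (i :: v))
    | i <- iota 0 (size ts)]) :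
  ~~ chosen k (Node ts) -> big (Node ts) -> size_preserving (Node ts) k f ->
  [/\ refill (Node ts) k f = Node ts', ~~ chosen k (Node ts'), big (Node ts'),
      nxt k ts' = nxt k ts & size ts' = size ts].
Proof.
move=> nc bt sp.
have e : refill (Node ts) k f = Node ts' by rewrite refillE (negbTE nc) bt.
have et : tsz (Node ts') = tsz (Node ts) by rewrite -e refill_tsz.
have ss : size ts' = size ts by rewrite size_map size_iota.
split => //; [by rewrite /is_chosen et|by rewrite /is_big et|].
apply: eq_tsz_nxt; apply: (@eq_from_nth _ 0%N); rewrite !size_map size_iota// => i il.
rewrite (nth_map leaf) ?size_map ?size_iota// (nth_map leaf)//.
rewrite (nth_map 0%N) ?size_iota// nth_iota// add0n refill_tsz//.
exact: size_preserving_child.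
Qed.

Lemma refill_cuts t k f : size_preserving t k f ->
  cuts (refill t k f) k = [seq (p.1, f p.1) | p <- cuts t k].
Proof.
elim/ptree_nested_ind: t k f => ts IH k f sp.
case: (boolP (chosen k (Node ts))) => [ch|nc].
  have := refill_tsz sp; rewrite cutsE ch refillE ch /= => et.
  case: (f [::]) et => ts' et; rewrite cutsE.
  by rewrite {1}/is_chosen et -/(chosen k (Node ts)) ch.
case: (boolP (big (Node ts))) => bt; last first.
  by rewrite refillE (negbTE nc) (negbTE bt) cuts_not_big.
have [-> nc' bt' en ss] := refill_node nc bt sp.
rewrite !cutsE (negbTE nc) (negbTE nc') bt bt' ss en map_flatten -map_comp; congr flatten.
apply/eq_in_map => i; rewrite mem_iota /= => il.
rewrite (nth_map 0%N) ?size_iota// nth_iota// add0n IH; last 2 first.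
- exact: mem_nth.
- exact: size_preserving_child.
by rewrite -!map_comp.
Qed.

Lemma refill_prune t k f : size_preserving t k f -> prune (refill t k f) k = prune t k.
Proof.
elim/ptree_nested_ind: t k f => ts IH k f sp.
case: (boolP (chosen k (Node ts))) => [ch|nc].
  have := refill_tsz sp; rewrite pruneE ch refillE ch.
  case: (f [::]) => ts' et; rewrite pruneE.
  by rewrite {1}/is_chosen et -/(chosen k (Node ts)) ch.
case: (boolP (big (Node ts))) => bt; last first.
  by rewrite refillE (negbTE nc) (negbTE bt).
have [-> nc' bt' en ss] := refill_node nc bt sp.
rewrite !pruneE (negbTE nc) (negbTE nc') bt bt' en; congr Node.
rewrite -map_comp; apply: (@eq_from_nth _ leaf); rewrite !size_map size_iota// => i il.
rewrite (nth_map 0%N) ?size_iota//= nth_iota// add0n (nth_map leaf)// IH//; first exact: mem_nth.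
exact: size_preserving_child.
Qed.

Section Weight.
Context {R : realType}.
Variable m : nat -> R.

(** A chosen vertex contributes 1: its offspring number is counted in the weight of the tree plugged
    in there. *)
Fixpoint context_weight t k : R :=
  match t with Node ts =>
    if chosen k (Node ts) then 1 else
    if big (Node ts) then m (size ts) * \prod_(w <- [seq context_weight t (nxt k ts) | t <- ts]) w
    else weight m (Node ts)
  end.

Lemma refill_weight t k f :
  weight m (refill t k f) = context_weight t k * \prod_(p <- cuts t k) weight m (f p.1).
Proof.
elim/ptree_nested_ind: t k f => ts IH k f; rewrite refillE [context_weight _ _]/=.
case: ifPn => [ch|nc]; first by rewrite cutsE ch big_seq1 mul1r.
case: ifPn => bt; last by rewrite cuts_not_big// big_nil mulr1.
rewrite weightE size_map size_iota -mulrA; congr (_ * _).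
rewrite big_map [X in X * _]big_map cutsE (negbTE nc) bt big_flatten big_map.
rewrite [X in X * _](big_nth leaf) /index_iota subn0 -big_split.
rewrite big_seq [RHS]big_seq; apply: eq_bigr => i; rewrite mem_iota /= => il.
by rewrite IH ?mem_nth// big_map.
Qed.
End Weight.

End Decomposition.

(** * The decomposition as a system of subgraphs *)

Arguments ptree_words : simpl never.
Arguments cuts : simpl never.
Arguments prune : simpl never.
Arguments refill : simpl never.

Section WordTrees.
Implicit Types (t : ptree) (u v w x y c : word) (e : rel word) (S : {fset word}).

Lemma words_cat t u w : u ++ w \in ptree_words t -> u \in ptree_words t.
Proof.
elim: u t => [|i u IH] [ts]; first by rewrite words_nil.
by rewrite cat_cons !words_consE => /andP[-> /IH].
Qed.

Lemma words_elder t u k j : u \in ptree_words t -> (k < size u)%N -> (j <= nth 0%N u k)%N ->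
  rcons (take k u) j \in ptree_words t.
Proof.
elim: u t k => [//|i u IH] [ts] [|k]; rewrite !words_consE => /andP[il uw] /=.
  by move=> _ ji; rewrite words_nil andbT (leq_ltn_trans ji).
by rewrite ltnS => ku ji; rewrite il; exact: IH.
Qed.

Definition parent u : word := take (size u).-1 u.

Lemma parent_rcons u i : parent (rcons u i) = u.
Proof. by rewrite /parent size_rcons /= -cats1 take_size_cat. Qed.

Lemma parent_ofP x y : reflect (exists i, y = rcons x i) (parent_of x y).
Proof.
apply: (iffP andP) => [[y0 /eqP xy]|[i ->]].
  case/lastP: y y0 xy => [//|y i] _; rewrite -/(parent _) parent_rcons => ->.
  by exists i.
by rewrite -/(parent _) parent_rcons eqxx; split => //; case: (x).
Qed.

Lemma size_parent u : u != [::] -> (size (parent u) < size u)%N.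
Proof. by case/lastP: u => [//|u i] _; rewrite parent_rcons size_rcons. Qed.

Lemma prefix_rconsE c y i : prefix c (rcons y i) = (c == rcons y i) || prefix c y.
Proof.
elim: c y => [|a c IH] [|b y] //=.
- by rewrite eqseq_cons orbF; case: c {IH}.
- by rewrite IH eqseq_cons andb_orr.
Qed.

Lemma joined_refl e x : joined e x x. Proof. by exists [::]. Qed.

Lemma joined_trans e x y z : joined e x y -> joined e y z -> joined e x z.
Proof.
move=> [p [ep lp]] [q [eq lq]]; exists (p ++ q).
by rewrite cat_path ep lp eq last_cat lp.
Qed.

Lemma joined_sym e x y : symmetric e -> joined e x y -> joined e y x.
Proof.
move=> se [p [ep lp]]; exists (rev (belast x p)); split.
  by rewrite -lp (eq_path (e' := fun a b => e b a)) ?rev_path.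
by case: p lp {ep} => [//|a p] /= _; rewrite rev_cons last_rcons.
Qed.

Lemma joined_root (P : pred word) e r :
  (forall u, P u -> u != r -> [/\ u != [::], P (parent u) & e u (parent u)]) ->
  forall u, P u -> joined e u r.
Proof.
move=> H u; have [n] := ubnP (size u); elim: n u => // n IH u un Pu.
case: (eqVneq u r) => [->|ur]; first exact: joined_refl.
have [u0 Ppu epu] := H _ Pu ur.
apply: (@joined_trans _ _ (parent u)); first by exists [:: parent u]; rewrite /= epu.
by apply: IH => //; rewrite -ltnS (leq_trans _ un)// ltnS size_parent.
Qed.

Section UniquePath.
Variable e : rel word.
Hypothesis e_adj : forall a b, e a b -> parent_of a b || parent_of b a.

Lemma edge_inside x i a b : e a b -> a != x -> b != x ->
  prefix (rcons x i) a = prefix (rcons x i) b.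
Proof.
move=> /e_adj /orP[] /parent_ofP[j ->].
  move=> ax _; rewrite prefix_rconsE; case: eqP => //= /rcons_inj[xa _].
  by rewrite xa eqxx in ax.
move=> _ bx; rewrite prefix_rconsE; case: eqP => //= /rcons_inj[xa _].
by rewrite xa eqxx in bx.
Qed.

Lemma path_inside x i a p : path e a p -> x \notin a :: p ->
  prefix (rcons x i) a = prefix (rcons x i) (last a p).
Proof.
elim: p a => //= b p IH a /andP[ab bp]; rewrite !inE !negb_or => /and3P[xa xb xp].
rewrite (edge_inside _ ab) 1?eq_sym//; apply: IH => //.
by rewrite inE negb_or xb.
Qed.

(** After its start a simple path avoids [x], so it cannot leave the branch below [rcons x i]; the
    common endpoint shows that the other path enters the same branch. *)
Lemma first_step x i p b q : path e x (rcons x i :: p) -> path e x (b :: q) ->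
  uniq (x :: rcons x i :: p) -> uniq (x :: b :: q) ->
  last (rcons x i) p = last b q -> b = rcons x i.
Proof.
move=> /= /andP[_ pp] /andP[eb pq] /andP[xp _] /andP[xq _] lpq.
have := path_inside i pp xp; rewrite prefix_refl lpq => /esym.
rewrite -(path_inside i pq xq) => pb.
have /orP[/parent_ofP[j bj]|/parent_ofP[j xj]] := e_adj eb.
  move: pb; rewrite bj prefix_rconsE => /orP[/eqP -> //|/size_prefix].
  by rewrite size_rcons ltnn.
by move: pb => /size_prefix; rewrite size_rcons xj size_rcons ltnNge leqnSn.
Qed.

(** If either path starts towards a child, [first_step] applies; otherwise both start towards the
    parent, which is unique. *)
Lemma unique_path x p q : path e x p -> path e x q -> uniq (x :: p) -> uniq (x :: q) ->
  last x p = last x q -> p = q.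
Proof.
elim: p x q => [|a p IH] x [|b q] //.
- by move=> _ _ _ /= /andP[xq _] lx; rewrite lx mem_last in xq.
- by move=> _ _ /= /andP[xq _] _ lx; rewrite -lx mem_last in xq.
move=> pa pb ua ub lab.
suff ab : a = b.
  rewrite -ab in pb ub lab *; congr cons; apply: (IH a) => //.
  - by case/andP: pa.
  - by case/andP: pb.
  - by case/andP: ua.
  - by case/andP: ub.
have ea : e x a by case/andP: pa.
have eb : e x b by case/andP: pb.
have /orP[/parent_ofP[i ai]|/parent_ofP[i xi]] := e_adj ea.
  by rewrite ai in pa ua lab *; rewrite (first_step pa pb ua ub lab).
have /orP[/parent_ofP[j bj]|/parent_ofP[j xj]] := e_adj eb.
  by rewrite bj in pb ub lab *; rewrite (first_step pb pa ub ua (esym lab)).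
by move: xi; rewrite xj => /rcons_inj[].
Qed.
End UniquePath.

(** Covers all subtrees that occur: the whole tree and the remainder with [r] the empty word, and
    the chosen subtrees with [r] their own root. *)
Definition prefix_closed r S := [/\ r \in S, forall u, u \in S -> prefix r u &
  forall u, u \in S -> u != r -> parent u \in S].

Lemma parent_of_parent u : u != [::] -> parent_of (parent u) u.
Proof. by move=> u0; rewrite /parent_of u0 /parent eqxx. Qed.

Lemma prefix_closed_is_tree r S e : prefix_closed r S ->
  (forall x y, e x y = [&& x \in S, y \in S & parent_of x y || parent_of y x]) ->
  is_tree S e.
Proof.
move=> [rS rp pS] eE.
have se : symmetric e by move=> a b; rewrite !eE orbC andbCA.
have J u : u \in S -> joined e u r.
  move=> uS0; apply: (@joined_root (fun u => u \in S) e r _ u uS0) => {uS0}u uS ur.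
  have uS' := pS _ uS ur.
  have u0 : u != [::].
    by apply: contraNneq ur => u0; move: (rp _ uS); rewrite u0 prefixs0 eq_sym.
  by split => //; rewrite eE uS uS' parent_of_parent ?orbT.
split; first by exists r.
move=> x y xS yS.
have [p [ep lp]] := joined_trans (J _ xS) (joined_sym se (J _ yS)).
case/shortenP: ep lp => p' ep' up' _ lp'.
exists p'; split => // q [eq uq lq].
apply: (@unique_path e) up' uq _ => //; last by rewrite lp' lq.
by move=> a b; rewrite eE => /and3P[].
Qed.

Lemma prefix_closed_verts t : prefix_closed [::] (verts t).
Proof.
split; first by rewrite mem_verts words_nil.
  by move=> u _; exact: prefix0s.
move=> u; rewrite !mem_verts; case/lastP: u => [//|u i] ut _.
by rewrite parent_rcons; move: ut; rewrite -cats1 => /words_cat.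
Qed.

Definition grafted v t : {fset word} := [fset v ++ w | w in verts t]%fset.

Lemma in_grafted v t u : (u \in grafted v t) = prefix v u && (drop (size v) u \in ptree_words t).
Proof.
apply/imfsetP/andP => [[w /= + ->]|[/prefixP[w ->]]].
  by rewrite mem_verts prefix_prefix drop_size_cat.
by rewrite drop_size_cat// => wt; exists w; rewrite //= mem_verts.
Qed.

Lemma in_grafted_cat v t w : (v ++ w \in grafted v t) = (w \in ptree_words t).
Proof. by rewrite in_grafted prefix_prefix drop_size_cat. Qed.

Lemma card_grafted v t : #|` grafted v t| = tsz t.
Proof.
rewrite card_imfset /= ?card_verts// => u w /eqP.
by rewrite eqseq_cat// eqxx => /eqP.
Qed.

Lemma prefix_closed_grafted v t : prefix_closed v (grafted v t).
Proof.
split; first by rewrite -[v in v \in _]cats0 in_grafted_cat words_nil.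
  by move=> u; rewrite in_grafted => /andP[].
move=> u; rewrite in_grafted => /andP[/prefixP[w ->]].
rewrite drop_size_cat//; case/lastP: w => [|w i]; first by rewrite cats0 eqxx.
rewrite -rcons_cat parent_rcons in_grafted_cat => + _.
by rewrite -cats1 => /words_cat.
Qed.

(** If every elder sibling along the way from [v] to [u] is present, counting elder siblings gives
    back the letter. *)
Lemma relabel_id S v u : (forall k j, (size v <= k < size u)%N -> (j < nth 0%N u k)%N ->
   rcons (take k u) j \in S) -> relabel S v u = drop (size v) u.
Proof.
move=> H; apply: (@eq_from_nth _ 0%N); rewrite /relabel size_map size_iota ?size_drop// => i il.
rewrite (nth_map 0%N) ?size_iota// nth_iota// nth_drop.
rewrite (eq_in_count (a2 := predT)) ?count_predT ?size_iota// => j.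
rewrite mem_iota /= add0n => jl; apply: H => //.
by rewrite leq_addr /=; rewrite ltn_subRL in il.
Qed.

Lemma relabel_verts t u : u \in verts t -> relabel (verts t) [::] u = u.
Proof.
rewrite mem_verts => ut; rewrite relabel_id ?drop0// => k j /andP[_ ku] ju.
by rewrite mem_verts words_elder// ltnW.
Qed.

Lemma shape_verts t : Defs.shape (verts t) [::] = verts t.
Proof.
apply/fsetP => u; apply/imfsetP/idP => [[w /= wt ->]|ut]; first by rewrite relabel_verts.
by exists u; rewrite //= relabel_verts.
Qed.

Lemma relabel_grafted v t w : w \in ptree_words t -> relabel (grafted v t) v (v ++ w) = w.
Proof.
move=> wt; rewrite relabel_id ?drop_size_cat// => k j /andP[vk ku] jw.
rewrite take_cat ltnNge vk /= rcons_cat in_grafted_cat words_elder//.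
  by rewrite ltn_subLR// -size_cat.
by rewrite ltnW//; move: jw; rewrite nth_cat [(k < _)%N]ltnNge vk.
Qed.

Lemma shape_grafted v t : Defs.shape (grafted v t) v = verts t.
Proof.
apply/fsetP => u; apply/imfsetP/idP => [[w' /=]|ut].
  rewrite in_grafted => /andP[/prefixP[w ->]]; rewrite drop_size_cat// => wt ->.
  by rewrite relabel_grafted// mem_verts.
by rewrite mem_verts in ut; exists (v ++ u); rewrite ?in_grafted_cat ?relabel_grafted.
Qed.
End WordTrees.

Section CutSets.
Variables (x M l : nat).
Implicit Types (t : ptree).

Definition cut_sets t : subtree_seq := [seq (p.1, grafted p.1 p.2) | p <- cuts x M l t 0].

Lemma sroot_cut_sets t i : (i < size (cuts x M l t 0))%N ->
  sroot (cut_sets t) i = (nth ([::], leaf) (cuts x M l t 0) i).1.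
Proof. by move=> il; rewrite /sroot (nth_map ([::], leaf)). Qed.

Lemma sverts_cut_sets t i : (i < size (cuts x M l t 0))%N ->
  sverts (cut_sets t) i = grafted (nth ([::], leaf) (cuts x M l t 0) i).1
    (nth ([::], leaf) (cuts x M l t 0) i).2.
Proof. by move=> il; rewrite /sverts (nth_map ([::], leaf)). Qed.

Lemma grafted_sub t v s : (v, s) \in cuts x M l t 0 -> (grafted v s `<=` verts t)%fset.
Proof.
move=> vs; apply/fsubsetP => u; rewrite in_grafted => /andP[/prefixP[w ->]].
by rewrite drop_size_cat// mem_verts (cut_words vs).
Qed.

Lemma cut_is_rooted_subtree t v s : (v, s) \in cuts x M l t 0 ->
  is_rooted_subtree t v (grafted v s).
Proof.
move=> vs; have sub := grafted_sub vs; split => //.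
- apply: (prefix_closed_is_tree (prefix_closed_grafted v s)) => a b.
  rewrite /tree_edge; case: (boolP (a \in _)) => //= aS; case: (boolP (b \in _)) => //= bS.
  by rewrite !(fsubsetP sub).
- by case: (prefix_closed_grafted v s).
move=> u; rewrite in_grafted => /andP[/prefixP[w ->] _] uv.
rewrite size_cat -[X in (X < _)%N]addn0 ltn_add2l; case: w uv => //.
by rewrite cats0 eqxx.
Qed.

Section Hat.
Variable t : ptree.
Hypothesis tM : (M < tsz t)%N.
Hypothesis t1 : (1 < tsz t)%N.
Notation P := (prune x M l t 0).
Notation s := (cut_sets t).

(** An edge lies in a chosen subtree exactly when its lower endpoint is strictly below the chosen
    root, that is, has been pruned. *)
Lemma hat_edgeE a b :
  hat_edge t s a b = [&& a \in verts P, b \in verts P & parent_of a b || parent_of b a].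
Proof.
have child a' b' v w : parent_of a' b' -> (v, w) \in cuts x M l t 0 -> b' \in verts P ->
    a' \in grafted v w -> b' \in grafted v w -> False.
  move=> /parent_ofP[i ->] vw; rewrite mem_verts words_prune => /andP[_ /hasPn H].
  rewrite !in_grafted => /andP[va _] _; have := H _ vw; rewrite /= prefix_rconsE va orbT /=.
  by move=> /negPn /eqP va'; move: va => /size_prefix; rewrite -va' size_rcons ltnn.
rewrite /hat_edge /cut_sets all_map; apply/idP/idP.
  move=> /andP[/and3P[at' bt ab] /allP al]; rewrite ab andbT.
  have cutP (a' b' : word) : a' \in verts t -> b' \in verts t ->
      parent_of a' b' || parent_of b' a' ->
      (forall v w, (v, w) \in cuts x M l t 0 -> ~~ ((a' \in grafted v w) && (b' \in grafted v w))) ->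
      a' \in verts P.
    rewrite !mem_verts words_prune => at1 bt1 ab' H; rewrite at1 /=; apply/hasPn => -[v w] vw /=.
    apply/negP => /andP[va av].
    have inS c : c \in ptree_words t -> prefix v c -> c \in grafted v w.
      move=> ct /prefixP[r cr]; move: ct; rewrite cr (cut_words vw) => rw.
      by rewrite in_grafted_cat.
    have := H _ _ vw; rewrite !inS//; case/orP: ab' => /parent_ofP[i E].
      by rewrite E prefix_rconsE va orbT.
    by move: va; rewrite E prefix_rconsE -E eq_sym (negbTE av).
  have alC v w : (v, w) \in cuts x M l t 0 -> ~~ ((a \in grafted v w) && (b \in grafted v w)).
    by move=> vw; exact: (al _ vw).
  rewrite (cutP a b)//= (cutP b a)// 1?orbC// => v w /alC; by rewrite andbC.
move=> /and3P[aP bP ab]; apply/andP; split.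
  rewrite /tree_edge ab andbT.
  by move: aP bP; rewrite !mem_verts !words_prune => /andP[-> _] /andP[-> _].
apply/allP => -[v w] vw /=; apply/negP => /andP[aS bS].
by case/orP: ab => [ab|ba]; [exact: (child a b v w)|exact: (child b a v w)].
Qed.

(** [hat_verts] contains only vertices with an incident edge, so the root needs a child in the
    remainder: [t1] provides one, and [tM] prevents the root from being chosen. *)
Lemma hat_vertsE : hat_verts t s = verts P.
Proof.
apply/fsetP => u; rewrite inE /= inE /= mem_verts.
apply/andP/idP => [[_ /hasP[b _]]|uP]; first by rewrite hat_edgeE => /and3P[].
split; first by move: uP; rewrite mem_verts words_prune => /andP[].
have [b bP ub] : exists2 b, b \in verts P & parent_of u b || parent_of b u.
  case: (eqVneq u [::]) => [->|u0]; last first.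
    exists (parent u); last by rewrite parent_of_parent ?orbT.
    by case: (prefix_closed_verts P) => _ _; apply.
  exists [:: 0%N] => //; move: tM t1; case: (t) => ts tM' t1'; rewrite mem_verts pruneE.
  have ts0 : (0 < size ts)%N by case: (ts) t1'.
  rewrite ifN; last by rewrite /is_chosen [(_ <= M)%N]leqNgt tM' !andbF.
  by case: ifP => _; rewrite words_consE words_nil ?size_map ts0.
apply/hasP; exists b; last by rewrite hat_edgeE uP bP ub.
by move: bP; rewrite mem_verts words_prune => /andP[].
Qed.

Lemma hat_is_tree : is_tree (hat_verts t s) (hat_edge t s).
Proof.
rewrite hat_vertsE; apply: prefix_closed_is_tree (prefix_closed_verts P) _ => a b.
exact: hat_edgeE.
Qed.

(** The remainder is again a plane tree without gaps, so relabelling is the identity on it; it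
    contains the chosen roots since by [cut_separated] none lies below another. *)
Lemma skeleton_cut_sets : skeleton t s =
  (verts P, [seq tsz p.2 | p <- cuts x M l t 0], [seq p.1 | p <- cuts x M l t 0]).
Proof.
rewrite /skeleton hat_vertsE shape_verts -!map_comp; congr (_, _, _).
  by apply: eq_map => -[v w] /=; rewrite card_grafted.
apply/eq_in_map => -[v w] vw /=; apply: relabel_verts.
rewrite mem_verts words_prune -[v in v \in _]cats0 (cut_words vw) words_nil /=.
apply/hasPn => -[v' w'] vw' /=; apply/negP => /andP[pv vv].
have vv' : v' != v by rewrite eq_sym.
have [h1] := cut_separated (leq0n l) vw' vw vv'.
by rewrite (prefix_trans _ pv)// prefix_take.
Qed.
End Hat.

Lemma ancestral_inside (v u : word) : (l <= size v)%N -> ancestral_path v l u ->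
  prefix (take (size v - l) v) u.
Proof.
move=> lv /andP[/prefixP[w ->]] h.
by rewrite takel_cat ?prefix_take// leq_subLR addnC.
Qed.

(** The removed path lies below its top vertex, and the vertices not below that one are joined to
    the root by their ancestral lines. *)
Lemma outside_component t (v : word) x' y' : (l <= size v)%N ->
  x' \in verts t -> y' \in verts t ->
  ~~ prefix (take (size v - l) v) x' -> ~~ prefix (take (size v - l) v) y' ->
  same_component t (ancestral_path v l) x' y'.
Proof.
move=> lv xt yt xw yw.
have out u : ~~ prefix (take (size v - l) v) u -> ~~ ancestral_path v l u.
  by apply: contra; exact: ancestral_inside.
split; rewrite ?out//.
set e := fun a b => _.
have se : symmetric e.
  by move=> a b; rewrite /e /tree_edge orbC andbCA; congr (_ && (_ && _)); rewrite andbCA.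
have J u : u \in verts t -> ~~ prefix (take (size v - l) v) u -> joined e u [::].
  move=> ut uw; apply: (@joined_root (fun u => (u \in verts t) && ~~ prefix (take (size v - l) v) u));
    last by rewrite ut.
  move=> {ut uw}u /andP[ut uw] u0.
  have pt : parent u \in verts t by case: (prefix_closed_verts t) => _ _; apply.
  have pw : ~~ prefix (take (size v - l) v) (parent u).
    move: uw; case/lastP: u u0 {ut pt} => // u i _; rewrite parent_rcons prefix_rconsE.
    by rewrite negb_or => /andP[].
  by split; rewrite ?pt// /e !out//= /tree_edge ut pt parent_of_parent ?orbT.
exact: joined_trans (J _ xt xw) (joined_sym se (J _ yt yw)).
Qed.

Lemma cut_component t v v' v'' s s' s'' (a b : word) :
  (v, s) \in cuts x M l t 0 -> (v', s') \in cuts x M l t 0 -> (v'', s'') \in cuts x M l t 0 ->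
  v' != v -> v'' != v -> a \in grafted v' s' -> b \in grafted v'' s'' ->
  same_component t (ancestral_path v l) a b.
Proof.
(* If the top [c] of the path of [v] were above a vertex of the subtree at [w], it would be a prefix
   of [w], which separation at [v] excludes, or would have [w] as a prefix, which separation at [w]
   excludes. *)
have out w r u : (v, s) \in cuts x M l t 0 -> (w, r) \in cuts x M l t 0 -> w != v ->
    u \in grafted w r -> ~~ prefix (take (size v - l) v) u.
  move=> vs wr wv; rewrite in_grafted => /andP[wu _]; rewrite eq_sym in wv.
  have [lv sep] := cut_separated (leq0n l) vs wr wv.
  have [_ sep'] := cut_separated (leq0n l) wr vs ltac:(by rewrite eq_sym).
  apply/negP => pu; case/prefixP: wu pu => z ->.
  set c := take _ v in sep *; case: (leqP (size c) (size w)) => cw.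
    by rewrite prefixE takel_cat// -prefixE (negbTE sep).
  move=> pu; have wc : prefix w c.
    move: pu; rewrite prefixE => /eqP <-.
    by rewrite take_cat ltnNge ltnW//= prefix_prefix.
  by move: sep'; rewrite (prefix_trans (prefix_take _ _))// (prefix_trans wc)// prefix_take.
move=> vs vs' vs'' v'v v''v av bv.
have [lv _] := cut_separated (leq0n l) vs vs' ltac:(by rewrite eq_sym).
apply: outside_component => //.
- exact: (fsubsetP (grafted_sub vs')).
- exact: (fsubsetP (grafted_sub vs'')).
- exact: (out v' s').
- exact: (out v'' s'').
Qed.
End CutSets.

(** * The offspring law *)

Section Offspring.
Context {R : realType}.
Variable mu : probability nat R.
Hypothesis mu_mean : ('E_mu[fun i : nat => i%:R] = 1)%E.
Hypothesis mu_var : (0 < variance mu (fun i : nat => i%:R : R))%E.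
Variable c : R.
Hypothesis c_gt1 : 1 < c.
Hypothesis mu_exp : (\int[mu]_i (c ^+ i)%:E < +oo)%E.

Definition offspring (d : nat) : R := fine (mu [set d]).
Notation m := offspring.

Lemma offspring_ge0 d : 0 <= m d. Proof. exact: fine_ge0. Qed.
Hint Resolve offspring_ge0 : core.

Lemma offspringE d : mu [set d] = (m d)%:E.
Proof. by rewrite fineK// fin_num_measure. Qed.

Lemma integral_offspring (f : nat -> R) : (forall i, 0 <= f i) ->
  (\int[mu]_i (f i)%:E = \sum_(i <oo) (f i * m i)%:E)%E.
Proof.
move=> f0; have TE : [set: nat] = \bigcup_i [set i].
  by apply/seteqP; split => // i _; exists i.
rewrite TE ge0_integral_bigcup//.
- apply: eq_eseriesr => i _.
  rewrite (@eq_integral _ _ _ mu _ (cst (f i)%:E)); last by move=> j; rewrite inE /= => ->.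
  by rewrite integral_cst// [X in (_ * X)%E = _]offspringE -EFinM.
- by move=> i _; rewrite lee_fin.
- by apply/trivIsetP => i j _ _ ij; apply/seteqP; split => // k [/= -> /eqP]; rewrite (negbTE ij).
Qed.

Lemma partial_sum_le (f : nat -> R) (a : R) L : (forall i, 0 <= f i) ->
  (\sum_(i <oo) (f i * m i)%:E <= a%:E)%E -> \sum_(d < L) m d * f d <= a.
Proof.
move=> f0 fa; rewrite -lee_fin; apply: le_trans fa.
rewrite -sumEFin -(big_mkord xpredT (fun d => (m d * f d)%:E)).
under eq_bigr do rewrite mulrC.
by apply: nneseries_lim_ge => i _ _; rewrite lee_fin mulr_ge0.
Qed.

Lemma partial_sum_ge (f : nat -> R) (a eps : R) : (forall i, 0 <= f i) -> 0 < eps ->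
  (\sum_(i <oo) (f i * m i)%:E = a%:E)%E ->
  exists L0, forall L, (L0 <= L)%N -> a - eps <= \sum_(d < L) m d * f d.
Proof.
move=> f0 e0 fa; apply: contrapT => H.
have {}H L : \sum_(d < L) m d * f d <= a - eps.
  rewrite leNgt; apply/negP => h; apply: H; exists L => L' LL'.
  apply: (le_trans (ltW h)); rewrite -!(big_mkord xpredT (fun d => m d * f d)).
  rewrite [leRHS](@big_cat_nat _ _ _ L)//= lerDl.
  by apply: sumr_ge0 => i _; rewrite mulr_ge0.
suff : (\sum_(i <oo) (f i * m i)%:E <= (a - eps)%:E)%E.
  by rewrite fa lee_fin; lra.
apply: lime_le.
  by apply: is_cvg_nneseries => i _ _; rewrite lee_fin mulr_ge0.
apply: nearW => n; rewrite big_mkord sumEFin lee_fin.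
by under eq_bigr do rewrite mulrC.
Qed.

Lemma offspring_series0 : (\sum_(i <oo) (1 * m i)%:E = 1%:E)%E.
Proof.
rewrite -(integral_offspring (f := fun=> 1))// integral_cst// mul1e.
exact: probability_setT.
Qed.

Lemma offspring_series1 : (\sum_(i <oo) (i%:R * m i)%:E = 1%:E)%E.
Proof. by rewrite -(integral_offspring (f := fun i => i%:R))// -mu_mean unlock. Qed.

Lemma offspring_sum0 L : \sum_(d < L) m d <= 1.
Proof.
have := @partial_sum_le (fun=> 1) 1 L; rewrite offspring_series0.
under eq_bigr do rewrite mulr1.
by apply.
Qed.

Lemma offspring_sum1 L : \sum_(d < L) m d * d%:R <= 1.
Proof. by apply: (@partial_sum_le (fun i => i%:R)); rewrite ?offspring_series1. Qed.

Lemma offspring_crit (eps : R) L0 : 0 < eps -> exists L, [/\ (L0 <= L)%N,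
  1 - eps <= \sum_(d < L.+1) m d & 1 - eps <= \sum_(d < L.+1) m d * d%:R].
Proof.
move=> e0.
have [L1 H1] := @partial_sum_ge (fun=> 1) 1 eps (fun=> ler01) e0 offspring_series0.
have [L2 H2] := @partial_sum_ge (fun i => i%:R) 1 eps (fun=> ler0n _ _) e0 offspring_series1.
exists (maxn L0 (maxn L1 L2)); rewrite leq_maxl; split => //.
  have := H1 (maxn L0 (maxn L1 L2)).+1 ltac:(by rewrite leqW// !leq_max leqnn orbT).
  by under eq_bigr do rewrite mulr1.
by apply: H2; rewrite leqW// !leq_max leqnn !orbT.
Qed.

Lemma sum_gt_term L j : (j < L)%N -> forall f : nat -> R, (forall i, 0 <= f i) ->
  f j <= \sum_(d < L) f d.
Proof. by move=> jL f f0; exact: (le_sum_term (i := Ordinal jL)). Qed.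

(** Without offspring numbers above 1, mean one forces exactly one child almost surely, and the
    variance vanishes. *)
Lemma offspring_branching : exists j, 0 < m j.+2.
Proof.
apply: contrapT => H.
have m2 d : m d.+2 = 0.
  apply/eqP; rewrite eq_le offspring_ge0 andbT leNgt; apply/negP => h; apply: H; by exists d.
have m1 : m 1%N = 1.
  have : (\sum_(i <oo) (i%:R * m i)%:E = (m 1%N)%:E)%E.
    rewrite (@nneseries_split _ _ 0 2)/=; last by move=> i _; rewrite lee_fin mulr_ge0.
    rewrite eseries0 ?adde0; last by case=> [|[|i]]//= _ _; rewrite m2 mulr0.
    by rewrite !big_nat_recl// big_geq//= mul0r mul1r add0e adde0.
  by rewrite offspring_series1 => -[].
have m0 : m 0%N = 0.
  have := offspring_sum0 2; rewrite !big_ord_recl big_ord0 /= m1.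
  by have := offspring_ge0 0; lra.
move: mu_var; rewrite /variance unlock mu_mean /= unlock.
suff -> : (\int[mu]_w ((([eta Algebra.natmul 1] \- cst 1) *
    ([eta Algebra.natmul 1] \- cst 1)) w)%:E = 0)%E by rewrite ltxx.
rewrite (eq_integral (fun i : nat => ((i%:R - 1) ^+ 2)%:E)); last by move=> i _; rewrite expr2.
rewrite integral_offspring => [|i]; last exact: sqr_ge0.
apply: eseries0 => -[|[|i]] _ _; rewrite ?m0 ?m2 ?mulr0//.
by rewrite subrr expr0n mul0r.
Qed.

(** If [m 0 = 0], every term of the sum of m d (d - 1) is nonnegative and one is positive, against
    mean one. *)
Lemma offspring0_gt0 : 0 < m 0%N.
Proof.
rewrite lt_neqAle eq_sym offspring_ge0 andbT; apply/eqP => m0.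
have [j mj] := offspring_branching.
have e0 : 0 < m j.+2 / 2 by rewrite divr_gt0.
have [L [jL s0 _]] := offspring_crit j.+2 e0.
have := offspring_sum1 L.+1.
have : m j.+2 <= \sum_(d < L.+1) (m d * d%:R - m d).
  apply: (@le_trans _ _ (m j.+2 * j.+2%:R - m j.+2)).
    by rewrite -natr1 -natr1 mulrDr mulrDr !mulr1; have := ler0n R j; have := mj; nra.
  apply: (@sum_gt_term _ _ _ (fun d => m d * d%:R - m d)) => [|[|i]]; first by rewrite ltnS.
    by rewrite m0 mul0r subrr.
  by rewrite -natr1 mulrDr mulr1 addrK mulr_ge0.
rewrite sumrB; lra.
Qed.

Let c_ge0 : 0 <= c. Proof. exact: ltW (lt_trans ltr01 c_gt1). Qed.

Definition exp_moment : R := fine (\int[mu]_i (c ^+ i)%:E).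

Lemma offspring_exp L : \sum_(d < L) m d * c ^+ d <= exp_moment.
Proof.
have c0 i : 0 <= c ^+ i by rewrite exprn_ge0.
apply: (@partial_sum_le (fun i => c ^+ i)) => //.
rewrite -integral_offspring// /exp_moment fineK//.
by rewrite ge0_fin_numE//; apply: integral_ge0 => i _; rewrite lee_fin.
Qed.

Lemma exp_moment_ge0 : 0 <= exp_moment.
Proof. by have := offspring_exp 0; rewrite big_ord0. Qed.

Lemma offspring_tail L n : \sum_(d < n | (L < d)%N) m d <= exp_moment / c ^+ L.
Proof.
have cL : 0 < c ^+ L by rewrite exprn_gt0// (lt_trans ltr01 c_gt1).
rewrite ler_pdivlMr//; apply: le_trans (offspring_exp n).
rewrite big_distrl /= big_mkcond; apply: ler_sum => d _; case: ifPn => Ld.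
  by rewrite ler_wpM2l//; apply: ler_weXn2l; [exact: ltW|exact: ltnW].
by rewrite mulr_ge0 ?exprn_ge0.
Qed.

Lemma cube_le_exp : exists2 K : R, 0 < K & forall d, d%:R ^+ 3 <= K * c ^+ d.
Proof.
(* For h at most 1, (1 + h)^3 <= 1 + 7 h, so (1 + h)^3 <= c; then Bernoulli's d h <= (1 + h)^d is
   cubed. *)
pose h := Num.min (c - 1) 1 / 7.
have h0 : 0 < h by rewrite divr_gt0// lt_min ltr01 subr_gt0 c_gt1.
have h1 : h <= 1 / 7 by rewrite ler_pM2r// ge_min lexx orbT.
have h2 : 7 * h <= c - 1 by rewrite /h mulrC divfK ?pnatr_eq0// ge_min lexx.
have hc : (1 + h) ^+ 3 <= c by rewrite !exprS expr0; nra.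
exists (h ^+ 3)^-1; first by rewrite invr_gt0 exprn_gt0.
move=> d; rewrite ler_pdivlMl ?exprn_gt0//.
apply: (@le_trans _ _ (((1 + h) ^+ 3) ^+ d)); last first.
  by apply: lerXn2r; rewrite ?nnegrE ?exprn_ge0//; lra.
rewrite -exprM mulnC exprM -exprMn mulrC.
have := bernoulli_ge d (ltW h0); have := mulr_ge0 (ler0n R d) (ltW h0) => H1 H2.
by apply: lerXn2r; rewrite ?nnegrE ?exprn_ge0//; lra.
Qed.

Lemma offspring_sum3 : exists2 C : R, 0 < C & forall L, \sum_(d < L) m d * d%:R ^+ 3 <= C.
Proof.
have [K K0 HK] := cube_le_exp; have E0 := exp_moment_ge0.
exists (K * (exp_moment + 1)) => [|L]; first by rewrite mulr_gt0//; lra.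
apply: (@le_trans _ _ (K * exp_moment)); last by rewrite ler_pM2l//; lra.
apply: le_trans (ler_wpM2l (ltW K0) (offspring_exp L)).
rewrite big_distrr /=; apply: ler_sum => d _.
by rewrite [leRHS]mulrCA ler_wpM2l.
Qed.

Lemma offspring_sum2 : exists2 C : R, 0 < C & forall L, \sum_(d < L) m d * d%:R ^+ 2 <= C.
Proof.
have [C C0 HC] := offspring_sum3; exists C => // L.
apply: le_trans (HC L); apply: ler_sum => d _; rewrite ler_wpM2l//.
rewrite -!natrX ler_nat; case: (nat_of_ord d) => // k; exact: leq_pexp2l.
Qed.

Lemma gw_weightE t : gw_weight mu t = weight m t.
Proof.
elim/ptree_nested_ind: t => ts IH; rewrite weightE /= big_map; congr (_ * _).
by rewrite big_seq [RHS]big_seq; apply: eq_bigr => t /IH.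
Qed.

Lemma support_offspring : [set i : nat | (0 < mu [set i])%E] = [set i | 0 < m i].
Proof. by apply/seteqP; split => i /=; rewrite offspringE lte_fin. Qed.
End Offspring.

(** * Law of the chosen subtrees *)

Section ConditionedTree.
Context {R : realType}.
Variable mu : probability nat R.
Notation m := (offspring mu).
Notation w := (weight m).
Implicit Types (t : ptree) (A : set ptree) (n : nat).

Lemma of_sizeE n : of_size n = [set` trees_size n].
Proof.
apply/seteqP; split => t /=; rewrite /of_size /= mem_trees_size card_verts; first by move=> ->.
by move=> /eqP.
Qed.

Lemma gw_law_size A n :
  gw_law mu (A `&` of_size n) = (\sum_(t <- trees_size n | t \in A) w t)%:E.
Proof.
rewrite /gw_law esum_mkcondl of_sizeE esum_fset; [|exact: finite_seq|]; last first.
  by move=> t _; case: ifP => // _; rewrite lee_fin gw_weight_ge0.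
rewrite -fsbig_seq ?trees_size_uniq// [in RHS]big_mkcond -sumEFin; apply: eq_bigr => t _.
by rewrite gw_weightE; case: ifP.
Qed.

Lemma gw_condE A n : 0 < size_pr m n ->
  gw_cond mu n A = ((\sum_(t <- trees_size n | t \in A) w t) / size_pr m n)%:E.
Proof.
move=> p0; rewrite /gw_cond /= /mnormalize /= /mrestr.
have -> : gw_law mu ([set: ptree] `&` of_size n) = (size_pr m n)%:E.
  by rewrite gw_law_size; congr EFin; apply: eq_bigl => t; rewrite in_setT.
by rewrite eqe gt_eqF//= gw_law_size EFinM.
Qed.

Fixpoint seqs_sized (ns : seq nat) : seq (seq ptree) :=
  if ns is n :: ns' then [seq t :: ts | t <- trees_size n, ts <- seqs_sized ns'] else [:: [::]].

Lemma mem_seqs_sized ns ts : (ts \in seqs_sized ns) = (map tsz ts == ns).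
Proof.
elim: ns ts => [|n ns IH] ts /=; first by rewrite inE; case: ts.
apply/allpairsP/eqP => [[[t ts'] /= [+ + ->]]|].
  by rewrite mem_trees_size IH => /eqP <- /eqP <-.
case: ts => // t ts [e1 e2]; exists (t, ts); split => //.
  by rewrite /= mem_trees_size e1.
by rewrite /= IH e2.
Qed.

Lemma seqs_sized_uniq ns : uniq (seqs_sized ns).
Proof.
elim: ns => //= n ns IH; apply: allpairs_uniq; rewrite ?trees_size_uniq//.
by move=> [t ts] [t' ts'] _ _ /= [-> ->].
Qed.

Fixpoint all_in (A : nat -> set ptree) (ts : seq ptree) : bool :=
  if ts is t :: ts' then (t \in A 0%N) && all_in (fun i => A i.+1) ts' else true.

Lemma all_inP (A : nat -> set ptree) ts :
  reflect (forall i, (i < size ts)%N -> A i (nth leaf ts i)) (all_in A ts).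
Proof.
elim: ts A => [|t ts IH] A /=; first by apply: ReflectT.
apply: (iffP andP) => [[tA /IH H] [|i]|H] /=; rewrite ?ltnS; first by move: tA; rewrite inE.
  exact: H.
by split; [rewrite inE; exact: (H 0%N)|apply/IH => i il; exact: (H i.+1)].
Qed.

Lemma sum_seqs_sized (A : nat -> set ptree) ns :
  \sum_(ts <- seqs_sized ns | all_in A ts) \prod_(t <- ts) w t =
  \prod_(i < size ns) \sum_(t <- trees_size (nth 0%N ns i) | t \in A i) w t.
Proof.
elim: ns A => [|n ns IH] A; first by rewrite big_ord0 /= big_mkcond big_seq1 big_nil.
rewrite big_ord_recl -(IH (fun i => A i.+1)) big_mkcond /= big_allpairs_dep /=.
rewrite [X in _ = X * _]big_mkcond big_distrl; apply: eq_bigr => t _.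
rewrite [X in _ = _ * X]big_mkcond big_distrr; apply: eq_bigr => ts _ /=.
by case: (t \in A 0%N) => /=; case: (all_in _ ts); rewrite ?mul0r ?mulr0 ?big_cons.
Qed.

(** * The decomposition of a tree of size n and its conditional law *)

Section Decomposed.
Variables (x M l n : nat) (r : R).
Hypotheses (nM : (M < n)%N) (n1 : (1 < n)%N).
Notation cuts := (cuts x M l).
Notation prune := (prune x M l).

(** A single chosen subtree is excluded: depth is controlled only by separation from a second
    one. *)
Definition good_tree t :=
  [&& tsz t == n, (tsz (prune t 0))%:R <= r & size (cuts t 0) != 1%N].

Definition decompose t : option subtree_seq :=
  if good_tree t then Some (cut_sets x M l t) else None.

Lemma decompose_skeleton t : good_tree t -> skeleton t (cut_sets x M l t) =
  (verts (prune t 0), [seq tsz p.2 | p <- cuts t 0], [seq p.1 | p <- cuts t 0]).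
Proof. by move=> /and3P[/eqP tn _ _]; apply: skeleton_cut_sets; rewrite tn. Qed.

Section Law.
Variable t0 : ptree.
Hypothesis t0_good : good_tree t0.
Notation cs := (cuts t0 0).
Notation locs := [seq p.1 | p <- cs].
Notation sizes := [seq tsz p.2 | p <- cs].
Notation E := (skeleton_event decompose (verts (prune t0 0), sizes, locs)).

(** Words that are not places of chosen subtrees get the default [leaf], which [refill] never
    consults. *)
Let plug (ts : seq ptree) (v : word) : ptree := nth leaf ts (index v locs).

Let plug_nth ts i : (i < size cs)%N -> plug ts (nth [::] locs i) = nth leaf ts i.
Proof. by move=> il; rewrite /plug index_uniq ?cuts_uniq// size_map. Qed.

Let map_plug ts : size ts = size cs -> [seq plug ts p.1 | p <- cs] = ts.
Proof.
move=> ss; apply: (@eq_from_nth _ leaf); rewrite size_map// => i il.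
rewrite (nth_map ([::], leaf))// -(plug_nth ts il); congr plug.
by rewrite (nth_map ([::], leaf)).
Qed.

Let size_sized ts : ts \in seqs_sized sizes -> size ts = size cs.
Proof. by rewrite mem_seqs_sized => /eqP e; move: (congr1 size e); rewrite !size_map. Qed.

Let plug_size ts : ts \in seqs_sized sizes ->
  size_preserving x M l t0 0 (plug ts).
Proof.
move=> tss; have ss := size_sized tss; move: tss; rewrite mem_seqs_sized => /eqP e v s vs.
have il : (index (v, s) cs < size cs)%N by rewrite index_mem.
have vE : v = nth [::] locs (index (v, s) cs).
  by rewrite (nth_map ([::], leaf))// nth_index.
rewrite {1}vE plug_nth//; have := congr1 (nth 0%N ^~ (index (v, s) cs)) e.
by rewrite (nth_map leaf) ?ss// (nth_map ([::], leaf))// nth_index.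
Qed.

Let filled ts := refill x M l t0 0 (plug ts).

Let filled_cuts ts : ts \in seqs_sized sizes -> cuts (filled ts) 0 = zip locs ts.
Proof.
move=> tss; rewrite refill_cuts; last exact: plug_size.
rewrite -{2}(map_plug (size_sized tss)); elim: cs => //= p s ->; congr cons.
Qed.

Let filled_good ts : ts \in seqs_sized sizes -> good_tree (filled ts).
Proof.
move=> tss; have sp := plug_size tss.
rewrite /good_tree refill_tsz// refill_prune// refill_cuts// size_map.
exact: t0_good.
Qed.

Let filled_skeleton ts : ts \in seqs_sized sizes -> E (filled ts).
Proof.
move=> tss; have sp := plug_size tss; have ss := size_sized tss.
exists (cut_sets x M l (filled ts)); first by rewrite /decompose filled_good.
rewrite decompose_skeleton ?filled_good// filled_cuts// refill_prune//.
move: tss; rewrite mem_seqs_sized => /eqP <-; congr (_, _, _).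
  by rewrite -[in RHS](@unzip2_zip _ _ locs ts) ?size_map ?ss// /unzip2 -map_comp.
by rewrite -/(unzip1 _) unzip1_zip// size_map ss.
Qed.

Let skeleton_filled t : E t -> exists2 ts, ts \in seqs_sized sizes & t = filled ts.
Proof.
move=> [s Ds sk]; move: Ds; rewrite /decompose; case: ifP => // gt [es].
move: sk; rewrite -es decompose_skeleton// => -[ep ez el].
pose ts := [seq p.2 | p <- cuts t 0].
exists ts; first by rewrite mem_seqs_sized -ez /ts -map_comp.
have etag : map tag_size cs = map tag_size (cuts t 0).
  have tE (q : seq (word * ptree)) : map tag_size q = zip [seq p.1 | p <- q] [seq tsz p.2 | p <- q].
    by elim: q => //= p q ->.
  by rewrite !tE el ez.
symmetry; apply: refill_uniq => //; first by rewrite (verts_inj ep).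
move=> v s' vs; rewrite /plug -el.
have il : (index (v, s') (cuts t 0) < size (cuts t 0))%N by rewrite index_mem.
have {1}-> : v = nth [::] [seq p.1 | p <- cuts t 0] (index (v, s') (cuts t 0)).
  by rewrite (nth_map ([::], leaf))// nth_index.
by rewrite index_uniq ?cuts_uniq ?size_map// (nth_map ([::], leaf))// nth_index.
Qed.

Let skeleton_perm : perm_eq [seq t <- trees_size n | t \in E] (map filled (seqs_sized sizes)).
Proof.
apply: uniq_perm.
- exact/filter_uniq/trees_size_uniq.
- rewrite map_inj_in_uniq ?seqs_sized_uniq// => ts ts' tss tss' e.
  have := filled_cuts tss; rewrite e filled_cuts// => ez.
  have := congr1 (@unzip2 _ _) ez.
  by rewrite !unzip2_zip// size_map ?(size_sized tss) ?(size_sized tss').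
move=> t; rewrite mem_filter mem_trees_size /=; apply/andP/mapP.
  by move=> [/set_mem /skeleton_filled[ts tss ->] _]; exists ts.
move=> [ts tss ->]; split; first exact/mem_set/filled_skeleton.
by case/and3P: (filled_good tss).
Qed.

Let W := context_weight x M l m t0 0.

Let filled_weight ts : ts \in seqs_sized sizes -> w (filled ts) = W * \prod_(t <- ts) w t.
Proof.
move=> tss; rewrite refill_weight; congr (_ * _).
by rewrite -[in RHS](map_plug (size_sized tss)) big_map.
Qed.

Let filled_shapes (A : nat -> set ptree) ts : ts \in seqs_sized sizes ->
  (filled ts \in shapes_event decompose A) = all_in A ts.
Proof.
move=> tss; have ss := size_sized tss.
have Dt : decompose (filled ts) = Some (cut_sets x M l (filled ts)).
  by rewrite /decompose filled_good.
have sc : size (cuts (filled ts) 0) = size ts by rewrite filled_cuts// size_zip size_map ss minnn.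
have shE i : (i < size ts)%N ->
    Defs.shape (sverts (cut_sets x M l (filled ts)) i) (sroot (cut_sets x M l (filled ts)) i) =
    verts (nth leaf ts i).
  move=> il; rewrite sverts_cut_sets ?sc// sroot_cut_sets ?sc// shape_grafted.
  by rewrite filled_cuts// nth_zip ?size_map.
apply/idP/all_inP => [|H]; rewrite inE.
  move=> [s]; rewrite Dt => -[<-] H i il.
  have [|tau At vt] := H i; first by rewrite size_map sc.
  by move: vt; rewrite shE// => /verts_inj <-.
exists (cut_sets x M l (filled ts)) => // i; rewrite size_map sc => il.
by exists (nth leaf ts i); [exact: H|rewrite shE].
Qed.

Lemma sum_skeleton_shapes (A : nat -> set ptree) :
  \sum_(t <- trees_size n | t \in shapes_event decompose A `&` E) w t =
  W * \prod_(i < size sizes) \sum_(t <- trees_size (nth 0%N sizes i) | t \in A i) w t.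
Proof.
under eq_bigl do rewrite in_setI andbC.
rewrite -big_filter_cond (perm_big _ skeleton_perm) big_map -sum_seqs_sized big_distrr /=.
rewrite big_seq_cond [RHS]big_seq_cond.
apply: congr_big => // [ts|ts /andP[tss _]]; last exact: filled_weight.
by case: (boolP (ts \in _)) => //= tss; exact: filled_shapes.
Qed.

Lemma sum_skeleton :
  \sum_(t <- trees_size n | t \in E) w t =
  W * \prod_(i < size sizes) size_pr m (nth 0%N sizes i).
Proof.
rewrite -[E]setTI -(_ : shapes_event decompose (fun=> setT) `&` E = [set: ptree] `&` E).
  rewrite sum_skeleton_shapes; congr (_ * _); apply: eq_bigr => i _.
  by apply: eq_bigl => t; rewrite in_setT.
apply/seteqP; split => t [_ Et]; split => //.
case: (Et) => s Ds _; exists s => // i il.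
move: Ds; rewrite /decompose; case: ifP => // _ [es].
have sc : (i < size (cuts t 0))%N by move: il; rewrite -es size_map.
rewrite -es sverts_cut_sets// sroot_cut_sets// shape_grafted.
by exists (nth ([::], leaf) (cuts t 0) i).2.
Qed.
End Law.

(* The trees with a given skeleton are the [refill]s of one of them by all families of trees of the
   prescribed sizes, and their weight factorizes. *)
Lemma decompose_cond_pr (H : {fset word}) (sizes : seq nat) (locs : seq word)
    (E := skeleton_event decompose (H, sizes, locs)) :
  0 < size_pr m n -> (0 < gw_cond mu n E)%E -> forall A : nat -> set ptree,
  cond_pr (gw_cond mu n) (shapes_event decompose A) E =
  \prod_(i < size sizes) fine (gw_cond mu (nth 0%N sizes i) (A i)).
Proof.
move=> pn; rewrite gw_condE// lte_fin => E0 A.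
have {}E0 : 0 < \sum_(t <- trees_size n | t \in E) w t by move: E0; rewrite pmulr_lgt0 ?invr_gt0.
have [t0 Et0] : exists t, E t.
  apply: contrapT => nE; move: E0; rewrite big1 ?ltxx// => t.
  by rewrite inE => Et; exfalso; apply: nE; exists t.
case: (Et0) => s Ds sk; move: Ds; rewrite /decompose; case: ifP => // gt0 [es].
move: sk; rewrite -es decompose_skeleton// => -[eH eS eL].
have S1 := sum_skeleton_shapes gt0 A; have S0 := sum_skeleton gt0.
move: S0 S1; rewrite eH eS eL -/E => S0 S1.
have fE (a : R) : fine a%:E = a by [].
rewrite /cond_pr [gw_cond mu n _]gw_condE// [gw_cond mu n E]gw_condE// !fE S1 S0.
rewrite S0 in E0.
set W := context_weight _ _ _ _ _ _ in E0 *.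
(* Positive probability of the skeleton makes the context weight and the probability of each size
   nonzero, so the ratio of the two sums simplifies and each [gw_cond] is a true conditional law. *)
have W0 : W != 0 by apply/eqP => W0; move: E0; rewrite W0 mul0r ltxx.
have p0 (i : 'I_(size sizes)) : size_pr m (nth 0%N sizes i) != 0.
  by apply/eqP => p0; move: E0; rewrite (bigD1 i)//= p0 mul0r mulr0 ltxx.
have P0 : \prod_(i < size sizes) size_pr m (nth 0%N sizes i) != 0.
  by apply/prodf_neq0 => i _.
rewrite [RHS](eq_bigr (fun i : 'I_(size sizes) =>
   (\sum_(t <- trees_size (nth 0%N sizes i) | t \in A i) w t) / size_pr m (nth 0%N sizes i))).
  rewrite prodf_div; set X := \prod_(i < _) \sum_(t <- _ | _) _; set Y := \prod_(i < _) _ in P0 *.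
  by field; rewrite P0 W0 gt_eqF.
move=> i _; rewrite gw_condE// lt_neqAle eq_sym p0 size_pr_ge0//.
exact: offspring_ge0.
Qed.
End Decomposed.
End ConditionedTree.

(** * Choice of the parameters *)

Section ExpCalculus.
Context {R : realType}.
Implicit Types p q a b : R.

Lemma two_le_expR1 : 2 <= expR 1 :> R.
Proof. by have := @expR_ge1Dx R 1; lra. Qed.

(** Parameters are compared through exponents, and numerical factors are rounded up to powers of 2,
    hence of e: the conditions of the Chernoff bound become linear inequalities. *)
Lemma ler_mul_expR p q a b : 0 <= p -> 0 <= q -> p <= expR a -> q <= expR b ->
  p * q <= expR (a + b).
Proof. by move=> p0 q0 pa qb; rewrite expRD; exact: ler_pM. Qed.

Lemma ler_inv_expR p a : expR a <= p -> p^-1 <= expR (- a).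
Proof. by move=> ap; rewrite expRN lef_pV2 ?posrE ?expR_gt0// (lt_le_trans (expR_gt0 _) ap). Qed.

Lemma ler_expR_inv p a : 0 < p -> p <= expR a -> expR (- a) <= p^-1.
Proof. by move=> p0 pa; rewrite expRN lef_pV2 ?posrE ?expR_gt0. Qed.

Lemma sqrt_expR a : Num.sqrt (expR a) = expR (a / 2) :> R.
Proof.
have -> : expR a = expR (a / 2) ^+ 2 by rewrite -expRM_natl; congr expR; field.
by rewrite sqrtr_sqr ger0_norm// expR_ge0.
Qed.

Lemma ler_sqrt_expR p a : p <= expR a -> Num.sqrt p <= expR (a / 2).
Proof. by move=> pa; rewrite -sqrt_expR; exact: ler_wsqrtr. Qed.

Lemma ler_expR_sqrt p a : expR a <= p -> expR (a / 2) <= Num.sqrt p.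
Proof. by move=> pa; rewrite -sqrt_expR; exact: ler_wsqrtr. Qed.

Lemma natr_le_expR k : (2 ^ k)%:R <= expR k%:R :> R.
Proof.
rewrite -[k%:R]mulr1 expRM_natl natrX; apply: lerXn2r; rewrite ?nnegrE ?expR_ge0//.
exact: two_le_expR1.
Qed.

Lemma expRN1_le : expR (-1) <= 1 / 2 :> R.
Proof. by rewrite mul1r expRN lef_pV2 ?posrE ?expR_gt0//; exact: two_le_expR1. Qed.

Lemma two_mul_expRN1_le : 2 * expR (-1) <= 1 :> R.
Proof. by rewrite -ler_pdivlMl// mulr1 -[leRHS]mul1r expRN1_le. Qed.

Lemma expRN2_le : expR (-2) <= 1 / 4 :> R.
Proof.
have -> : (-2 : R) = -1 + -1 by ring.
by rewrite expRD; have := expRN1_le; have := expR_ge0 (-1 : R); nra.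
Qed.

Lemma mulr_nat_expR k p a : 0 <= p -> p <= expR a -> (2 ^ k)%:R * p <= expR (k%:R + a).
Proof. by move=> p0 pa; apply: ler_mul_expR => //; exact: natr_le_expR. Qed.
End ExpCalculus.

(** * Hypotheses of the Chernoff bound in exponential form *)

Section ChernoffConditions.
Context {R : realType}.
Variables (m : nat -> R) (m_ge0 : forall d, 0 <= m d) (L : nat).
Hypothesis m_sum0 : \sum_(d < L.+1) m d <= 1.
Hypothesis m_sum1 : \sum_(d < L.+1) m d * d%:R <= 1.
Variables (c C3 : R).
Hypotheses (c_gt0 : 0 < c) (c_le : c <= \sum_(d < L.+1 | (1 < d)%N) m d).
Hypotheses (m_gt0 : 0 < m 0%N) (m_sum3 : \sum_(d < L.+1) m d * d%:R ^+ 3 <= C3).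
Hypothesis C3_gt0 : 0 < C3.
Variables (x M l : nat).
Variables (EX EB EA EL : R).
Notation a := (tail_const c).

(** Chosen to make the hypothesis [theta_lam] an equality. *)
Definition theta_const : R := m 0%N / (12 * a * (1 + a) * C3).
(** [B] is at most this constant over [x]; 36 is 4 times the square of the 3 in [rho]. *)
Definition loss_const : R := 2 * theta_const + 36 * C3 * a ^+ 2.
Definition theta : R := theta_const / (Num.sqrt M%:R * Num.sqrt x%:R).

Notation k0 := (ln theta_const).
Notation k5 := (ln loss_const).
Notation ka := (ln a).
Notation kC := (ln C3).
Notation km := (ln (m 0%N)).

Hypotheses (x_ge : expR EX <= x%:R) (x_le : x%:R <= expR (EX + 1)).
Hypotheses (M_ge : expR (EB - 1) <= M%:R) (M_le : M%:R <= expR EB).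
Hypothesis l_le : l%:R <= expR EA.
Hypotheses (L_ge1 : (1 <= L)%N) (L_le : L%:R <= expR EL).

Hypothesis h_xM : EX + 3 <= EB.
Hypothesis h1 : k0 + 7 / 2 + EX / 2 + EL <= EB / 2.
Hypothesis h2 : EL + 5 / 2 + ka + k0 <= EB / 2.
Hypothesis h3 : EA + 7 / 2 + k0 <= EB / 2 + EX / 2.
Hypothesis h3' : EA + 11 / 2 + k0 + ka + kC <= EB / 2.
Hypothesis h4 : EA + 3 / 2 + k5 <= EX / 2 + ka.
Hypothesis h5 : EL + 2 + EA + k5 <= EX.
Hypothesis h6 : kC + 6 + ka + EA + k5 + EB <= 3 / 2 * EX + km.

Let a_gt0 : 0 < a := tail_const_gt0 c_gt0.
Let x_gt0R : 0 < x%:R :> R := lt_le_trans (expR_gt0 _) x_ge.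
Let M_gt0R : 0 < M%:R :> R := lt_le_trans (expR_gt0 _) M_ge.

Lemma theta_const_gt0 : 0 < theta_const.
Proof.
have a1 : 0 < 1 + a by exact: addr_gt0.
by apply: divr_gt0 => //; do 3 (apply: mulr_gt0 => //).
Qed.

Lemma loss_const_gt0 : 0 < loss_const.
Proof.
have k0 := theta_const_gt0; have a2 : 0 < a ^+ 2 by exact: exprn_gt0.
by apply: addr_gt0; [exact: mulr_gt0|apply: mulr_gt0 => //; exact: mulr_gt0].
Qed.

Let lnE (p : R) : 0 < p -> p <= expR (ln p). Proof. by move=> p0; rewrite lnK ?posrE. Qed.
Let lnE' (p : R) : 0 < p -> expR (ln p) <= p. Proof. by move=> p0; rewrite lnK ?posrE. Qed.

Let sx_gt0 : 0 < Num.sqrt x%:R :> R. Proof. by rewrite sqrtr_gt0. Qed.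
Let sM_gt0 : 0 < Num.sqrt M%:R :> R. Proof. by rewrite sqrtr_gt0. Qed.

Lemma theta_gt0 : 0 < theta.
Proof. by rewrite divr_gt0 ?theta_const_gt0// mulr_gt0. Qed.

Let isM : (Num.sqrt M%:R)^-1 <= expR (- ((EB - 1) / 2)).
Proof. by apply: ler_inv_expR; exact: ler_expR_sqrt. Qed.

Let isx : (Num.sqrt x%:R)^-1 <= expR (- (EX / 2)).
Proof. by apply: ler_inv_expR; exact: ler_expR_sqrt. Qed.

Let isM0 : 0 <= (Num.sqrt M%:R)^-1 :> R. Proof. by rewrite invr_ge0 ltW. Qed.
Let isx0 : 0 <= (Num.sqrt x%:R)^-1 :> R. Proof. by rewrite invr_ge0 ltW. Qed.

Let theta_rx : theta * Num.sqrt x%:R = theta_const / Num.sqrt M%:R.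
Proof. by rewrite /theta; field; rewrite !gt_eqF. Qed.

Let theta_le : theta <= expR (k0 + (- ((EB - 1) / 2) - EX / 2)).
Proof.
rewrite /theta invfM; apply: ler_mul_expR.
- exact: ltW theta_const_gt0.
- exact: mulr_ge0.
- exact: lnE theta_const_gt0.
- exact: ler_mul_expR.
Qed.

Let theta_rx_le : theta * Num.sqrt x%:R <= expR (k0 - (EB - 1) / 2).
Proof.
rewrite theta_rx; apply: ler_mul_expR => //.
- exact: ltW theta_const_gt0.
- exact: lnE theta_const_gt0.
Qed.

Let x_ge1 : (0 < x)%N. Proof. by rewrite -(ltr_nat R). Qed.

Lemma two_x_le_M : (2 * x <= M)%N.
Proof.
rewrite -(ler_nat R) natrM; apply: le_trans M_ge.
have := @mulr_nat_expR R 1 x%:R _ (ltW x_gt0R) x_le; rewrite expn1 => H.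
by apply: (le_trans H); rewrite ler_expR; have := h_xM; lra.
Qed.

Let half_le (p e0 : R) : p <= expR e0 -> e0 <= -1 -> p <= 1 / 2.
Proof.
by move=> pe e1; apply: (le_trans pe); apply: le_trans expRN1_le; rewrite ler_expR.
Qed.

Lemma cond_theta_small : theta * (1 + L%:R * x%:R) <= 1 / 2.
Proof.
have Lx1 : 1 <= L%:R * x%:R :> R by rewrite -natrM ler1n muln_gt0 L_ge1.
have H : (2 ^ 1)%:R * (L%:R * x%:R) <= expR (1%:R + (EL + (EX + 1))).
  by apply: mulr_nat_expR; rewrite ?mulr_ge0//; apply: ler_mul_expR.
rewrite expn1 in H.
apply: (@half_le _ (k0 + (- ((EB - 1) / 2) - EX / 2) + (1 + (EL + (EX + 1))))).
  apply: ler_mul_expR => //; first exact: ltW theta_gt0.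
  by apply: le_trans H; lra.
by have := h1; lra.
Qed.

Lemma cond_nu_small : L%:R * (2 * theta * a * Num.sqrt x%:R) <= 1 / 2.
Proof.
have -> : L%:R * (2 * theta * a * Num.sqrt x%:R) = (2 ^ 1)%:R * (L%:R * (a * (theta * Num.sqrt x%:R))).
  by rewrite expn1; ring.
have t0 : 0 <= theta * Num.sqrt x%:R by rewrite mulr_ge0 ?sqrtr_ge0// (ltW theta_gt0).
have at0 : 0 <= a * (theta * Num.sqrt x%:R) by rewrite mulr_ge0// (ltW a_gt0).
apply: (@half_le _ (1%:R + (EL + (ka + (k0 - (EB - 1) / 2))))); last (by have := h2; lra).
apply: mulr_nat_expR; first by rewrite mulr_ge0.
apply: ler_mul_expR => //; apply: ler_mul_expR => //; first exact: ltW.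
exact: lnE.
Qed.

Lemma cond_K_small (nu := 2 * theta * a * Num.sqrt x%:R) :
  l%:R * (2 * theta + 2 * nu * C3 + 2 * theta * (2 * nu * C3)) <= 1 / 2.
Proof.
have t0 := theta_gt0.
have nu0 : 0 <= nu by apply: ltW; do 3 (apply: mulr_gt0 => //).
have t1 : 2 * theta <= 1.
  have := cond_theta_small; have : 0 <= L%:R * x%:R :> R by rewrite mulr_ge0.
  by nra.
have q1 : (2 ^ 1)%:R * (l%:R * theta) <= 1 / 4.
  apply: le_trans expRN2_le; apply: (@le_trans _ _ (expR (1%:R + (EA + (k0 + (- ((EB - 1) / 2) - EX / 2)))))).
    apply: mulr_nat_expR; first by rewrite mulr_ge0// ltW.
    by apply: ler_mul_expR => //; exact: ltW.
  by rewrite ler_expR; have := h3; lra.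
have q2 : (2 ^ 3)%:R * (l%:R * (a * (C3 * (theta * Num.sqrt x%:R)))) <= 1 / 4.
  have s0 : 0 <= theta * Num.sqrt x%:R by rewrite mulr_ge0 ?sqrtr_ge0// (ltW t0).
  have s1 : 0 <= C3 * (theta * Num.sqrt x%:R) by rewrite mulr_ge0// (ltW C3_gt0).
  have s2 : 0 <= a * (C3 * (theta * Num.sqrt x%:R)) by rewrite mulr_ge0// (ltW a_gt0).
  apply: le_trans expRN2_le.
  apply: (@le_trans _ _ (expR (3%:R + (EA + (ka + (kC + (k0 - (EB - 1) / 2))))))).
    apply: mulr_nat_expR; first by rewrite mulr_ge0.
    apply: ler_mul_expR => //; apply: ler_mul_expR => //; [exact: ltW|exact: lnE|].
    by apply: ler_mul_expR => //; [exact: ltW|exact: lnE].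
  by rewrite ler_expR; have := h3'; lra.
have p0 : 0 <= nu * C3 by rewrite mulr_ge0// ltW.
have p1 : 2 * theta * (2 * nu * C3) <= 2 * nu * C3 by rewrite ler_piMl//; lra.
have l0 : 0 <= l%:R :> R by [].
apply: (@le_trans _ _ (l%:R * (2 * theta + 4 * (nu * C3)))).
  by rewrite ler_wpM2l//; lra.
have -> : l%:R * (2 * theta + 4 * (nu * C3)) = (2 ^ 1)%:R * (l%:R * theta) +
   (2 ^ 3)%:R * (l%:R * (a * (C3 * (theta * Num.sqrt x%:R)))).
  have -> : (2 ^ 3 = 8)%N by []. rewrite expn1 /nu; ring.
lra.
Qed.

Notation rho := (3 * a / Num.sqrt x%:R).
Notation B := (2 * theta + 4 * C3 * rho ^+ 2).
Notation A := (2 * l%:R * B).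

Let B_ge0 : 0 <= B.
Proof.
apply: addr_ge0; first by apply: mulr_ge0 => //; exact: ltW theta_gt0.
by apply: mulr_ge0; [apply: mulr_ge0 => //; exact: ltW|exact: sqr_ge0].
Qed.

(** As [x <= M], also [theta <= theta_const / x], so both parts of [B] are at most of order 1 /
    x. *)
Let A_le : A <= expR (1 + EA + k5 - EX).
Proof.
have xE : Num.sqrt x%:R ^+ 2 = x%:R :> R by rewrite sqr_sqrtr// ltW.
have BL : B <= loss_const / x%:R.
  have -> : loss_const / x%:R = 2 * (theta_const / x%:R) + 4 * C3 * rho ^+ 2.
    move: xE sx_gt0; move: (Num.sqrt x%:R) => s <- s0.
    by rewrite /loss_const; field; rewrite gt_eqF.
  rewrite lerD2r ler_pM2l// /theta ler_pM2l ?theta_const_gt0// lef_pV2 ?posrE ?mulr_gt0//.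
  rewrite -[leLHS]xE expr2 ler_wpM2r ?sqrtr_ge0// ler_wsqrtr// ler_nat.
  by apply: leq_trans two_x_le_M; rewrite leq_pmull.
have B0 := B_ge0.
have -> : A = (2 ^ 1)%:R * (l%:R * B) by rewrite expn1 mulrA.
have -> : 1 + EA + k5 - EX = 1%:R + (EA + (k5 - EX)) by ring.
apply: mulr_nat_expR; first by rewrite mulr_ge0.
apply: ler_mul_expR => //; apply: (le_trans BL).
apply: ler_mul_expR; rewrite ?invr_ge0//; first exact: ltW loss_const_gt0.
  exact: lnE loss_const_gt0.
exact: ler_inv_expR.
Qed.

Let A_ge0 : 0 <= A.
Proof.
by apply: mulr_ge0; [exact: mulr_ge0|exact: B_ge0].
Qed.

Lemma cond_A_small : A <= a / Num.sqrt x%:R.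
Proof.
apply: (le_trans A_le); apply: (@le_trans _ _ (expR (ka - (EX + 1) / 2))).
  by rewrite ler_expR; have := h4; lra.
rewrite expRD; apply: ler_pM; [exact: expR_ge0|exact: expR_ge0|exact: lnE'|].
by apply: ler_expR_inv => //; exact: ler_sqrt_expR.
Qed.

Lemma cond_LA_small : L%:R * A <= 1 / 2.
Proof.
apply: (@half_le _ (EL + (1 + EA + k5 - EX))); last (by have := h5; lra).
exact: ler_mul_expR.
Qed.

Lemma cond_A_rho : 4 * C3 * A * rho <= M%:R^-1 * m 0%N / 2.
Proof.
have -> : 4 * C3 * A * rho = 12 * (C3 * (a * (A * (Num.sqrt x%:R)^-1))) by ring.
have i0 : 0 <= (Num.sqrt x%:R)^-1 :> R by rewrite invr_ge0 sqrtr_ge0.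
have Ai0 : 0 <= A * (Num.sqrt x%:R)^-1 by rewrite mulr_ge0.
have aA0 : 0 <= a * (A * (Num.sqrt x%:R)^-1) by rewrite mulr_ge0// ltW.
have CA0 : 0 <= C3 * (a * (A * (Num.sqrt x%:R)^-1)) by rewrite mulr_ge0// ltW.
apply: (@le_trans _ _ ((2 ^ 4)%:R * (C3 * (a * (A * (Num.sqrt x%:R)^-1))))).
  by rewrite ler_wpM2r// ler_nat.
apply: (@le_trans _ _ (expR (4%:R + (kC + (ka + (1 + EA + k5 - EX - EX / 2)))))).
  apply: mulr_nat_expR => //; apply: ler_mul_expR => //; [exact: ltW|exact: lnE|].
  apply: ler_mul_expR => //; [exact: ltW|exact: lnE|].
  exact: ler_mul_expR.
apply: (@le_trans _ _ (expR (- EB + km + -1))); first by rewrite ler_expR; have := h6; lra.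
rewrite !expRD; apply: ler_pM; rewrite ?mulr_ge0 ?expR_ge0//.
  by apply: ler_pM; [exact: expR_ge0|exact: expR_ge0|exact: ler_expR_inv|exact: lnE'].
by rewrite -[leRHS]mul1r expRN1_le.
Qed.

Lemma cond_theta_lam : 6 * a * (1 + a) * C3 * theta * Num.sqrt x%:R / Num.sqrt M%:R <=
  M%:R^-1 * m 0%N / 2.
Proof.
have ME : M%:R = Num.sqrt M%:R ^+ 2 :> R by rewrite sqr_sqrtr// ltW.
rewrite le_eqVlt; apply/orP; left; apply/eqP.
rewrite [in RHS]ME /theta /theta_const; field.
by rewrite !gt_eqF// addr_gt0.
Qed.

Lemma gwE_lost_tail_explicit h n (r : R) :
  gwE m L h (fun t => ((tsz t == n) && (r <= (lost x M l t 0)%:R))%:R) <=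
  expR (M%:R^-1 * n%:R - theta * r).
Proof.
exact: (gwE_lost_tail m_ge0 m_sum0 m_sum1 c_gt0 c_le m_gt0 m_sum3 L_ge1 x_ge1 two_x_le_M
  theta_gt0 erefl cond_theta_small cond_nu_small cond_K_small cond_A_small cond_LA_small
  cond_A_rho cond_theta_lam).
Qed.
End ChernoffConditions.

Lemma sum_indicator (R : pzRingType) (I : Type) (s : seq I) (P : pred I) (w : I -> R) :
  \sum_(i <- s) w i * (P i)%:R = \sum_(i <- s | P i) w i.
Proof. by rewrite [RHS]big_mkcond; apply: eq_bigr => i _; case: (P i); rewrite ?mulr1 ?mulr0. Qed.

(** * From the loss to the failure of the decomposition *)

Section FailureProbability.
Context {R : realType}.
Variables (x M l n : nat) (r : R).
Hypotheses (x_gt0 : (0 < x)%N) (xn : (x <= n)%N) (rM : r + M%:R <= n%:R).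
Notation good := (good_tree x M l n r).

(** A tree that is not good has a remainder of size at least [r], even with a single chosen subtree,
    since that one has at most [M] vertices and [r + M <= n]. Passing from the remainder to [lost]
    subtracts the number of chosen subtrees, at most n / x. *)
Lemma lost_ge_not_good t : tsz t = n -> ~~ good t -> r - n%:R / x%:R <= (lost x M l t 0)%:R.
Proof.
move=> tn; have bt : is_big x t by rewrite /is_big tn.
have pr := prune_lost M l 0 bt; have sc := size_cuts_le x M l 0 t; rewrite tn in sc.
have rp : ~~ good t -> r <= (tsz (prune x M l t 0))%:R.
  rewrite /good_tree tn eqxx /= negb_and -ltNge negbK => /orP[|/eqP s1]; first exact: ltW.
  have := tsz_prune x M l 0 t; rewrite s1 tn.
  case: (cuts x M l t 0) (@cut_size x M l 0 t) s1 => [|[v s] [|]]// cs _.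
  rewrite big_seq1 /= => e; have /andP[_ sM] := cs _ _ (mem_head _ _).
  apply: (@le_trans _ _ (n%:R - M%:R)); first by rewrite lerBrDr.
  by rewrite lerBlDr -natrD ler_nat -(leq_add2r 1) e -addnA leq_add2l (leq_trans sM)// leq_addr.
move=> /rp; rewrite pr natrD -lerBlDr => rl; apply: le_trans rl.
rewrite lerD2l lerN2 ler_pdivlMr ?ltr0n// -natrM ler_nat//.
Qed.

(** Trees with degrees at most [L] are covered by the truncation at [L], to which the Chernoff bound
    applies; the others are covered by the truncation at [n]. *)
Lemma sum_not_good_le (m : nat -> R) L : (forall d, 0 <= m d) ->
  \sum_(t <- trees_size n | ~~ good t) weight m t <=
  gwE m L n (fun t => ((tsz t == n) && (r - n%:R / x%:R <= (lost x M l t 0)%:R))%:R) +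
  gwE m n n (fun t => (L < maxdeg t)%N%:R).
Proof.
move=> m_ge0; rewrite (bigID (fun t => maxdeg t <= L)%N) /=; apply: lerD.
  rewrite /gwE sum_indicator -[leLHS]big_filter -[leRHS]big_filter; apply: le_sum_subseq; last exact: weight_ge0.
    exact/filter_uniq/trees_size_uniq.
  move=> t; rewrite mem_filter mem_trees_size => /andP[/andP[ng tL] /eqP tn].
  by rewrite mem_filter tn eqxx lost_ge_not_good//= trees_complete ?tn.
rewrite /gwE sum_indicator -[leLHS]big_filter -[leRHS]big_filter; apply: le_sum_subseq; last exact: weight_ge0.
  exact/filter_uniq/trees_size_uniq.
move=> t; rewrite mem_filter mem_trees_size -ltnNge => /andP[/andP[ng tL] /eqP tn].
by rewrite mem_filter tL trees_complete ?tn// ltnW// -tn maxdeg_lt_tsz.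
Qed.

Lemma decompose_pr (mu : probability nat R) (b : R) : 0 < size_pr (offspring mu) n ->
  \sum_(t <- trees_size n | ~~ good t) weight (offspring mu) t <= b * size_pr (offspring mu) n ->
  ((1 - b)%:E <= gw_cond mu n [set t | isSome (decompose x M l n r t)])%E.
Proof.
move=> p0 H; rewrite gw_condE// lee_fin ler_pdivlMr// mulrBl mul1r lerBlDr.
rewrite [in leLHS]/size_pr (bigID good) /= lerD//.
rewrite le_eqVlt; apply/orP; left; apply/eqP/eq_bigl => t.
by apply/idP/idP; rewrite in_setE /= /decompose; case: (good t).
Qed.
End FailureProbability.

Lemma decompose_spec (R : realType) x M l n (r : R) t (s : subtree_seq) :
    (M < n)%N -> (1 < n)%N -> #|` verts t| = n -> decompose x M l n r t = Some s ->
  [/\ forall i, (i < size s)%N -> is_rooted_subtree t (sroot s i) (sverts s i),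
      forall i, (i < size s)%N ->
        [/\ (x <= #|` sverts s i|)%N, (#|` sverts s i| <= M)%N & (l <= size (sroot s i))%N],
      is_tree (hat_verts t s) (hat_edge t s) /\ #|` hat_verts t s|%:R <= r &
      forall i j k, (i < size s)%N -> (j < size s)%N -> (k < size s)%N -> j != i -> k != i ->
        forall a b, a \in sverts s j -> b \in sverts s k ->
        same_component t (ancestral_path (sroot s i) l) a b].
Proof.
move=> Mn n1; rewrite card_verts /decompose => tn.
case: ifPn => // /and3P[_ Pr m1] [<-]; set cs := cuts x M l t 0 in m1 *.
have sE : size (cut_sets x M l t) = size cs by rewrite size_map.
pose p i := nth ([::], leaf) cs i.
have pin i : (i < size cs)%N -> ((p i).1, (p i).2) \in cs by move=> il; rewrite -surjective_pairing mem_nth.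
have rE i : (i < size cs)%N -> sroot (cut_sets x M l t) i = (p i).1 by exact: sroot_cut_sets.
have vE i : (i < size cs)%N -> sverts (cut_sets x M l t) i = grafted (p i).1 (p i).2 by exact: sverts_cut_sets.
have pD i j : (i < size cs)%N -> (j < size cs)%N -> i != j -> (p i).1 != (p j).1.
  move=> il jl; apply: contra => /eqP e.
  by rewrite -(nth_uniq [::] _ _ (cuts_uniq x M l t 0)) ?size_map// !(nth_map ([::], leaf))// -/(p i) -/(p j) e.
rewrite sE; split => [i il|i il||i j k il jl kl ji ki a b].
- by rewrite rE// vE//; apply: cut_is_rooted_subtree (pin i il).
- rewrite rE// vE// card_grafted; have /andP[-> ->] := cut_size (pin i il); split => //.
  (* There is a second chosen subtree because their number is not 1; separation from it gives the
     depth. *)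
  have [j jl ji] : exists2 j, (j < size cs)%N & i != j.
    by case: (size cs) m1 il => [|[|k]]// _ _; case: i => [|i]; [exists 1%N|exists 0%N].
  by have [] := cut_separated (leq0n l) (pin i il) (pin j jl) (pD i j il jl ji).
- split; first by apply: hat_is_tree; rewrite tn.
  by rewrite hat_vertsE ?tn// card_verts.
rewrite rE// !vE//; apply: cut_component (pin i il) (pin j jl) (pin k kl) _ _; exact: pD.
Qed.

(** * Comparison of powers and logarithms of N *)

Section Growth.
Context {R : realType}.
Implicit Types s u v a b d D e k y K : R.

(** Used with u = ln N and v = ln (ln N): the power exp (s u) of N absorbs the logarithmic factor
    exp (e v) as well as K u^2, the order of the exponent in the lower bound for P(|T| = n). *)
Lemma lnln_dominates s e k K : 0 < s -> exists V, forall u v, u = expR v -> V <= v ->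
  [/\ k <= v, 0 <= v, 1 <= u, (e + 3) * v <= s * u & K * u ^+ 2 <= expR (s * u)].
Proof.
(* The three summands serve the bound by [k], the quadratic term of u = exp v, and the cubic term of
   exp (s u), where 6 is the factorial of 3. *)
move=> s0; exists (`|k| + 2 * `|e + 3| / s + 6 * `|K| / s ^+ 3) => u v uv Vv.
have s3 : 0 < s ^+ 3 by rewrite exprn_gt0.
have e0 : 0 <= 2 * `|e + 3| / s by rewrite divr_ge0 ?(ltW s0)// mulr_ge0.
have K0 : 0 <= 6 * `|K| / s ^+ 3 by rewrite divr_ge0 ?(ltW s3)// mulr_ge0.
have k0 := normr_ge0 k; have kk := ler_norm k.
have v0 : 0 <= v by lra.
have v1 : 2 * `|e + 3| <= v * s by rewrite -ler_pdivrMr//; lra.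
have v2 : 6 * `|K| <= v * s ^+ 3 by rewrite -ler_pdivrMr//; lra.
have u1 : 1 + v ^+ 2 / 2 <= u by rewrite uv; exact: (@expR_ge1Dxn _ v 1).
have uv1 : v <= u by rewrite uv; apply: le_trans (expR_ge1Dx v); lra.
have v20 : 0 <= v ^+ 2 by rewrite sqr_ge0.
have u0 : 1 <= u by lra.
split => //; first lra.
- apply: (@le_trans _ _ (`|e + 3| * v)); first by rewrite ler_wpM2r// ler_norm.
  apply: (@le_trans _ _ (s * (v ^+ 2 / 2))); last by rewrite ler_pM2l//; lra.
  have -> : s * (v ^+ 2 / 2) = (v * s / 2) * v by rewrite expr2; ring.
  by rewrite ler_wpM2r//; lra.
- have := @expR_ge1Dxn _ (s * u) 2 (mulr_ge0 (ltW s0) (le_trans ler01 u0)) => H.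
  apply: le_trans (_ : (s * u) ^+ 3 / 3`!%:R <= _); last by lra.
  apply: (@le_trans _ _ (`|K| * u ^+ 2)); first by rewrite ler_wpM2r ?sqr_ge0// ler_norm.
  have -> : (s * u) ^+ 3 / 3`!%:R = (u * s ^+ 3 / 6) * u ^+ 2.
    have -> : 3`! = 6%N by []. by field.
  rewrite ler_wpM2r ?sqr_ge0// ler_pdivlMr// mulrC; apply: (le_trans v2).
  by rewrite ler_wpM2r// ltW.
Qed.

Lemma near_lnln V : \forall N \near \oo, [/\ 0 < N%:R :> R, 0 < ln N%:R :> R & V <= ln (ln N%:R) :> R].
Proof.
pose A := expR (expR V) : R.
exists (Num.truncn A).+1 => // N /= AN.
have {}AN : A <= N%:R.
  apply: le_trans (ltW _) (_ : (Num.truncn A).+1%:R <= _); last by rewrite ler_nat.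
  by have /andP[] := truncn_itv (ltW (expR_gt0 (expR V))).
have N0 : 0 < N%:R :> R by rewrite (lt_le_trans (expR_gt0 _) AN).
have l1 : expR V <= ln N%:R by rewrite -[leLHS]expRK ler_ln// posrE ?expR_gt0.
have l0 : 0 < ln N%:R :> R by rewrite (lt_le_trans (expR_gt0 _) l1).
by split => //; rewrite -[leLHS]expRK ler_ln// posrE ?expR_gt0.
Qed.

Lemma truncn_expR_le y : (Num.truncn (expR y))%:R <= expR y.
Proof. by rewrite truncn_le expR_ge0. Qed.

Lemma truncn_expR_ge y : 1 <= y -> expR (y - 1) <= (Num.truncn (expR y))%:R.
Proof.
move=> y1; have /andP[_] := truncn_itv (expR_ge0 y); rewrite -natr1 => h.
have e1 : 1 <= expR (y - 1) by rewrite -[leLHS]expR0 ler_expR; lra.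
have : expR (y - 1) * 2 <= expR y.
  have -> : y = y - 1 + 1 by ring.
  by rewrite [leRHS]expRD addrK ler_pM2l ?expR_gt0// two_le_expR1.
by lra.
Qed.

Lemma truncn_expRS y : 0 <= y ->
  expR y <= (Num.truncn (expR y)).+1%:R <= expR (y + 1).
Proof.
move=> y0; have /andP[h1 h2] := truncn_itv (expR_ge0 y); rewrite (ltW h2)/=.
have e1 : 1 <= expR y by rewrite -[leLHS]expR0 ler_expR.
have : expR y * 2 <= expR (y + 1) by rewrite expRD ler_pM2l ?expR_gt0// two_le_expR1.
by rewrite -natr1; lra.
Qed.

(* Logarithmic scale: [a], [b], [D], [d] are [alpha], [beta], [delta], [d0] times [ln N], and [v] is
   [ln (ln N)], so that [expR EX] is the size threshold [x]. *)
Lemma exponent_conditions a b D d v (EX := b - 2 * D - 101 / 100 * v) k0 k5 ka kC km :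
  0 <= a -> 0 <= v -> b <= d ->
  3 * v <= D / 4 -> 3 * v <= 3 / 2 * b - a - d - 7 / 2 * D ->
  `|k0| + `|k5| + `|ka| + `|kC| + `|km| + 20 <= v ->
  [/\ EX + 3 <= b, k0 + 7 / 2 + EX / 2 + D / 2 <= b / 2,
      D / 2 + 5 / 2 + ka + k0 <= b / 2, a + 7 / 2 + k0 <= b / 2 + EX / 2 &
      a + 11 / 2 + k0 + ka + kC <= b / 2] /\
  [/\ a + 3 / 2 + k5 <= EX / 2 + ka, D / 2 + 2 + a + k5 <= EX,
      kC + 6 + ka + a + k5 + b <= 3 / 2 * EX + km & 1 + D <= EX].
Proof.
move=> a0 v0 bd vD vs kv.
have := ler_norm k0; have := ler_norm k5; have := ler_norm ka; have := ler_norm kC.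
have := ler_norm (- ka); have := ler_norm (- km); rewrite !normrN.
have := normr_ge0 k0; have := normr_ge0 k5; have := normr_ge0 ka; have := normr_ge0 kC.
have := normr_ge0 km; rewrite /EX => *.
by split; split; lra.
Qed.
End Growth.

Section FailureEstimate.
Context {R : realType}.
Variables (m : nat -> R) (m_ge0 : forall d, 0 <= m d).
Hypothesis m_sum0 : forall L, \sum_(d < L) m d <= 1.
Hypothesis m_sum1 : forall L, \sum_(d < L) m d * d%:R <= 1.
Variable C3 : R.
Hypotheses (C3_gt0 : 0 < C3) (m_sum3 : forall L, \sum_(d < L) m d * d%:R ^+ 3 <= C3).
Hypothesis m0_gt0 : 0 < m 0%N.
Variable j : nat.
Hypothesis mj_gt0 : 0 < m j.+2.
Notation c := (m j.+2).
Notation k0 := (ln (theta_const m c C3)).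

(** The factor 2 is there because the logarithm in the threshold enters [theta] with exponent 101 /
    200, slightly more than one half. *)
Definition scale_const : R := 2 * (`|k0| + `|ln (loss_const m c C3)| +
  `|ln (tail_const c)| + `|ln C3| + `|ln (m 0%N)|) + 20.

Lemma chernoff_estimate (L h n x M l : nat) (r a b D d v : R)
    (EX := b - 2 * D - 101 / 100 * v) :
  0 <= a -> 0 <= v -> b <= d ->
  3 * v <= D / 4 -> 3 * v <= 3 / 2 * b - a - d - 7 / 2 * D -> scale_const <= v ->
  expR EX <= x%:R -> x%:R <= expR (EX + 1) -> expR (b - 1) <= M%:R -> M%:R <= expR b ->
  l%:R <= expR a -> (j.+2 <= L)%N -> L%:R <= expR (D / 2) -> r = n%:R * expR (- D) ->
  gwE m L h (fun t => ((tsz t == n) && (r - n%:R / x%:R <= (lost x M l t 0)%:R))%:R) <=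
  expR (- (n%:R / M%:R)).
Proof.
move=> a0 v0 bd vD vs kv xl xu Ml Mu lu jL Lu rE.
have n0 := normr_ge0 k0; have n1 := normr_ge0 (ln (loss_const m c C3)).
have n2 := normr_ge0 (ln (tail_const c)); have n3 := normr_ge0 (ln C3).
have n4 := normr_ge0 (ln (m 0%N)).
have kv' : `|k0| + `|ln (loss_const m c C3)| +
  `|ln (tail_const c)| + `|ln C3| + `|ln (m 0%N)| + 20 <= v.
  by move: kv; rewrite /scale_const; lra.
have k0v : 2 * `|k0| + 20 <= v.
  by move: kv; rewrite /scale_const; lra.
have [[h_xM h1 h2 h3 h3'] [h4 h5 h6 hD]] := exponent_conditions a0 v0 bd vD vs kv'.
have c_le : c <= \sum_(d < L.+1 | (1 < d)%N) m d.
  move: (jL); rewrite -ltnS => jL'.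
  exact: (@le_sum_term _ _ (fun d : 'I_L.+1 => (1 < d)%N) _ (Ordinal jL')).
have L1 : (1 <= L)%N by apply: leq_trans jL.
have M0 : 0 < M%:R :> R := lt_le_trans (expR_gt0 _) Ml.
have x0 : 0 < x%:R :> R := lt_le_trans (expR_gt0 _) xl.
have kp := @theta_const_gt0 R m c C3 mj_gt0 m0_gt0 C3_gt0.
have sx : (Num.sqrt x%:R)^-1 >= expR (- ((EX + 1) / 2)).
  by apply: ler_expR_inv; rewrite ?sqrtr_gt0//; exact: ler_sqrt_expR.
have sM : (Num.sqrt M%:R)^-1 >= expR (- (b / 2)).
  by apply: ler_expR_inv; rewrite ?sqrtr_gt0//; exact: ler_sqrt_expR.
have th : expR (k0 + (- (b / 2) - (EX + 1) / 2)) <= theta m c C3 x M.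
  rewrite /theta invfM expRD lnK ?posrE// ler_pM2l// expRD.
  by apply: ler_pM; rewrite ?expR_ge0.
have nx : n%:R / x%:R <= r / 2.
  rewrite rE -mulrA ler_wpM2l//; apply: (le_trans (ler_inv_expR xl)).
  apply: (@le_trans _ _ (expR (- D - 1))); first by rewrite ler_expR -opprD lerN2 addrC.
  by rewrite expRD ler_pM2l ?expR_gt0// -[leRHS]mul1r expRN1_le.
apply: le_trans (gwE_lost_tail_explicit m_ge0 (m_sum0 _) (m_sum1 _) mj_gt0 c_le m0_gt0
  (m_sum3 _) C3_gt0 xl xu Ml Mu lu L1 Lu h_xM h1 h2 h3 h3' h4 h5 h6 _ _ _) _.
rewrite ler_expR.
have t0 : 0 <= theta m c C3 x M by apply: le_trans th; exact: expR_ge0.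
(* The right side is at least the exponential of [k0 - b + 101 / 200 * v - 1 / 2]: the term 2 D in
   [EX] cancels against D, and the power of the logarithm in the threshold beats the constants. *)
have q : 4 * M%:R^-1 <= theta m c C3 x M * expR (- D).
  apply: (@le_trans _ _ (expR (k0 + (- (b / 2) - (EX + 1) / 2) - D))); last first.
    by rewrite [leLHS]expRD ler_wpM2r ?expR_ge0.
  apply: (@le_trans _ _ (expR (2%:R + (- (b - 1))))).
    have := @mulr_nat_expR R 2 M%:R^-1 (- (b - 1)) _ (ler_inv_expR Ml).
    by apply; rewrite invr_ge0 ltW.
  by rewrite ler_expR /EX; have := ler_norm (- k0); rewrite normrN; lra.
have q2 : 2 * (n%:R / M%:R) <= theta m c C3 x M * (r / 2).
  have -> : 2 * (n%:R / M%:R) = n%:R / 2 * (4 * M%:R^-1) :> R by field; rewrite gt_eqF.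
  rewrite rE [leRHS](_ : _ = n%:R / 2 * (theta m c C3 x M * expR (- D))); last by field.
  by rewrite ler_wpM2l// divr_ge0.
have q3 : theta m c C3 x M * (r / 2) <= theta m c C3 x M * (r - n%:R / x%:R).
  by rewrite ler_wpM2l//; lra.
by rewrite [M%:R^-1 * _]mulrC; lra.
Qed.
End FailureEstimate.

Lemma tail_estimate (R : realType) (c E y T : R) n L : 1 < c -> 0 <= E -> n%:R <= expR y ->
  T + y + E <= L%:R * ln c -> n%:R * (E / c ^+ L) <= expR (- T).
Proof.
move=> c1 E0 ny H; have c0 : 0 < c by rewrite (lt_trans ltr01).
have Ee : E <= expR E by apply: le_trans (expR_ge1Dx E); rewrite lerDr.
have cL : c ^+ L = expR (L%:R * ln c) by rewrite expRM_natl lnK.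
have -> : n%:R * (E / c ^+ L) = n%:R * E * expR (- (L%:R * ln c)) by rewrite cL expRN mulrA.
apply: (@le_trans _ _ (expR (y + E) * expR (- (L%:R * ln c)))).
  by rewrite ler_wpM2r ?expR_ge0//; exact: ler_mul_expR.
by rewrite -expRD ler_expR; lra.
Qed.

Section Failure.
Context {R : realType}.
Variables (m : nat -> R) (m_ge0 : forall d, 0 <= m d).
Hypothesis m_sum0 : forall L, \sum_(d < L) m d <= 1.
Hypothesis m_sum1 : forall L, \sum_(d < L) m d * d%:R <= 1.
Variable C3 : R.
Hypotheses (C3_gt0 : 0 < C3) (m_sum3 : forall L, \sum_(d < L) m d * d%:R ^+ 3 <= C3).
Hypothesis m0_gt0 : 0 < m 0%N.
Variable j : nat.
Hypothesis mj_gt0 : 0 < m j.+2.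
Variables c E : R.
Hypotheses (c_gt1 : 1 < c) (E_ge0 : 0 <= E).
Hypothesis m_tail : forall L n, \sum_(d < n | (L < d)%N) m d <= E / c ^+ L.

(** [w] is the logarithm of a small power of N that fits into every gap between exponents; [ev] is
    the logarithm of the factor (log N)^e by which [n] may deviate from N^d0. *)
Lemma sum_not_good_estimate (n : nat) (r a b D d v ev w T : R)
    (x := (Num.truncn (expR (b - 2 * D - 101 / 100 * v))).+1)
    (M := Num.truncn (expR b)) (l := Num.truncn (expR a)) :
  0 <= a -> 0 <= v -> 0 <= ev -> ev <= w ->
  3 * v <= w -> 4 * w <= D -> 4 * w <= d - b -> w <= 3 / 2 * b - a - d - 7 / 2 * D ->
  scale_const m C3 j <= v -> expR (d - ev) <= n%:R -> n%:R <= expR (d + ev) ->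
  r = n%:R * expR (- D) -> (j.+2)%:R <= expR w -> T <= expR w ->
  T + (d + ev) + E <= expR w * ln c ->
  [/\ (M < n)%N, (1 < n)%N, r + M%:R <= n%:R, (x <= n)%N &
   \sum_(t <- trees_size n | ~~ good_tree x M l n r t) weight m t <= 2 * expR (- T)].
Proof.
move=> a0 v0 ev0 evw vw wD wd ws kv nl nu rE jw Tw Tw'.
have v20 : 20 <= v.
  by apply: le_trans kv; rewrite /scale_const lerDr mulr_ge0.
have D0 : 240 <= D by lra.
have b1 : 1 <= b by lra.
set EX := b - 2 * D - 101 / 100 * v in x *.
have EX0 : 0 <= EX by rewrite /EX; lra.
have /andP[xl xu] := truncn_expRS EX0; rewrite -/x in xl xu.
have Ml := truncn_expR_ge b1; have Mu := truncn_expR_le b; rewrite -/M in Ml Mu.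
have n0 : 0 < n%:R :> R by apply: lt_le_trans nl; exact: expR_gt0.
have M0 : 0 < M%:R :> R by apply: lt_le_trans Ml; exact: expR_gt0.
have half (y z : R) : y <= z - 1 -> expR y <= expR z / 2.
  move=> yz; apply: (@le_trans _ _ (expR (z - 1))); first by rewrite ler_expR.
  by rewrite expRD ler_pM2l ?expR_gt0// -[leRHS]mul1r expRN1_le.
have Mn2 : M%:R <= n%:R / 2 :> R.
  apply: (le_trans Mu); apply: (@le_trans _ _ (expR (d - ev) / 2)); last by rewrite ler_pM2r.
  by apply: half; lra.
have rn2 : r <= n%:R / 2.
  rewrite rE ler_pM2l//; apply: (le_trans (@half _ 0 _)); first by lra.
  by rewrite expR0; lra.
have Mn : (M < n)%N by rewrite -(ltr_nat R); lra.
have M1 : (0 < M)%N by rewrite -(ltr_nat R).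
have xn : (x <= n)%N.
  rewrite -(ler_nat R); apply: (le_trans xu); apply: le_trans nl; rewrite ler_expR /EX; lra.
have rM : r + M%:R <= n%:R by lra.
split => //; first exact: leq_ltn_trans Mn.
(* This is of order N^(delta / 2): small enough for the conditions on [L], while [n] times the
   offspring tail beyond it, of order c^(-L), is below exp (- T). *)
pose L := Num.truncn (expR (D / 2)).
have D1 : 1 <= D / 2 by lra.
have Ll : expR w <= L%:R.
  by apply: le_trans (truncn_expR_ge D1); rewrite ler_expR; lra.
have jL : (j.+2 <= L)%N by rewrite -(ler_nat R); exact: le_trans Ll.
apply: (le_trans (sum_not_good_le l (isT : (0 < x)%N) xn rM L m_ge0)).
have -> : 2 * expR (- T) = expR (- T) + expR (- T) by ring.
apply: lerD.
  have bd : b <= d by lra.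
  have vD : 3 * v <= D / 4 by lra.
  have vs := le_trans vw ws.
  apply: le_trans (chernoff_estimate m_ge0 m_sum0 m_sum1 C3_gt0 m_sum3 m0_gt0 mj_gt0
    n a0 v0 bd vD vs kv xl xu Ml Mu (truncn_expR_le a) jL (truncn_expR_le (D / 2)) rE) _.
  rewrite ler_expR lerN2; apply: (le_trans Tw).
  apply: (@le_trans _ _ (expR (d - ev - b))); first by rewrite ler_expR; lra.
  rewrite expRD; apply: ler_pM; rewrite ?expR_ge0//.
  by apply: ler_expR_inv.
apply: (le_trans (gwE_maxdeg m_ge0 L n (m_sum0 _) (m_sum1 _))).
apply: (@le_trans _ _ (n%:R * (E / c ^+ L))); first by rewrite ler_wpM2l.
apply: (tail_estimate c_gt1 E_ge0 nu); apply: (le_trans Tw').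
by rewrite ler_wpM2r// ltW// ln_gt0.
Qed.

Lemma decompose_failure (d0 e alpha beta delta epsilon Cp : R) (n0 : nat) :
  0 < e -> 0 < alpha -> 0 < beta -> beta < d0 -> 0 < delta -> 0 < epsilon ->
  0 < 3 / 2 * beta - alpha - d0 - 7 / 2 * delta -> 0 <= Cp ->
  (forall n, (n0 <= n)%N -> expR (- (Cp * ln n%:R ^+ 2)) <= size_pr m n) ->
  exists V, forall u v n, u = expR v -> V <= v ->
    expR (d0 * u - e * v) <= n%:R -> n%:R <= expR (d0 * u + e * v) ->
  let x := (Num.truncn (expR (beta * u - 2 * (delta * u) - 101 / 100 * v))).+1 in
  let M := Num.truncn (expR (beta * u)) in
  let l := Num.truncn (expR (alpha * u)) in
  let r := n%:R * expR (- (delta * u)) in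
  [/\ (M < n)%N, (1 < n)%N, 0 < size_pr m n &
   \sum_(t <- trees_size n | ~~ good_tree x M l n r t) weight m t <=
   expR (- (epsilon * u)) * size_pr m n].
Proof.
move=> e0 al0 be0 bed de0 ep0 slack Cp0 lower.
have d00 : 0 < d0 by lra.
have E0 := E_ge0.
(* The least room left by the three strict inequalities on the exponents, scaled for
   [sum_not_good_estimate]. *)
pose s := Num.min (delta / 4) (Num.min ((d0 - beta) / 4) (3 / 2 * beta - alpha - d0 - 7 / 2 * delta)).
have s0 : 0 < s by rewrite !lt_min slack !divr_gt0// subr_gt0.
have s1 : 4 * s <= delta by rewrite -ler_pdivlMl// mulrC ge_min lexx.
have s2 : 4 * s <= d0 - beta by rewrite -ler_pdivlMl// mulrC !ge_min lexx orbT.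
have s3 : s <= 3 / 2 * beta - alpha - d0 - 7 / 2 * delta by rewrite !ge_min lexx !orbT.
have lc : 0 < ln c by rewrite ln_gt0.
pose W := epsilon + 4 * Cp * d0 ^+ 2 + 1 + 2 * d0 + E.
have Cd0 : 0 <= 4 * Cp * d0 ^+ 2 by rewrite mulr_ge0 ?sqr_ge0// mulr_ge0.
have W0 : 0 <= W by rewrite /W; lra.
have Wc0 : 0 <= W / ln c by rewrite divr_ge0// ltW.
have [V HV] := lnln_dominates e (scale_const m C3 j) (W + W / ln c + j.+2%:R + n0%:R) s0.
exists V => u v n uv Vv nl nu x M l r.
have [kv v0 u1 ve] := HV u v uv Vv.
set w := s * u in ve * => Kw.
have u0 : 0 < u by lra.
have u2 : 1 <= u ^+ 2 by rewrite exprn_ege1.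
have uu2 : u <= u ^+ 2 by rewrite expr2 ler_peMl// ltW.
have ev0 : 0 <= e * v by rewrite mulr_ge0// ltW.
have [evw vw] : e * v <= w /\ 3 * v <= w by split; move: ve; rewrite mulrDl; lra.
have wD : 4 * w <= delta * u by rewrite /w mulrA ler_wpM2r// ltW.
have wd : 4 * w <= d0 * u - beta * u by rewrite /w mulrA -mulrBl ler_wpM2r// ltW.
have ws : w <= 3 / 2 * (beta * u) - alpha * u - d0 * u - 7 / 2 * (delta * u).
  have -> : 3 / 2 * (beta * u) - alpha * u - d0 * u - 7 / 2 * (delta * u) =
    (3 / 2 * beta - alpha - d0 - 7 / 2 * delta) * u by ring.
  by rewrite /w ler_wpM2r// ltW.
have bu0 : 0 <= beta * u by rewrite mulr_ge0// ltW.
have au0 : 0 <= alpha * u by rewrite mulr_ge0// ltW.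
have Kw' (K : R) : 0 <= K -> K <= W + W / ln c + j.+2%:R + n0%:R -> K * u ^+ 2 <= expR w.
  by move=> K0 KK; apply: le_trans Kw; rewrite ler_wpM2r// sqr_ge0.
have Kw1 (K : R) : 0 <= K -> K <= W + W / ln c + j.+2%:R + n0%:R -> K <= expR w.
  by move=> K0 KK; apply: le_trans (Kw' K K0 KK); rewrite ler_peMr.
have j0 : 0 <= j.+2%:R :> R by [].
have n00 : 0 <= n0%:R :> R by [].
have jw : j.+2%:R <= expR w by apply: Kw1 => //; lra.
have nw : n0%:R <= expR w by apply: Kw1 => //; lra.
have Ww : W * u ^+ 2 <= expR w by apply: Kw' => //; lra.
have Wcw : W * u ^+ 2 <= expR w * ln c.
  rewrite -ler_pdivrMr// mulrAC; apply: Kw' => //; lra.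
have n1 : 0 < n%:R :> R by apply: lt_le_trans nl; exact: expR_gt0.
have pn : expR (- (Cp * ln n%:R ^+ 2)) <= size_pr m n.
  apply: lower; rewrite -(ler_nat R); apply: (le_trans nw); apply: le_trans nl.
  by rewrite ler_expR; lra.
have p0 : 0 < size_pr m n by apply: lt_le_trans pn; exact: expR_gt0.
have lnn : Cp * ln n%:R ^+ 2 <= 4 * Cp * d0 ^+ 2 * u ^+ 2.
  have -> : 4 * Cp * d0 ^+ 2 * u ^+ 2 = Cp * (2 * (d0 * u)) ^+ 2 by ring.
  rewrite ler_wpM2l//; apply: lerXn2r; rewrite ?nnegrE.
  - by rewrite ln_ge0// ler1n -(ltr_nat R).
  - by apply: mulr_ge0 => //; apply: mulr_ge0; exact: ltW.
  - by rewrite -[leRHS]expRK ler_ln ?posrE ?expR_gt0//; apply: (le_trans nu); rewrite ler_expR; lra.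
(* The second term pays for dividing by P(|T| = n), and the 1 absorbs the factor 2 of
   [sum_not_good_estimate]. *)
pose T := epsilon * u + Cp * ln n%:R ^+ 2 + 1.
have d0u : 2 * (d0 * u) <= 2 * d0 * u ^+ 2 by rewrite -mulrA ler_pM2l// ler_pM2l.
have epu : epsilon * u <= epsilon * u ^+ 2 by rewrite ler_pM2l.
have Eu : E <= E * u ^+ 2 by rewrite ler_peMr.
have WE : W * u ^+ 2 = epsilon * u ^+ 2 + 4 * Cp * d0 ^+ 2 * u ^+ 2 + u ^+ 2 +
  2 * d0 * u ^+ 2 + E * u ^+ 2 by rewrite /W; ring.
have TW : T + (d0 * u + e * v) + E <= W * u ^+ 2 by rewrite WE /T; lra.
have d0u0 : 0 <= d0 * u by rewrite mulr_ge0// ltW.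
have TW1 : T <= W * u ^+ 2 by apply: le_trans TW; lra.
have [Mn n2 _ _ B] := sum_not_good_estimate au0 v0 ev0 evw vw wD wd ws kv nl nu erefl jw
  (le_trans TW1 Ww) (le_trans TW Wcw).
split => //; apply: (le_trans B).
apply: (@le_trans _ _ (expR (- (epsilon * u)) * expR (- (Cp * ln n%:R ^+ 2)))); last first.
  by rewrite ler_pM2l ?expR_gt0.
have -> : - T = - (epsilon * u) + - (Cp * ln n%:R ^+ 2) + -1 by rewrite /T; ring.
rewrite -expRD [in leLHS]expRD mulrCA ler_piMr ?expR_ge0//.
exact: two_mul_expRN1_le.
Qed.
End Failure.

Theorem theorem13 (R : realType) (mu : probability nat R)
  (mu_mean : ('E_mu[fun i : nat => i%:R] = 1)%E)
  (mu_var : (0 < variance mu (fun i : nat => i%:R : R))%E)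
  (mu_exp : exists2 c : R, 1 < c & (\int[mu]_i (c ^+ i)%:E < +oo)%E)
  (mu_span : is_gcd [set i : nat | (0 < mu [set i])%E] 1)
  (d0 e alpha beta delta epsilon : R)
  (d0_gt0 : 0 < d0) (e_gt0 : 0 < e)
  (alpha_d0 : 0 < alpha < d0)
  (beta_d0 : 0 < beta < d0)
  (delta_d0 : 0 < delta < d0)
  (epsilon0_gt0 : 0 < 3 / 2 * beta - alpha - d0 - 7 / 2 * delta)
  (epsilon_lt : 0 < epsilon < 3 / 2 * beta - alpha - d0 - 7 / 2 * delta)
  (n : nat -> nat)
  (n_bounds : \forall N \near \oo,
     N%:R `^ d0 / ln N%:R `^ e <= (n N)%:R :> R /\
     (n N)%:R <= N%:R `^ d0 * ln N%:R `^ e :> R) :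
  exists C : R, \forall N \near \oo,
  let l := Num.truncn (N%:R `^ alpha : R) in
  let Q := gw_cond mu (n N) in
  exists D : ptree -> option subtree_seq,
  [/\ ((1 - C * N%:R `^ (- epsilon))%:E <= Q [set t | isSome (D t)])%E,
      forall (t : ptree) (s : subtree_seq), #|` verts t| = n N -> D t = Some s ->
      [/\ forall i, (i < size s)%N -> is_rooted_subtree t (sroot s i) (sverts s i),
          forall i, (i < size s)%N ->
            [/\ N%:R `^ (beta - 2 * delta) / ln N%:R `^ (101 / 100)
                  <= #|` sverts s i|%:R :> R,
                #|` sverts s i|%:R <= N%:R `^ beta :> R &
                (l <= size (sroot s i))%N],
          is_tree (hat_verts t s) (hat_edge t s) /\
            #|` hat_verts t s|%:R <= (n N)%:R / N%:R `^ delta :> R &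
          forall i j k, (i < size s)%N -> (j < size s)%N -> (k < size s)%N ->
            j != i -> k != i ->
            forall x y, x \in sverts s j -> y \in sverts s k ->
            same_component t (ancestral_path (sroot s i) l) x y] &
      forall (H : {fset word}) (sizes : seq nat) (locs : seq word),
        let E := skeleton_event D (H, sizes, locs) in
        (0 < Q E)%E ->
        forall A : nat -> set ptree,
        cond_pr Q (shapes_event D A) E =
        \prod_(i < size sizes) fine (gw_cond mu (nth 0%N sizes i) (A i))].
Proof.
have m_ge0 d : 0 <= offspring mu d := offspring_ge0 mu d.
have [c c1 mu_c] := mu_exp.
have [j mj] := offspring_branching mu_mean mu_var.
have m0 := offspring0_gt0 mu_mean mu_var.
have [C3 C30 s3] := offspring_sum3 c1 mu_c.
have [C2 C20 s2] := offspring_sum2 c1 mu_c.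
have s0 := offspring_sum0 mu; have s1 := offspring_sum1 mu_mean.
have [Cp [n0 [Cp0 lower]]] := size_pr_lower m_ge0 (fun L => s0 L.+1) (fun L => s1 L.+1)
  (fun L => s2 L.+1) (offspring_crit mu_mean) m0 mj
  (eq_ind _ (fun A => is_gcd A 1) mu_span _ (support_offspring mu)).
have [[al0 _] [be0 bed] [de0 _] [ep0 _]] : [/\ 0 < alpha /\ alpha < d0, 0 < beta /\ beta < d0,
    0 < delta /\ delta < d0 & 0 < epsilon /\ epsilon < 3 / 2 * beta - alpha - d0 - 7 / 2 * delta].
  by split; apply/andP.
have [V HV] := decompose_failure m_ge0 s0 s1 C30 s3 m0 mj c1 (exp_moment_ge0 c1 mu_c)
  (offspring_tail c1 mu_c) e_gt0 al0 be0 bed de0 ep0 epsilon0_gt0 Cp0 lower.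
(* For large N the failure probability is at most N^(-epsilon) itself, so C = 1. *)
exists 1; apply: filterS2 (near_lnln V) n_bounds => N [N0 u0 Vv].
have powN b : N%:R `^ b = expR (b * ln N%:R) :> R by rewrite /powR gt_eqF.
have powl b : ln N%:R `^ b = expR (b * ln (ln N%:R)) :> R by rewrite /powR gt_eqF.
rewrite !powN !powl -!expRN -!expRD => -[nl nu].
set v := ln (ln N%:R) in Vv nl nu *; set u := ln N%:R in powN nl nu *.
have uv : u = expR v by rewrite lnK ?posrE.
pose x := (Num.truncn (expR (beta * u - 2 * (delta * u) - 101 / 100 * v))).+1.
pose M := Num.truncn (expR (beta * u)); pose l := Num.truncn (expR (alpha * u)).
pose r := (n N)%:R * expR (- (delta * u)).
have [Mn n1 p0 fail] : [/\ (M < n N)%N, (1 < n N)%N, 0 < size_pr (offspring mu) (n N) &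
    \sum_(t <- trees_size (n N) | ~~ good_tree x M l (n N) r t) weight (offspring mu) t <=
    expR (- (epsilon * u)) * size_pr (offspring mu) (n N)] := HV u v (n N) uv Vv nl nu.
exists (decompose x M l (n N) r); split.
- by rewrite mul1r mulNr; exact: decompose_pr p0 fail.
- move=> t sq tn Dt; have [c1' c2 c3 c4] := decompose_spec Mn n1 tn Dt; split => //.
  move=> i il; have [xs sM ls] := c2 i il; split => //.
  (* [x] is the integer part plus one, so it lies above the real threshold. *)
  + rewrite mulrBl -mulrA; apply: (@le_trans _ _ x%:R); last by rewrite ler_nat.
    by have /andP[_ /ltW] := truncn_itv (expR_ge0 (beta * u - 2 * (delta * u) - 101 / 100 * v)).
  + by apply: le_trans (truncn_expR_le (beta * u)); rewrite ler_nat.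
- by move=> H sizes locs Epos A; exact: decompose_cond_pr.
Qed.
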